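(* The parameterized problem Short$_{\text{Breaker}}$ MB Pos Game is $\mathrm{W}[2]$-complete.
   Context: Let $\mathcal{H}=(\mathcal{X},\mathcal{F})$ be a finite hypergraph with vertex set $\mathcal{X}$ and hyperedge set $\mathcal{F}$ (given explicitly by its list of vertices and hyperedges). A transversal of $\mathcal{H}$ is a set of vertices intersecting every hyperedge. In the Maker-Breaker positional game on $\mathcal{H}$, two players, Maker and Breaker, alternately claim one unclaimed vertex of $\mathcal{X}$. Maker wins if she claims all the vertices of some hyperedge; otherwise, i.e. if Breaker manages to claim a transversal of $\mathcal{H}$, Breaker wins. Short$_{\text{Breaker}}$ MB Pos Game is the following parameterized problem. Input: a hypergraph $\mathcal{H}$, the first player (Maker or Breaker), and an integer $k$. Parameter: $k$. Question: does Breaker have a strategy to claim a transversal of $\mathcal{H}$ in at most $k$ moves (i.e. using at most $k$ of his own moves), against every play of Maker? Completeness is with respect to FPT (parameterized) reductions. *)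

(* Defs.v *)
From HB Require Import structures.
From mathcomp Require Import all_boot.

Set Implicit Arguments.
Unset Strict Implicit.
Unset Printing Implicit Defensive.

(** * Model of computation

  The WHILE language on binary trees (N. D. Jones, "Computability and
  Complexity", 1997).  Trees play the role of strings over a finite alphabet.
  Every value computed by a subexpression is charged its size (not unit cost,
  under which iterating [X := cons X X] would produce an exponentially large
  value in linear time), so programs and multitape Turing machines simulate
  each other with polynomial overhead, also when computing functions. *)

Inductive data := Nil | Cons of data & data.

Fixpoint data_eqb (a b : data) : bool :=
  match a, b with
  | Nil, Nil => true
  | Cons a1 a2, Cons b1 b2 => data_eqb a1 b1 && data_eqb a2 b2
  | _, _ => false
  end.

Lemma data_eqP : Equality.axiom data_eqb.
Proof.
move=> a b; apply: (iffP idP) => [|<-]; last first.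
  by elim: a => //= a1 -> a2 ->.
elim: a b => [|a1 IH1 a2 IH2] [|b1 b2] //= /andP[ab1 ab2].
by rewrite (IH1 _ ab1) (IH2 _ ab2).
Qed.

HB.instance Definition _ := hasDecEq.Build data data_eqP.

Fixpoint dsize (a : data) : nat :=
  if a is Cons a1 a2 then (dsize a1 + dsize a2).+1 else 1.

Definition dhd (a : data) : data := if a is Cons a1 _ then a1 else Nil.
Definition dtl (a : data) : data := if a is Cons _ a2 then a2 else Nil.
Definition dbool (b : bool) : data := if b then Cons Nil Nil else Nil.

Inductive expr :=
  | EVar of nat
  | EConst of data
  | ECons of expr & expr
  | EHd of expr
  | ETl of expr
  | EEq of expr & expr.

Definition store := nat -> data.

Fixpoint eval (s : store) (e : expr) : data :=
  match e with
  | EVar x => s x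
  | EConst a => a
  | ECons e1 e2 => Cons (eval s e1) (eval s e2)
  | EHd e1 => dhd (eval s e1)
  | ETl e1 => dtl (eval s e1)
  | EEq e1 e2 => dbool (eval s e1 == eval s e2)
  end.

Fixpoint ecost (s : store) (e : expr) : nat :=
  dsize (eval s e) +
  match e with
  | EVar _ | EConst _ => 0
  | EHd e1 | ETl e1 => ecost s e1
  | ECons e1 e2 | EEq e1 e2 => ecost s e1 + ecost s e2
  end.

Inductive cmd :=
  | CAssign of nat & expr
  | CSeq of cmd & cmd
  | CIf of expr & cmd & cmd
  | CWhile of expr & cmd.

Definition update (s : store) (x : nat) (a : data) : store :=
  fun y => if y == x then a else s y.

(* [exec c s t s']: started in [s], [c] halts in [s'] after time [t].
   In tests, [Nil] is false and everything else is true. *)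
Inductive exec : cmd -> store -> nat -> store -> Prop :=
  | ExecAssign x e s :
      exec (CAssign x e) s (ecost s e) (update s x (eval s e))
  | ExecSeq c1 c2 s t1 s1 t2 s2 :
      exec c1 s t1 s1 -> exec c2 s1 t2 s2 -> exec (CSeq c1 c2) s (t1 + t2) s2
  | ExecIfTrue e c1 c2 s t s1 :
      eval s e <> Nil -> exec c1 s t s1 ->
      exec (CIf e c1 c2) s (ecost s e + t) s1
  | ExecIfFalse e c1 c2 s t s1 :
      eval s e = Nil -> exec c2 s t s1 ->
      exec (CIf e c1 c2) s (ecost s e + t) s1
  | ExecWhileTrue e c s t1 s1 t2 s2 :
      eval s e <> Nil -> exec c s t1 s1 -> exec (CWhile e c) s1 t2 s2 ->
      exec (CWhile e c) s (ecost s e + t1 + t2) s2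
  | ExecWhileFalse e c s :
      eval s e = Nil -> exec (CWhile e c) s (ecost s e) s.

(* Variable 0 holds the input and the output. *)
Definition runs (c : cmd) (input : data) (t : nat) (output : data) : Prop :=
  exists2 s, exec c (update (fun=> Nil) 0 input) t s & s 0 = output.

Definition num (n : nat) : data := iter n (Cons Nil) Nil.
Definition dlist (s : seq data) : data := foldr Cons Nil s.

Definition computable (f : nat -> nat) : Prop :=
  exists c, forall n, exists t, runs c (num n) t (num (f n)).

(** * Parameterized problems and FPT reductions *)

(* Sets of pairs (x, k), where x is the input and k is the parameter. *)
Definition pproblem := data -> nat -> Prop.

Definition fpt_reducible (P Q : pproblem) : Prop :=
  exists (c : cmd) (f g : nat -> nat) (m : nat),
    [/\ computable f, computable g
      & forall (x : data) (k : nat), exists (t : nat) (x' : data) (k' : nat),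
        [/\ runs c (Cons x (num k)) t (Cons x' (num k')),
            t <= f k * dsize x ^ m,
            k' <= g k
          & P x k <-> Q x' k']].

(** * Boolean circuits and the W-hierarchy *)

(* A circuit is the list of its nodes in a topological order; arguments of a
   node are positions of earlier nodes, and the output is the last node.
   Conjunctions and disjunctions of fan-in 0 are the constants. *)
Inductive gate :=
  | GInput
  | GNot of nat
  | GAnd of seq nat
  | GOr of seq nat.

Definition circuit := seq gate.

Definition gate_args (g : gate) : seq nat :=
  match g with
  | GInput => [::]
  | GNot i => [:: i]
  | GAnd s | GOr s => s
  end.

Definition is_input (g : gate) : bool := if g is GInput then true else false.

Definition is_large (g : gate) : bool := 2 < size (gate_args g).

Definition circuit_wf (C : circuit) : bool :=
  (0 < size C) &&
  all (fun i => all (fun j => j < i) (gate_args (nth GInput C i)))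
      (iota 0 (size C)).

(* Attaches a value to every node, given the values of the earlier nodes
   (in order), and returns the value of the output node. *)
Definition fold_circuit (A : Type) (a0 : A) (f : seq A -> gate -> A)
    (C : circuit) : A :=
  last a0 (foldl (fun vs g => rcons vs (f vs g)) [::] C).

(* The assignment [a] gives the value of the input node at position [i] as
   [a i]; its values at positions of other nodes are ignored. *)
Definition gate_value (a : nat -> bool) (vs : seq bool) (g : gate) : bool :=
  match g with
  | GInput => a (size vs)
  | GNot i => ~~ nth false vs i
  | GAnd s => all (nth false vs) s
  | GOr s => has (nth false vs) s
  end.

Definition satisfies (a : nat -> bool) (C : circuit) : bool :=
  fold_circuit false (gate_value a) C.

Definition weight (a : nat -> bool) (C : circuit) : nat :=
  count (fun i => is_input (nth GInput C i) && a i) (iota 0 (size C)).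

Definition gate_depth (ds : seq nat) (g : gate) : nat :=
  if is_input g then 0 else (\max_(i <- gate_args g) nth 0 ds i).+1.

Definition depth (C : circuit) : nat := fold_circuit 0 gate_depth C.

Definition gate_weft (ws : seq nat) (g : gate) : nat :=
  is_large g + \max_(i <- gate_args g) nth 0 ws i.

Definition weft (C : circuit) : nat := fold_circuit 0 gate_weft C.

Definition gate_tag (g : gate) : nat :=
  match g with GInput => 0 | GNot _ => 1 | GAnd _ => 2 | GOr _ => 3 end.

Definition encode_gate (g : gate) : data :=
  Cons (num (gate_tag g)) (dlist [seq num i | i <- gate_args g]).

Definition encode_circuit (C : circuit) : data :=
  dlist [seq encode_gate g | g <- C].

(* Weighted circuit satisfiability for circuits of weft at most [t] and depth
   at most [d]. *)
Definition WCS (t d : nat) : pproblem := fun x k =>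
  exists C : circuit,
    [/\ x = encode_circuit C, circuit_wf C, weft C <= t, depth C <= d
      & exists a : nat -> bool, satisfies a C /\ weight a C = k].

(* The class W[t], for t >= 1. *)
Definition in_W (t : nat) (P : pproblem) : Prop :=
  exists d : nat, 0 < d /\ fpt_reducible P (WCS t d).

Definition W_hard (t : nat) (P : pproblem) : Prop :=
  forall Q : pproblem, in_W t Q -> fpt_reducible Q P.

Definition W_complete (t : nat) (P : pproblem) : Prop :=
  in_W t P /\ W_hard t P.

(** * The Maker-Breaker game *)

Inductive player := Maker | Breaker.

Definition is_breaker (p : player) : bool :=
  if p is Breaker then true else false.

Definition opponent (p : player) : player :=
  if p is Maker then Breaker else Maker.

(* The player making move number [i], counted from 0. *)
Definition mover (first : player) (i : nat) : player :=
  if odd i then opponent first else first.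

Section Game.

Variables (X : finType) (F : {set {set X}}) (first : player).

Definition hyper_transversal (S : {set X}) : Prop :=
  forall e : {set X}, e \in F -> exists2 v : X, v \in e & v \in S.

(* A play is the duplicate-free sequence of the vertices claimed so far, by
   both players, in chronological order. *)

Definition breaker_moves (p : seq X) : seq X :=
  mask [seq is_breaker (mover first i) | i <- iota 0 (size p)] p.

(* The answer to a play may be [None], as there is no move on a full board. *)
Definition strategy := seq X -> option X.

Definition follows (sigma : strategy) (p : seq X) : Prop :=
  forall i, i < size p -> mover first i = Breaker ->
    sigma (take i p) = onth p i.

Definition legal (sigma : strategy) : Prop :=
  forall p : seq X, uniq p -> follows sigma p -> size p < #|X| ->
    mover first (size p) = Breaker ->
    exists2 v : X, sigma p = Some v & v \notin p.

(* Plays run until all the vertices are claimed: if Breaker gets a transversal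
   with his first [k] moves, then Maker never fills a hyperedge, and the rest
   of the play is irrelevant. *)
Definition breaker_wins_within (k : nat) : Prop :=
  exists2 sigma : strategy, legal sigma &
    forall p : seq X, uniq p -> size p = #|X| -> follows sigma p ->
      hyper_transversal [set v in take k (breaker_moves p)].

End Game.

Definition hyperedge_set (n : nat) (es : seq (seq 'I_n)) : {set {set 'I_n}} :=
  [set:: [seq [set v in e] | e <- es]].

(* The vertex set {0, ..., n - 1} is listed explicitly, hence [n] in unary. *)
Definition encode_game (n : nat) (es : seq (seq 'I_n)) (first : player) : data :=
  Cons (num n)
    (Cons (dlist [seq dlist [seq num (v : 'I_n) | v <- e] | e <- es])
      (dbool (is_breaker first))).

Definition short_breaker_MB : pproblem := fun x k =>
  exists (n : nat) (es : seq (seq 'I_n)) (first : player),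
    x = encode_game es first /\
    breaker_wins_within (hyperedge_set es) first k.

(* Main.v *)
Require Import Defs.
From HB Require Import structures.
From mathcomp Require Import all_boot zify.
From Stdlib Require Import IndefiniteDescription.
Import Defs.

Set Implicit Arguments.
Unset Strict Implicit.
Unset Printing Implicit Defensive.

(** Membership.  If Breaker has a winning strategy, he has one which uses only a
  number of vertices bounded in [k]: after his move, fix his plan for the case
  that Maker plays outside this plan, and for every vertex of the plan a plan
  avoiding that vertex.  Such a tree of plans has a fixed shape, computed from
  [k], and an assignment of vertices to its nodes is a winning strategy iff the
  vertices in the plan for a vertex [u] differ from [u] and every branch is a
  transversal, which is a CNF formula, that is, a circuit of weft 2.

  Hardness.  Distributing bottom up, a circuit of weft 2 and depth [d] becomes in
  polynomial time an OR of ANDs of ORs of terms of at most [2 ^ d] literals.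
  Guess the disjunct, the sorted list of the [k] true inputs, and its restriction
  to each choice of [2 ^ d] slots.  Since a false input is located by the two
  consecutive true inputs around it, every term becomes a disjunction of single
  guesses, so the guesses form a hitting set with one vertex per group.  Replacing
  each vertex by as many copies as there are groups makes Maker harmless. *)

(** * Running WHILE programs *)

(** No running time is worked out for a whole reduction. Since every value is charged its size,
    running time bounds output size, so polynomial time is closed under composition, conditionals
    and folds with polynomially bounded accumulators, and the reductions are assembled from such
    pieces. What may exceed every polynomial, the shape of the tree of plans, depends on [k] alone
    and arises by iterating one fixed polynomial step.

    In the hardness part the budget equals the number of groups. A set of that size hitting every
    group has exactly one vertex in each, so not guessing a value is the same as guessing another
    value of the group, and an implication between guesses becomes a plain edge. A term needs a
    joint guess for all its slots because an edge is hit by a single vertex; the groups [nseq q j]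
    are the reference guesses to which all joint guesses are tied. Joint guesses stay polynomial in
    number because [q = 2 ^ d] is a constant. *)

Fixpoint written (c : cmd) : nat :=
  match c with
  | CAssign x _ => x.+1
  | CSeq c1 c2 | CIf _ c1 c2 => maxn (written c1) (written c2)
  | CWhile _ c1 => written c1
  end.

(** This lets a value survive a subprogram: it is parked in a register numbered at least
    [written c]. *)
Lemma exec_frame c s t s' :
  exec c s t s' -> forall x, written c <= x -> s' x = s x.
Proof.
elim=> {c s t s'} //=.
- by move=> x e s y; rewrite /update; case: eqP => // ->; rewrite ltnn.
- move=> c1 c2 s t1 s1 t2 s2 _ IH1 _ IH2 x; rewrite geq_max => /andP[h1 h2].
  by rewrite IH2 // IH1.
- by move=> e c1 c2 s t s1 _ _ IH x; rewrite geq_max => /andP[h1 h2]; apply: IH.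
- by move=> e c1 c2 s t s1 _ _ IH x; rewrite geq_max => /andP[h1 h2]; apply: IH.
- by move=> e c s t1 s1 t2 s2 _ _ IH1 _ IH2 x hx; rewrite IH2 // IH1.
Qed.

Lemma dsize_gt0 a : 0 < dsize a. Proof. by case: a. Qed.

Lemma dsize_eval s e : dsize (eval s e) <= ecost s e.
Proof. by case: e => *; rewrite /= leq_addr. Qed.

(** Every assignment costs at least the size of the value assigned, so time bounds yield size bounds
    for free. *)
Lemma exec_size c s t s' x : exec c s t s' -> dsize (s' x) <= dsize (s x) + t.
Proof.
elim=> {c s t s'} //=; try lia.
move=> y e s; rewrite /update; case: eqP => _; last exact: leq_addr.
by rewrite (leq_trans (dsize_eval s e)) // leq_addl.
Qed.

Definition run (c : cmd) (s : store) (Q : store -> Prop) (B : nat) : Prop :=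
  exists t s', [/\ exec c s t s', t <= B & Q s'].

Lemma run_exec c s t s' (Q : store -> Prop) B :
  exec c s t s' -> t <= B -> Q s' -> run c s Q B.
Proof. by exists t, s'. Qed.

Lemma run_weaken c s (Q : store -> Prop) B1 B2 :
  run c s Q B1 -> B1 <= B2 -> run c s Q B2.
Proof. by case=> t [s' [e b q]] le12; exists t, s'; rewrite (leq_trans b). Qed.

Lemma updateE s x a y : update s x a y = if y == x then a else s y.
Proof. by []. Qed.

(** * Encodings *)

(** [dec] is total and arbitrary on data that encode nothing; such data are recognised by
    [enc (dec x) != x]. *)
HB.mixin Record hasEncoding T of Equality T := {
  enc : T -> data;
  dec : data -> T;
  encK : cancel enc dec
}.

#[short(type="encType")]
HB.structure Definition Encodable := {T of Equality T & hasEncoding T}.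

Fixpoint spine (a : data) : seq data :=
  if a is Cons a1 a2 then a1 :: spine a2 else [::].

Lemma dlistK : cancel dlist spine.
Proof. by elim=> //= a s ->. Qed.

Lemma spineK : cancel spine dlist.
Proof. by elim=> //= a1 _ a2 ->. Qed.

Lemma numE n : num n = dlist (nseq n Nil).
Proof. by elim: n => //= n <-. Qed.

Lemma dsize_num n : dsize (num n) = n.*2.+1.
Proof. by elim: n => //= n ->; lia. Qed.

HB.instance Definition _ := @hasEncoding.Build data id id (fun=> erefl).

Definition dec_nat (a : data) : nat := size (spine a).
Lemma dec_natK : cancel num dec_nat.
Proof. by move=> n; rewrite /dec_nat numE dlistK size_nseq. Qed.
HB.instance Definition _ := hasEncoding.Build nat dec_natK.

Definition dec_bool (a : data) : bool := a != Nil.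
Lemma dec_boolK : cancel dbool dec_bool.
Proof. by case. Qed.
HB.instance Definition _ := hasEncoding.Build bool dec_boolK.

Section PairSeq.
Variables A B : encType.

Definition enc_pair (p : A * B) : data := Cons (enc p.1) (enc p.2).
Definition dec_pair (a : data) : A * B := (dec (dhd a), dec (dtl a)).
Lemma dec_pairK : cancel enc_pair dec_pair.
Proof. by case=> a b; rewrite /dec_pair /= !encK. Qed.

Definition enc_seq (s : seq A) : data := dlist (map enc s).
Definition dec_seq (a : data) : seq A := map dec (spine a).
Lemma dec_seqK : cancel enc_seq dec_seq.
Proof. by move=> s; rewrite /dec_seq dlistK -map_comp (eq_map encK) map_id. Qed.
End PairSeq.

HB.instance Definition _ (A B : encType) :=
  hasEncoding.Build (A * B)%type (@dec_pairK A B).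
HB.instance Definition _ (A : encType) := hasEncoding.Build (seq A) (@dec_seqK A).

Arguments enc : simpl never.

Lemma enc_inj (A : encType) : injective (enc : A -> data).
Proof. exact: can_inj encK. Qed.

Lemma enc_pairE (A B : encType) (a : A) (b : B) :
  enc (a, b) = Cons (enc a) (enc b).
Proof. by []. Qed.

Lemma enc_consE (A : encType) (a : A) s : enc (a :: s) = Cons (enc a) (enc s).
Proof. by []. Qed.

Definition esize (A : encType) (a : A) : nat := dsize (enc a).

Lemma dsize_enc (A : encType) (a : A) : dsize (enc a) = esize a.
Proof. by []. Qed.

Section Esize.
Variables A B : encType.

Lemma esize_gt0 (a : A) : 0 < esize a. Proof. exact: dsize_gt0. Qed.

Lemma esize_pair (a : A) (b : B) : esize (a, b) = (esize a + esize b).+1.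
Proof. by []. Qed.

Lemma esize_cons (a : A) s : esize (a :: s) = (esize a + esize s).+1.
Proof. by []. Qed.

End Esize.

Section EsizeSeq.
Variables A : encType.

Lemma esize_cat (s1 s2 : seq A) : (esize (s1 ++ s2)).+1 = esize s1 + esize s2.
Proof. by elim: s1 => //= a s1 IH; rewrite !esize_cons; lia. Qed.

Lemma esize_rev (s : seq A) : esize (rev s) = esize s.
Proof.
elim: s => // a s IH; apply: succn_inj; rewrite rev_cons -cats1 esize_cat IH.
by rewrite !esize_cons /esize /=; lia.
Qed.

Lemma esize_take i (s : seq A) : esize (take i s) <= esize s.
Proof.
have := esize_cat (take i s) (drop i s); rewrite cat_take_drop.
by have := esize_gt0 (drop i s); lia.
Qed.

Lemma esize_drop i (s : seq A) : esize (drop i s) <= esize s.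
Proof.
have := esize_cat (take i s) (drop i s); rewrite cat_take_drop.
by have := esize_gt0 (take i s); lia.
Qed.

Lemma size_esize (s : seq A) : size s < esize s.
Proof. by elim: s => //= a s IH; rewrite esize_cons; lia. Qed.

Lemma esize_seq_le (s : seq A) m :
  {in s, forall x, esize x <= m} -> esize s <= (size s * m.+1).+1.
Proof.
elim: s => //= a s IH h; rewrite esize_cons mulSn.
have h1 : esize s <= (size s * m.+1).+1.
  by apply: IH => x xs; apply: h; rewrite inE xs orbT.
by have := h a (mem_head _ _); lia.
Qed.

End EsizeSeq.

Lemma esize_flatten (A : encType) (ss : seq (seq A)) :
  esize (flatten ss) <= esize ss.
Proof.
elim: ss => // s ss IH; have := esize_cat s (flatten ss).
by rewrite esize_cons /=; lia.
Qed.

Lemma esize_mem (A : encType) (a : A) (s : seq A) :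
  a \in s -> esize a <= esize s.
Proof.
elim: s => //= b s IH; rewrite inE esize_cons => /predU1P[->|/IH]; lia.
Qed.

Lemma esize_nat n : esize n = n.*2.+1. Proof. exact: dsize_num. Qed.

(** * Polynomial bounds *)

(** The base is at least 2, so raising the exponent absorbs constants and sums, and this single form
    covers all polynomials. *)
Definition poly_bounded (P : nat -> nat) : Prop :=
  exists d, forall n, P n <= n.+2 ^ d.

Lemma leq_pexp2r m n e : m <= n -> m ^ e <= n ^ e.
Proof. by case: e => // e le; rewrite leq_exp2r. Qed.

Lemma leq_add_mul2 x y : 0 < x -> 0 < y -> x + y <= 2 * (x * y).
Proof. by case: x => // x; case: y => // y _ _; nia. Qed.

Lemma pbd_le P Q : poly_bounded Q -> (forall n, P n <= Q n) -> poly_bounded P.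
Proof. by case=> d h le; exists d => n; rewrite (leq_trans (le n)). Qed.

Lemma pbd_const c : poly_bounded (fun=> c).
Proof.
exists c => n; apply: leq_trans (ltnW (ltn_expl c (isT : 1 < 2))) _.
exact: leq_pexp2r.
Qed.

Lemma pbd_id : poly_bounded id.
Proof. by exists 1 => n; rewrite expn1; lia. Qed.

Lemma pbd_add P Q :
  poly_bounded P -> poly_bounded Q -> poly_bounded (fun n => P n + Q n).
Proof.
move=> [d hd] [e he]; exists (d + e).+1 => n.
apply: leq_trans (leq_add (hd n) (he n)) _.
apply: leq_trans (leq_add_mul2 _ _) _; rewrite ?expn_gt0 // expnS expnD.
by rewrite leq_mul.
Qed.

Lemma pbd_mul P Q :
  poly_bounded P -> poly_bounded Q -> poly_bounded (fun n => P n * Q n).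
Proof. by move=> [d hd] [e he]; exists (d + e) => n; rewrite expnD leq_mul. Qed.

Lemma pbd_exp P m : poly_bounded P -> poly_bounded (fun n => P n ^ m).
Proof.
move=> hP; elim: m => [|m IH].
  by apply: (pbd_le (pbd_const 1)) => n; rewrite expn0.
by apply: (pbd_le (pbd_mul hP IH)) => n; rewrite expnS.
Qed.

Lemma pbd_succ P : poly_bounded P -> poly_bounded (fun n => (P n).+1).
Proof.
by move=> hP; apply: (pbd_le (pbd_add hP (pbd_const 1))) => n; rewrite addn1.
Qed.

Ltac pbd := repeat first
  [ exact: pbd_id | apply: pbd_const | apply: pbd_succ | apply: pbd_add
  | apply: pbd_mul | apply: pbd_exp ].

(** * Computations with an explicit time bound *)

Section Computes.
Variables A B : encType.

(** Only register 0 is prescribed. The program must work from any contents of the others, so it can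
    be run after other programs and inside loops. *)
Definition computes (c : cmd) (f : A -> B) (T : A -> nat) : Prop :=
  forall a s, s 0 = enc a -> run c s (fun s' => s' 0 = enc (f a)) (T a).

Lemma computes_esize c f T a : computes c f T -> esize (f a) <= esize a + T a.
Proof.
move=> /(_ a (fun=> enc a) erefl)[t [s' [e b h]]].
have := exec_size 0 e; rewrite h /= /esize.
by move/leq_trans; apply; rewrite leq_add2l.
Qed.

Lemma computes_le c f T T' :
  computes c f T -> (forall a, T a <= T' a) -> computes c f T'.
Proof. by move=> h le a s h0; apply: (run_weaken (h a s h0)). Qed.

Lemma computes_eq c f g T : computes c f T -> f =1 g -> computes c g T.
Proof. by move=> h fg a s h0; rewrite -fg; apply: h. Qed.
End Computes.

Ltac exec_steps :=
  repeat first [eassumption | eapply ExecAssign | eapply ExecSeq].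

Lemma computes_comp (A B C : encType) c1 c2 (f : A -> B) (g : B -> C) T1 T2 :
  computes c1 f T1 -> computes c2 g T2 ->
  computes (CSeq c1 c2) (g \o f) (fun a => T1 a + T2 (f a)).
Proof.
move=> h1 h2 a s h0; have [t1 [s1 [e1 b1 q1]]] := h1 a s h0.
have [t2 [s2 [e2 b2 q2]]] := h2 _ s1 q1.
by apply: run_exec (ExecSeq e1 e2) _ q2; rewrite leq_add.
Qed.

Section Pair.
Variables A B C : encType.

Lemma computes_pair c1 c2 (f : A -> B) (g : A -> C) T1 T2 :
  computes c1 f T1 -> computes c2 g T2 ->
  exists c, computes c (fun a => (f a, g a))
    (fun a => 10 * (esize a + T1 a + T2 a)).
Proof.
move=> h1 h2.
(* Registers [N] and [N.+1] keep the input and the first result out of reach of both programs; the 1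
   keeps them away from register 0. *)
pose N := maxn 1 (maxn (written c1) (written c2)).
exists (CSeq (CAssign N (EVar 0)) (CSeq c1 (CSeq (CAssign N.+1 (EVar 0))
  (CSeq (CAssign 0 (EVar N)) (CSeq c2 (CAssign 0 (ECons (EVar N.+1) (EVar 0)))))))).
move=> a s h0.
have hF := computes_esize a h1; have hG := computes_esize a h2.
have [hN hN1 hN2] : [/\ 0 < N, written c1 <= N & written c2 <= N] by rewrite /N; split; lia.
have ha := esize_gt0 a.
pose s1 := update s N (s 0).
have [|t2 [s2 [e2 b2 q2]]] := h1 a s1; first by rewrite /s1 updateE ltn_eqF.
have fr2 := exec_frame e2.
pose s3 := update s2 N.+1 (s2 0); pose s4 := update s3 0 (s3 N).
have s3N : s3 N = enc a.
  by rewrite /s3 updateE ltn_eqF // fr2 // /s1 updateE eqxx.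
have [|t5 [s5 [e5 b5 q5]]] := h2 a s4; first by rewrite /s4 updateE eqxx.
have s5N : s5 N.+1 = enc (f a).
  by rewrite (exec_frame e5) ?leqW // /s4 updateE /= /s3 updateE eqxx.
apply: run_exec.
- by exec_steps.
- rewrite /= -/s3 h0 q2 s3N s5N q5 !dsize_enc; lia.
- by rewrite updateE /= s5N q5.
Qed.
End Pair.
Section If.
Variables A B : encType.

Lemma computes_if c0 c1 c2 (b : A -> bool) (f g : A -> B) T0 T1 T2 :
  computes c0 b T0 -> computes c1 f T1 -> computes c2 g T2 ->
  exists c, computes c (fun a => if b a then f a else g a)
    (fun a => 5 * esize a + T0 a + (if b a then T1 a else T2 a)).
Proof.
move=> h0 h1 h2; pose N := (written c0).+1.
exists (CSeq (CAssign N (EVar 0)) (CSeq c0 (CIf (EVar 0)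
  (CSeq (CAssign 0 (EVar N)) c1) (CSeq (CAssign 0 (EVar N)) c2)))).
move=> a s s0; pose s1 := update s N (s 0).
have [//|t2 [s2 [e2 b2 q2]]] := h0 a s1.
have s2N : s2 N = enc a by rewrite (exec_frame e2) // /s1 updateE eqxx.
pose s3 := update s2 0 (s2 N).
have ha := esize_gt0 a.
case: (b a) q2 => q2.
  have [//|t4 [s4 [e4 b4 q4]]] := h1 a s3.
  apply: run_exec q4.
  - apply: ExecSeq; first by exec_steps.
    apply: ExecSeq; first by exec_steps.
    by apply: ExecIfTrue; [rewrite /= q2|exec_steps].
  - by rewrite /= s0 q2 s2N !dsize_enc -[esize true]/3; lia.
have [//|t4 [s4 [e4 b4 q4]]] := h2 a s3.
apply: run_exec q4.
- apply: ExecSeq; first by exec_steps.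
  apply: ExecSeq; first by exec_steps.
  by apply: ExecIfFalse; [rewrite /= q2|exec_steps].
- by rewrite /= s0 q2 s2N !dsize_enc -[esize false]/1; lia.
Qed.
End If.

Section Fold.
Variables X S B : encType.
Variables (f : X -> S -> B -> S) (T : X * (S * B) -> nat).

(** Each round also pays for the whole remaining list, which the loop test and the step to its tail
    evaluate. *)
Fixpoint fold_cost (x : X) (s : S) (l : seq B) : nat :=
  10 * (esize x + esize s + esize l) +
  if l is y :: l' then
    esize (f x s y) + T (x, (s, y)) + fold_cost x (f x s y) l'
  else 0.

Lemma computes_foldl c :
  computes c (fun p : X * (S * B) => f p.1 p.2.1 p.2.2) T ->
  exists c', computes c'
    (fun p : X * (S * seq B) => foldl (f p.1) p.2.1 p.2.2)
    (fun p => 10 * esize p + fold_cost p.1 p.2.1 p.2.2).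
Proof.
move=> hc; pose N := (written c).+1.
(* Register [N] holds the context [x], [N.+1] the rest of the list and [N.+2] the accumulator. *)
pose body := CSeq (CAssign 0 (ECons (EVar N) (ECons (EVar N.+2) (EHd (EVar N.+1)))))
  (CSeq c (CSeq (CAssign N.+2 (EVar 0)) (CAssign N.+1 (ETl (EVar N.+1))))).
have loop x : forall l a s,
    [/\ s N = enc x, s N.+1 = enc l & s N.+2 = enc a] ->
    run (CSeq (CWhile (EVar N.+1) body) (CAssign 0 (EVar N.+2))) s
      (fun s' => s' 0 = enc (foldl (f x) a l)) (fold_cost x a l).
  elim=> [|y l IH] a s [sN sN1 sN2].
    apply: run_exec.
    - apply: ExecSeq; last exact: ExecAssign.
      by apply: ExecWhileFalse; rewrite /= sN1.
    - by rewrite /= sN1 sN2 /= dsize_enc; have := esize_gt0 a; lia.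
    - by rewrite updateE.
  pose s1 := update s 0 (Cons (s N) (Cons (s N.+2) (dhd (s N.+1)))).
  have [|t2 [s2 [e2 b2 q2]]] := hc (x, (a, y)) s1.
    by rewrite /s1 updateE /= sN sN1 sN2.
  have fr z : N <= z -> s2 z = s z.
    by move=> hz; rewrite (exec_frame e2) 1?ltnW // /s1 updateE gtn_eqF // (leq_trans _ hz).
  pose s3 := update s2 N.+2 (s2 0).
  pose s4 := update s3 N.+1 (dtl (s3 N.+1)).
  have s3N1 : s3 N.+1 = enc (y :: l) by rewrite /s3 updateE ltn_eqF // fr.
  have [|t5 [s5 [e5 b5 q5]]] := IH (f x a y) s4.
    split; rewrite /s4 updateE ?eqxx.
    - by rewrite ltn_eqF // /s3 updateE ltn_eqF // fr.
    - by rewrite s3N1.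
    - by rewrite gtn_eqF // /s3 updateE eqxx.
  case: (boolP (enc (y :: l) == Nil)) => [//|_].
  (* The induction hypothesis runs the loop together with the final assignment; they are separated
     so that one more round can be put in front of the loop. *)
  inversion e5 as [|c1 c2 st t6 s6 t7 s7 e6 e7| | | |]; subst.
  apply: run_exec q5.
  - apply: ExecSeq e7; apply: ExecWhileTrue e6; first by rewrite /= sN1.
    by exec_steps.
  - rewrite /= -/s3 s3N1 sN sN1 sN2 q2 enc_consE /= !dsize_enc.
    by move: b2 b5; rewrite /= esize_cons; lia.
exists (CSeq (CAssign N (EHd (EVar 0)))
  (CSeq (CAssign N.+1 (ETl (ETl (EVar 0))))
  (CSeq (CAssign N.+2 (EHd (ETl (EVar 0))))
  (CSeq (CWhile (EVar N.+1) body) (CAssign 0 (EVar N.+2)))))).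
case=> x [a l] s s0.
pose s1 := update s N (dhd (s 0)).
pose s2 := update s1 N.+1 (dtl (dtl (s1 0))).
pose s3 := update s2 N.+2 (dhd (dtl (s2 0))).
have s10 : s1 0 = enc (x, (a, l)) by rewrite /s1 updateE.
have s20 : s2 0 = enc (x, (a, l)) by rewrite /s2 updateE.
have [|t4 [s4 [e4 b4 q4]]] := loop x l a s3.
  rewrite /s3 !updateE eqxx !ltn_eqF // s20; split=> //.
    by rewrite /s2 updateE ltn_eqF // /s1 updateE eqxx s0.
  by rewrite /s2 updateE eqxx s10.
apply: run_exec q4.
- by exec_steps.
- rewrite /= -/s1 -/s2 s0 s10 s20 !enc_pairE /= !dsize_enc !esize_pair.
  by lia.
Qed.

Lemma fold_cost_le m x a l n :
  (forall p, T p <= (esize p).+2 ^ m) -> esize x + esize l <= n ->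
  (forall i, esize (foldl (f x) a (take i l)) <= n) ->
  fold_cost x a l <= n * (30 * n + (2 * n).+4 ^ m).
Proof.
move=> hT.
suff h : forall l a, esize x + esize l <= n ->
    (forall i, esize (foldl (f x) a (take i l)) <= n) ->
    fold_cost x a l <= (size l).+1 * (30 * n + (2 * n).+4 ^ m).
  move=> hl ha; apply: leq_trans (h l a hl ha) _.
  rewrite leq_mul2r; apply/orP; right.
  by have := size_esize l; have := esize_gt0 x; lia.
elim=> {a l} [|y l IH] a hl ha.
  by have := ha 0; rewrite /= mul1n; lia.
rewrite mulSn.
have ha0 : esize a <= n by have := ha 0.
have ha1 : esize (f x a y) <= n by have := ha 1; rewrite /= take0.
move: hl; rewrite /= esize_cons => hl.
have h1 : T (x, (a, y)) <= (2 * n).+4 ^ m.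
  apply: leq_trans (hT _) _; apply: leq_pexp2r; rewrite !esize_pair; lia.
have h2 : fold_cost x (f x a y) l <= (size l).+1 * (30 * n + (2 * n).+4 ^ m).
  by apply: IH; [lia|move=> i; apply: (ha i.+1)].
by lia.
Qed.
End Fold.

(** * Polynomial time *)


Definition ptime (A B : encType) (f : A -> B) : Prop :=
  exists c m, computes c f (fun a => (esize a).+2 ^ m).

(** Computable with an arbitrary time bound: the notion for functions of the parameter alone. *)
Definition effective (A B : encType) (f : A -> B) : Prop :=
  exists c T, computes c f T.

Section PtimeBasics.
Variables A B : encType.

Lemma ptime_intro c (f : A -> B) T P :
  computes c f T -> poly_bounded P -> (forall a, T a <= P (esize a)) -> ptime f.
Proof.
move=> h [d hd] le; exists c, d; apply: computes_le h _ => a.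
exact: leq_trans (le a) (hd _).
Qed.

Lemma ptime_eq (f g : A -> B) : ptime f -> f =1 g -> ptime g.
Proof. by move=> [c [m h]] fg; exists c, m; apply: computes_eq h fg. Qed.

Lemma ptime_esize (f : A -> B) :
  ptime f -> exists d, forall a, esize (f a) <= (esize a).+2 ^ d.
Proof.
move=> [c [m h]].
have [d hd] : poly_bounded (fun n => n + n.+2 ^ m) by pbd.
exists d => a; exact: leq_trans (computes_esize a h) (hd _).
Qed.

Lemma ptime_effective (f : A -> B) : ptime f -> effective f.
Proof. by case=> c [m h]; exists c, (fun a => (esize a).+2 ^ m). Qed.

End PtimeBasics.

Section Ptime.
Variables A B C : encType.

(* The encodings of [f a] and [g a] may agree in different types, e.g. for a
   number and the list of as many [Nil]'s. *)
Lemma ptime_cast (f : A -> B) (g : A -> C) :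
  ptime f -> (forall a, enc (f a) = enc (g a)) -> ptime g.
Proof. by move=> [c [m h]] fg; exists c, m => a s s0; rewrite -fg; apply: h. Qed.

Lemma ptime_comp (g : B -> C) (f : A -> B) :
  ptime g -> ptime f -> ptime (fun a => g (f a)).
Proof.
move=> [c2 [m2 h2]] hf; have [d hd] := ptime_esize hf.
have [c1 [m1 h1]] := hf.
have h : computes (CSeq c1 c2) (fun a => g (f a))
    (fun a => (esize a).+2 ^ m1 + (esize (f a)).+2 ^ m2).
  exact: computes_comp h1 h2.
apply: (ptime_intro h (P := fun n => n.+2 ^ m1 + (n.+2 ^ d).+2 ^ m2)).
  by pbd.
by move=> a; rewrite leq_add2l leq_pexp2r // !ltnS.
Qed.

Lemma ptime_pair (f : A -> B) (g : A -> C) :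
  ptime f -> ptime g -> ptime (fun a => (f a, g a)).
Proof.
move=> [c1 [m1 h1]] [c2 [m2 h2]]; have [c h] := computes_pair h1 h2.
apply: (ptime_intro h (P := fun n => 10 * (n + n.+2 ^ m1 + n.+2 ^ m2))) => //.
by pbd.
Qed.

Lemma ptime_if (b : A -> bool) (f g : A -> B) :
  ptime b -> ptime f -> ptime g -> ptime (fun a => if b a then f a else g a).
Proof.
move=> [c0 [m0 h0]] [c1 [m1 h1]] [c2 [m2 h2]].
have [c h] := computes_if h0 h1 h2.
apply: (ptime_intro h
  (P := fun n => 5 * n + n.+2 ^ m0 + (n.+2 ^ m1 + n.+2 ^ m2))).
  by pbd.
by move=> a; rewrite leq_add2l; case: ifP => _; rewrite ?leq_addr ?leq_addl.
Qed.

Lemma effective_comp (g : B -> C) (f : A -> B) :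
  effective g -> effective f -> effective (fun a => g (f a)).
Proof.
move=> [c2 [T2 h2]] [c1 [T1 h1]]; exists (CSeq c1 c2), (fun a => T1 a + T2 (f a)).
exact: computes_comp.
Qed.

Lemma effective_pair (f : A -> B) (g : A -> C) :
  effective f -> effective g -> effective (fun a => (f a, g a)).
Proof.
move=> [c1 [T1 h1]] [c2 [T2 h2]]; have [c h] := computes_pair h1 h2.
by exists c; eexists; exact: h.
Qed.
End Ptime.

Lemma ptime_comp2 (X A B C : encType) (g : A -> B -> C) (a : X -> A) (b : X -> B) :
  ptime (fun p : A * B => g p.1 p.2) -> ptime a -> ptime b ->
  ptime (fun x => g (a x) (b x)).
Proof.
move=> hg ha hb.
exact: (@ptime_comp _ _ _ (fun p : A * B => g p.1 p.2) (fun x => (a x, b x)) hg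
  (ptime_pair ha hb)).
Qed.

Section Expressions.

Fixpoint unary (e : expr) : bool :=
  match e with
  | EVar x => x == 0
  | EConst _ => true
  | EHd e1 | ETl e1 => unary e1
  | ECons e1 e2 | EEq e1 e2 => unary e1 && unary e2
  end.

Fixpoint ecost_factor (e : expr) : nat :=
  match e with
  | EVar _ => 1
  | EConst a => dsize a
  | EHd e1 | ETl e1 => 2 * ecost_factor e1
  | ECons e1 e2 | EEq e1 e2 => 3 + 2 * (ecost_factor e1 + ecost_factor e2)
  end.

Lemma ecost_linear s e : unary e -> ecost s e <= ecost_factor e * dsize (s 0).
Proof.
have h0 := dsize_gt0 (s 0).
have hd1 a : dsize (dhd a) <= dsize a by case: a => //= a b; lia.
have tl1 a : dsize (dtl a) <= dsize a by case: a => //= a b; lia.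
have b3 b : dsize (dbool b) <= 3 by case: b.
elim: e => [x /eqP ->|a _|e1 IH1 e2 IH2 /= /andP[u1 u2]|e IH /= u|e IH /= u|
            e1 IH1 e2 IH2 /= /andP[u1 u2]] /=.
- by lia.
- by rewrite addn0 leq_pmulr.
- by have := IH1 u1; have := IH2 u2; have := dsize_eval s e1; have := dsize_eval s e2; nia.
- by have := IH u; have := dsize_eval s e; have := hd1 (eval s e); nia.
- by have := IH u; have := dsize_eval s e; have := tl1 (eval s e); nia.
- by have := IH1 u1; have := IH2 u2; have := b3 (eval s e1 == eval s e2); nia.
Qed.

(** The source of all primitive operations: a fixed expression in register 0 is evaluated in linear
    time, as a constructor only adds the sizes of its arguments. *)
Lemma ptime_expr (A B : encType) (e : expr) (f : A -> B) :
  unary e -> (forall a s, s 0 = enc a -> eval s e = enc (f a)) -> ptime f.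
Proof.
move=> u h; apply: (@ptime_intro _ _ (CAssign 0 e) f
  (fun a => ecost_factor e * esize a) (fun n => ecost_factor e * n)) => //.
  move=> a s s0; apply: run_exec (ExecAssign _ _ _) _ _.
    by rewrite /esize -s0; apply: ecost_linear.
  by rewrite updateE /=; apply: h.
by pbd.
Qed.

Lemma ptime_id (X : encType) : ptime (fun x : X => x).
Proof. exact: (@ptime_expr _ _ (EVar 0)). Qed.

Lemma ptime_const (X A : encType) (a : A) : ptime (fun _ : X => a).
Proof. exact: (@ptime_expr _ _ (EConst (enc a))). Qed.
End Expressions.

Section PtimeFold.
Variables X S B : encType.

(** A polynomial step does not suffice, since an accumulator that doubles in every round becomes
    exponential; hence the bound on all intermediate accumulators. *)
Lemma ptime_foldl (f : X -> S -> B -> S) (a : X -> S) (l : X -> seq B) :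
  ptime (fun p : X * (S * B) => f p.1 p.2.1 p.2.2) -> ptime a -> ptime l ->
  (exists d, forall x i, esize (foldl (f x) (a x) (take i (l x))) <= (esize x).+2 ^ d) ->
  ptime (fun x => foldl (f x) (a x) (l x)).
Proof.
move=> [c [m hc]] ha hl [d hd].
have [c' hc'] := computes_foldl hc.
have [c1 [m1 h1]] := ptime_pair (ptime_id X) (ptime_pair ha hl).
have [e he] := ptime_esize hl.
have [e' he'] := ptime_esize ha.
pose N n := n + n.+2 ^ e + n.+2 ^ d + n.+2 ^ e'.
pose P n := n.+2 ^ m1 + (30 * (N n).+2 + N n * (30 * N n + (2 * N n).+4 ^ m)).
have h : computes (CSeq c1 c') (fun x => foldl (f x) (a x) (l x))
    (fun x => (esize x).+2 ^ m1 + (10 * esize (x, (a x, l x)) +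
       fold_cost f (fun p => (esize p).+2 ^ m) x (a x) (l x))).
  exact: computes_comp h1 hc'.
apply: (ptime_intro h (P := P)).
  by rewrite /P /N; pbd.
move=> x; rewrite leq_add2l /= leq_add //.
  by rewrite !esize_pair /N; have := he x; have := he' x; have := esize_gt0 x; lia.
apply: fold_cost_le => [//||i].
  by rewrite /N; have := he x; lia.
by rewrite /N; have := hd x i; lia.
Qed.
End PtimeFold.

Section EffectiveFold.
Variables X S B : encType.

Lemma effective_foldl (f : X -> S -> B -> S) (a : X -> S) (l : X -> seq B) :
  effective (fun p : X * (S * B) => f p.1 p.2.1 p.2.2) ->
  effective a -> effective l ->
  effective (fun x => foldl (f x) (a x) (l x)).
Proof.
move=> [c [T hc]] ha hl.
have [c' hc'] := computes_foldl hc.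
have hp := effective_pair (ptime_effective (ptime_id X)) (effective_pair ha hl).
exact: (effective_comp (g := fun p : X * (S * seq B) => foldl (f p.1) p.2.1 p.2.2)
  (ex_intro _ c' (ex_intro _ _ hc')) hp).
Qed.
End EffectiveFold.

Lemma ptime_fst (X A B : encType) (p : X -> A * B) :
  ptime p -> ptime (fun x => (p x).1).
Proof.
by apply: ptime_comp; apply: (@ptime_expr _ _ (EHd (EVar 0))) => // -[a b] s /= ->.
Qed.

Lemma ptime_snd (X A B : encType) (p : X -> A * B) :
  ptime p -> ptime (fun x => (p x).2).
Proof.
by apply: ptime_comp; apply: (@ptime_expr _ _ (ETl (EVar 0))) => // -[a b] s /= ->.
Qed.

Lemma ptime_cons (X A : encType) (a : X -> A) (l : X -> seq A) :
  ptime a -> ptime l -> ptime (fun x => a x :: l x).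
Proof.
apply: ptime_comp2; apply: (@ptime_expr _ _ (EVar 0)) => // -[b s] st /= ->.
Qed.

Lemma ptime_behead (X A : encType) (l : X -> seq A) :
  ptime l -> ptime (fun x => behead (l x)).
Proof.
by apply: ptime_comp; apply: (@ptime_expr _ _ (ETl (EVar 0))) => // -[|b l'] s /= ->.
Qed.

Lemma ptime_eq_op (X A : encType) (a b : X -> A) :
  ptime a -> ptime b -> ptime (fun x => a x == b x).
Proof.
apply: ptime_comp2.
apply: (@ptime_expr _ _ (EEq (EHd (EVar 0)) (ETl (EVar 0)))) => // -[u v] s /= ->.
by rewrite /= (inj_eq (@enc_inj A)).
Qed.

Lemma ptime_head (X A : encType) (d : A) (l : X -> seq A) :
  ptime l -> ptime (fun x => head d (l x)).
Proof.
(* On an empty list [dhd] returns [Nil], which need not encode an element of [A], so the case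
   distinction is made in [data] and decoded afterwards. *)
move=> hl; apply: (@ptime_eq _ _ (fun x => dec
   (if l x == [::] then enc d else dhd (enc (l x))))); last first.
  by move=> x; case: (l x) => [|b l'] /=; rewrite encK.
apply: (@ptime_cast _ data _
  (fun x => if l x == [::] then enc d else dhd (enc (l x)))).
  apply: ptime_if; last 1 first.
  - apply: (@ptime_comp _ _ _ (fun s : seq A => dhd (enc s))) => //.
    by apply: (@ptime_expr _ _ (EHd (EVar 0))) => // s st /= ->.
  - by apply: ptime_eq_op => //; apply: ptime_const.
  - exact: (@ptime_const _ data).
by move=> x; case: (l x) => [|b l'] /=; rewrite encK.
Qed.

Lemma ptime_succ (X : encType) (n : X -> nat) : ptime n -> ptime (fun x => (n x).+1).
Proof.
by apply: ptime_comp; apply: (@ptime_expr _ _ (ECons (EConst Nil) (EVar 0))) => //= n' s ->.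
Qed.

Lemma ptime_pred (X : encType) (n : X -> nat) : ptime n -> ptime (fun x => (n x).-1).
Proof.
by apply: ptime_comp; apply: (@ptime_expr _ _ (ETl (EVar 0))) => // -[|m] s /= ->.
Qed.

Lemma ptime_negb (X : encType) (b : X -> bool) : ptime b -> ptime (fun x => ~~ b x).
Proof.
apply: ptime_comp; apply: (@ptime_expr _ _ (EEq (EVar 0) (EConst Nil))) => //.
by case=> s /= ->.
Qed.

Lemma ptime_andb (X : encType) (b c : X -> bool) :
  ptime b -> ptime c -> ptime (fun x => b x && c x).
Proof. by move=> hb hc; apply: ptime_if => //; apply: ptime_const. Qed.

Lemma ptime_orb (X : encType) (b c : X -> bool) :
  ptime b -> ptime c -> ptime (fun x => b x || c x).
Proof. by move=> hb hc; apply: ptime_if => //; apply: ptime_const. Qed.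

Lemma ptime_implb (X : encType) (b c : X -> bool) :
  ptime b -> ptime c -> ptime (fun x => b x ==> c x).
Proof. by move=> hb hc; apply: ptime_if => //; apply: ptime_const. Qed.

(** A number and the list of as many [Nil]s are the same datum, so arithmetic reduces to list
    processing and a loop of [n] rounds is a fold over this list. *)
Lemma ptime_nseq_Nil (X : encType) (n : X -> nat) :
  ptime n -> ptime (fun x => nseq (n x) Nil).
Proof.
move=> hn; apply: (ptime_cast hn) => x.
by rewrite [LHS]numE [RHS]/enc /= /enc_seq map_nseq.
Qed.

Lemma ptime_spine (X : encType) (a : X -> data) : ptime a -> ptime (fun x => spine (a x)).
Proof.
move=> ha; apply: (ptime_cast ha) => x.
by rewrite [RHS]/enc /= /enc_seq (eq_map (g := id)) // map_id spineK.
Qed.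

Lemma ptime_dhd (X : encType) (a : X -> data) : ptime a -> ptime (fun x => dhd (a x)).
Proof.
by apply: ptime_comp; apply: (@ptime_expr _ _ (EHd (EVar 0))) => // a' s /= ->.
Qed.

Lemma ptime_dtl (X : encType) (a : X -> data) : ptime a -> ptime (fun x => dtl (a x)).
Proof.
by apply: ptime_comp; apply: (@ptime_expr _ _ (ETl (EVar 0))) => // a' s /= ->.
Qed.

Lemma ptime_enc (X A : encType) (a : X -> A) : ptime a -> ptime (fun x => enc (a x)).
Proof. by move=> ha; apply: (ptime_cast ha). Qed.

Lemma ptime_catrev (X A : encType) (l1 l2 : X -> seq A) :
  ptime l1 -> ptime l2 -> ptime (fun x => catrev (l1 x) (l2 x)).
Proof.
move=> h1 h2.
have e (s1 s2 : seq A) : foldl (fun s y => y :: s) s2 s1 = catrev s1 s2.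
  by elim: s1 s2 => //= a s1 IH s2; rewrite IH.
apply: (@ptime_eq _ _ (fun x => foldl (fun s y => y :: s) (l2 x) (l1 x))) => //.
apply: (@ptime_foldl _ _ _ (fun _ s y => y :: s)) => //.
  apply: ptime_cons; first exact: ptime_snd (ptime_snd (ptime_id _)).
  exact: ptime_fst (ptime_snd (ptime_id _)).
have [d1 hd1] := ptime_esize h1; have [d2 hd2] := ptime_esize h2.
have [d hd] : poly_bounded (fun n => n.+2 ^ d1 + n.+2 ^ d2) by pbd.
exists d => x i; apply: leq_trans (hd _); rewrite e catrevE.
have := esize_cat (rev (take i (l1 x))) (l2 x); rewrite esize_rev.
by have := esize_take i (l1 x); have := hd1 x; have := hd2 x; lia.
Qed.

Lemma ptime_rev (X A : encType) (l : X -> seq A) :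
  ptime l -> ptime (fun x => rev (l x)).
Proof. by move=> hl; apply: ptime_catrev => //; apply: ptime_const. Qed.

Lemma ptime_cat (X A : encType) (l1 l2 : X -> seq A) :
  ptime l1 -> ptime l2 -> ptime (fun x => l1 x ++ l2 x).
Proof.
move=> h1 h2; apply: (@ptime_eq _ _ (fun x => catrev (rev (l1 x)) (l2 x))).
  by apply: ptime_catrev => //; apply: ptime_rev.
by move=> x; rewrite catrevE revK.
Qed.

Lemma ptime_rcons (X A : encType) (l : X -> seq A) (a : X -> A) :
  ptime l -> ptime a -> ptime (fun x => rcons (l x) (a x)).
Proof.
move=> hl ha; apply: (@ptime_eq _ _ (fun x => l x ++ [:: a x])).
  by apply: ptime_cat => //; apply: ptime_cons => //; apply: ptime_const.
by move=> x; rewrite cats1.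
Qed.

Lemma ptime_map (X A B : encType) (f : X -> A -> B) (l : X -> seq A) :
  ptime (fun p : X * A => f p.1 p.2) -> ptime l ->
  ptime (fun x => [seq f x y | y <- l x]).
Proof.
move=> hf hl.
have e x (s : seq A) t :
    foldl (fun t y => f x y :: t) t s = rev [seq f x y | y <- s] ++ t.
  by elim: s t => //= a s IH t; rewrite IH rev_cons cat_rcons.
apply: (@ptime_eq _ _ (fun x => rev (foldl (fun t y => f x y :: t) [::] (l x)))).
  apply: ptime_rev; apply: (@ptime_foldl _ _ _ (fun x t y => f x y :: t)) => //.
  - apply: ptime_cons; last exact: ptime_fst (ptime_snd (ptime_id _)).
    apply: (ptime_comp2 hf); first exact: ptime_fst (ptime_id _).
    exact: ptime_snd (ptime_snd (ptime_id _)).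
  - exact: ptime_const.
  have [d1 hd1] := ptime_esize hf; have [d2 hd2] := ptime_esize hl.
  have [d hd] : poly_bounded (fun n =>
    (n.+2 ^ d2 * ((n + n.+2 ^ d2).+3 ^ d1).+1).+1) by pbd.
  exists d => x i; apply: leq_trans (hd _); rewrite e cats0 esize_rev.
  apply: leq_trans (esize_seq_le (m := (esize x + (esize x).+2 ^ d2).+3 ^ d1) _) _.
    move=> _ /mapP[y /mem_take/esize_mem yl ->].
    apply: leq_trans (hd1 (x, y)) _; apply: leq_pexp2r; rewrite esize_pair !ltnS.
    by rewrite leq_add2l (leq_trans yl).
  rewrite ltnS leq_mul2r size_map; apply/orP; right.
  apply: leq_trans (hd2 x); apply: leq_trans (ltnW (size_esize _)) _.
  exact: esize_take.
by move=> x; rewrite e cats0 revK.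
Qed.

Lemma ptime_flatten (X A : encType) (l : X -> seq (seq A)) :
  ptime l -> ptime (fun x => flatten (l x)).
Proof.
move=> hl.
have e (s : seq (seq A)) t : foldl cat t s = t ++ flatten s.
  by elim: s t => /= [|a s IH] t; rewrite ?cats0 // IH catA.
apply: (@ptime_eq _ _ (fun x => foldl cat [::] (l x))); last first.
  by move=> x; rewrite e.
apply: (@ptime_foldl _ _ _ (fun=> cat)) => //.
- apply: ptime_cat; first exact: ptime_fst (ptime_snd (ptime_id _)).
  exact: ptime_snd (ptime_snd (ptime_id _)).
- exact: ptime_const.
have [d hd] := ptime_esize hl.
exists d => x i; apply: leq_trans (hd _); rewrite e.
by apply: leq_trans (esize_flatten _) _; apply: esize_take.
Qed.

Lemma ptime_filter (X A : encType) (p : X -> pred A) (l : X -> seq A) :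
  ptime (fun q : X * A => p q.1 q.2) -> ptime l ->
  ptime (fun x => [seq y <- l x | p x y]).
Proof.
move=> hp hl.
apply: (@ptime_eq _ _ (fun x => flatten [seq if p x y then [:: y] else [::] | y <- l x])).
  apply: ptime_flatten; apply: ptime_map => //; apply: ptime_if => //.
    by apply: ptime_cons; [exact: ptime_snd (ptime_id _)|exact: ptime_const].
  exact: ptime_const.
by move=> x; elim: (l x) => //= a s ->; case: (p x a).
Qed.

Lemma ptime_has (X A : encType) (p : X -> pred A) (l : X -> seq A) :
  ptime (fun q : X * A => p q.1 q.2) -> ptime l ->
  ptime (fun x => has (p x) (l x)).
Proof.
move=> hp hl; apply: (@ptime_eq _ _ (fun x => filter (p x) (l x) != [::])).
  apply: ptime_negb; apply: ptime_eq_op; first exact: ptime_filter.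
  exact: ptime_const.
by move=> x; rewrite has_filter.
Qed.

Lemma ptime_all (X A : encType) (p : X -> pred A) (l : X -> seq A) :
  ptime (fun q : X * A => p q.1 q.2) -> ptime l ->
  ptime (fun x => all (p x) (l x)).
Proof.
move=> hp hl; apply: (@ptime_eq _ _ (fun x => ~~ has (predC (p x)) (l x))).
  apply: ptime_negb; apply: (@ptime_has _ _ (fun x => predC (p x))) => //.
  exact: ptime_negb.
by move=> x; rewrite -all_predC; apply: eq_all => y /=; rewrite negbK.
Qed.

Lemma ptime_mem (X A : encType) (a : X -> A) (l : X -> seq A) :
  ptime a -> ptime l -> ptime (fun x => a x \in l x).
Proof.
move=> ha hl; apply: (@ptime_eq _ _ (fun x => has (fun y => y == a x) (l x))).
  apply: (@ptime_has _ _ (fun x y => y == a x)) => //.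
  apply: ptime_eq_op; first exact: ptime_snd (ptime_id _).
  exact: ptime_comp ha (ptime_fst (ptime_id _)).
by move=> x; rewrite has_pred1.
Qed.

Lemma ptime_size (X A : encType) (l : X -> seq A) :
  ptime l -> ptime (fun x => size (l x)).
Proof.
move=> hl; apply: (@ptime_cast _ _ _ (fun x => [seq Nil | _ <- l x])).
  by apply: ptime_map => //; apply: ptime_const.
move=> x; rewrite [RHS]numE [LHS]/enc /= /enc_seq; congr dlist.
by elim: (l x) => //= a s ->.
Qed.

Lemma ptime_nseq (X A : encType) (n : X -> nat) (a : X -> A) :
  ptime n -> ptime a -> ptime (fun x => nseq (n x) (a x)).
Proof.
move=> hn ha; apply: (@ptime_eq _ _ (fun x => [seq a x | _ <- nseq (n x) Nil])).
  apply: (@ptime_map _ _ _ (fun x _ => a x)); last exact: ptime_nseq_Nil.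
  exact: ptime_comp ha (ptime_fst (ptime_id _)).
by move=> x; rewrite map_nseq.
Qed.

Lemma ptime_addn (X : encType) (m n : X -> nat) :
  ptime m -> ptime n -> ptime (fun x => m x + n x).
Proof.
move=> hm hn; apply: (@ptime_eq _ _ (fun x => size (nseq (m x) Nil ++ nseq (n x) Nil))).
  by apply: ptime_size; apply: ptime_cat; apply: ptime_nseq_Nil.
by move=> x; rewrite size_cat !size_nseq.
Qed.

Lemma ptime_muln (X : encType) (m n : X -> nat) :
  ptime m -> ptime n -> ptime (fun x => m x * n x).
Proof.
move=> hm hn.
apply: (@ptime_eq _ _ (fun x => size (flatten (nseq (m x) (nseq (n x) Nil))))).
  by apply: ptime_size; apply: ptime_flatten; apply: ptime_nseq => //; apply: ptime_nseq_Nil.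
by move=> x; rewrite size_flatten /shape map_nseq sumn_nseq size_nseq mulnC.
Qed.

Lemma ptime_expn (X : encType) (m : X -> nat) (e : nat) : ptime m -> ptime (fun x => m x ^ e).
Proof.
move=> hm; elim: e => [|e IH]; first exact: (@ptime_const _ _ 1).
by apply: (@ptime_eq _ _ (fun x => m x * m x ^ e)) => [|x]; [exact: ptime_muln|rewrite expnS].
Qed.

Lemma ptime_iota (X : encType) (m n : X -> nat) :
  ptime m -> ptime n -> ptime (fun x => iota (m x) (n x)).
Proof.
move=> hm hn.
have e x k s : foldl (fun t _ => rcons t (m x + size t)) (iota (m x) s) (nseq k Nil)
    = iota (m x) (s + k).
  elim: k s => [|k IH] s /=; first by rewrite addn0.
  by rewrite size_iota -cats1 -[[:: _]]/(iota _ 1) -iotaD addn1 IH addSnnS.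
apply: (@ptime_eq _ _ (fun x =>
    foldl (fun t _ => rcons t (m x + size t)) [::] (nseq (n x) Nil))); last first.
  by move=> x; apply: (e x (n x) 0).
apply: (@ptime_foldl _ _ _ (fun x t _ => rcons t (m x + size t))).
- have h1 := ptime_fst (ptime_snd (ptime_id (X * (seq nat * data))%type)).
  apply: ptime_rcons => //; apply: ptime_addn; last exact: ptime_size.
  exact: ptime_comp hm (ptime_fst (ptime_id _)).
- exact: ptime_const.
- exact: ptime_nseq_Nil.
have [d1 hd1] := ptime_esize hm; have [d2 hd2] := ptime_esize hn.
have [d hd] : poly_bounded (fun n =>
  (n.+2 ^ d2 * (2 * (n.+2 ^ d1 + n.+2 ^ d2)).+2).+1) by pbd.
exists d => x i; apply: leq_trans (hd _).
have -> : take i (nseq (n x) Nil) = nseq (minn i (n x)) Nil.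
  by rewrite /minn; case: ltnP => h; [rewrite take_nseq // ltnW|rewrite take_oversize ?size_nseq].
rewrite (e x _ 0).
have hmx := hd1 x; have hnx := hd2 x; rewrite !esize_nat in hmx hnx.
apply: leq_trans (esize_seq_le (m := (2 * ((esize x).+2 ^ d1 + (esize x).+2 ^ d2)).+1) _) _.
  move=> y; rewrite mem_iota add0n esize_nat => /andP[_ hy].
  by move: hy; rewrite /minn; case: ifP; lia.
rewrite size_iota ltnS leq_mul2r; apply/orP; right.
by rewrite /minn; case: ifP; lia.
Qed.

Lemma ptime_drop (X A : encType) (n : X -> nat) (l : X -> seq A) :
  ptime n -> ptime l -> ptime (fun x => drop (n x) (l x)).
Proof.
move=> hn hl.
have e k (s : seq A) : foldl (fun t _ => behead t) s (nseq k Nil) = drop k s.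
  by elim: k s => [|k IH] [|a s] //=; rewrite ?drop0 // IH.
apply: (@ptime_eq _ _ (fun x => foldl (fun t _ => behead t) (l x) (nseq (n x) Nil))).
  apply: (@ptime_foldl _ _ _ (fun x t _ => behead t)) => //.
  - exact: ptime_behead (ptime_fst (ptime_snd (ptime_id _))).
  - exact: ptime_nseq_Nil.
  have [d hd] := ptime_esize hl; exists d => x i; apply: leq_trans (hd x).
  have -> : take i (nseq (n x) Nil) = nseq (minn i (n x)) Nil.
    by rewrite /minn; case: ltnP => h; [rewrite take_nseq // ltnW|rewrite take_oversize ?size_nseq].
  by rewrite e esize_drop.
by move=> x; rewrite e.
Qed.

Lemma ptime_nth (X A : encType) (d : A) (l : X -> seq A) (n : X -> nat) :
  ptime l -> ptime n -> ptime (fun x => nth d (l x) (n x)).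
Proof.
move=> hl hn; apply: (@ptime_eq _ _ (fun x => head d (drop (n x) (l x)))).
  by apply: ptime_head; apply: ptime_drop.
by move=> x; rewrite -nth0 nth_drop addn0.
Qed.

Lemma ptime_subn (X : encType) (m n : X -> nat) :
  ptime m -> ptime n -> ptime (fun x => m x - n x).
Proof.
move=> hm hn; apply: (@ptime_eq _ _ (fun x => size (drop (n x) (nseq (m x) Nil)))).
  by apply: ptime_size; apply: ptime_drop => //; apply: ptime_nseq_Nil.
by move=> x; rewrite size_drop size_nseq.
Qed.

Lemma ptime_leq (X : encType) (m n : X -> nat) :
  ptime m -> ptime n -> ptime (fun x => m x <= n x).
Proof.
by move=> hm hn; apply: ptime_eq_op; [apply: ptime_subn|apply: ptime_const].
Qed.

Lemma ptime_dec_nat (X : encType) (a : X -> data) :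
  ptime a -> ptime (fun x => dec (a x) : nat).
Proof. by move=> ha; apply: ptime_size; apply: ptime_spine. Qed.

Lemma ptime_dec_bool (X : encType) (a : X -> data) :
  ptime a -> ptime (fun x => dec (a x) : bool).
Proof.
by move=> ha; apply: ptime_negb; apply: ptime_eq_op => //; apply: ptime_const.
Qed.

Lemma ptime_dec_pair (X A B : encType) (a : X -> data) :
  (forall (Y : encType) (b : Y -> data), ptime b -> ptime (fun y => dec (b y) : A)) ->
  (forall (Y : encType) (b : Y -> data), ptime b -> ptime (fun y => dec (b y) : B)) ->
  ptime a -> ptime (fun x => dec (a x) : A * B).
Proof.
move=> hA hB ha; apply: ptime_pair; [apply: hA|apply: hB].
  exact: ptime_dhd.
exact: ptime_dtl.
Qed.

Lemma ptime_dec_seq (X A : encType) (a : X -> data) :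
  (forall (Y : encType) (b : Y -> data), ptime b -> ptime (fun y => dec (b y) : A)) ->
  ptime a -> ptime (fun x => dec (a x) : seq A).
Proof.
move=> hA ha; apply: (@ptime_map _ _ _ (fun=> dec)); last exact: ptime_spine.
exact: hA (ptime_snd (ptime_id _)).
Qed.

Lemma ptime_iter (X A : encType) n (f : X -> A -> A) (a : X -> A) :
  ptime (fun p : X * A => f p.1 p.2) -> ptime a ->
  ptime (fun x => iter n (f x) (a x)).
Proof.
move=> hf ha; elim: n => [//|n IH].
exact: ptime_comp2 hf (ptime_id _) IH.
Qed.

(** Redefined below whenever further functions have been shown to be polynomial. *)
Ltac ptime_hook := fail.

(* The conclusion is matched syntactically: unification would unfold the
   functions in the goal when a lemma does not apply. *)
Ltac ptime_step :=
  cbv beta zeta;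
  lazymatch goal with
  | |- ptime (fun x => @?f x) => idtac
  | |- @ptime ?A ?B ?f => change (@ptime A B (fun x => f x))
  end;
  first [ assumption | ptime_hook | lazymatch goal with
  | |- ptime (fun=> ?c) => apply: ptime_const
  | |- ptime (fun x => x) => exact: ptime_id
  | |- ptime (fun x => (@?p x).1) => apply: ptime_fst
  | |- ptime (fun x => (@?p x).2) => apply: ptime_snd
  | |- ptime (fun x => (@?p x, @?q x)) => apply: ptime_pair
  | |- ptime (fun x => @?p x && @?q x) => apply: ptime_andb
  | |- ptime (fun x => @?p x || @?q x) => apply: ptime_orb
  | |- ptime (fun x => @?p x ==> @?q x) => apply: ptime_implb
  | |- ptime (fun x => ~~ @?p x) => apply: ptime_negb
  | |- ptime (fun x => @?p x == @?q x) => apply: ptime_eq_op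
  | |- ptime (fun x => @?p x <= @?q x) => apply: ptime_leq
  | |- ptime (fun x => S (@?p x)) => apply: ptime_succ
  | |- ptime (fun x => (@?p x).-1) => apply: ptime_pred
  | |- ptime (fun x => @?p x + @?q x) => apply: ptime_addn
  | |- ptime (fun x => @?p x - @?q x) => apply: ptime_subn
  | |- ptime (fun x => @?p x * @?q x) => apply: ptime_muln
  | |- ptime (fun x => @?p x ^ ?e) => apply: ptime_expn
  | |- ptime (fun x => @?p x :: @?q x) => apply: ptime_cons
  | |- ptime (fun x => @?p x ++ @?q x) => apply: ptime_cat
  | |- ptime (fun x => rcons (@?p x) (@?q x)) => apply: ptime_rcons
  | |- ptime (fun x => rev (@?p x)) => apply: ptime_rev
  | |- ptime (fun x => map (@?f x) (@?p x)) => apply: ptime_map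
  | |- ptime (fun x => filter (@?f x) (@?p x)) => apply: ptime_filter
  | |- ptime (fun x => flatten (@?p x)) => apply: ptime_flatten
  | |- ptime (fun x => all (@?f x) (@?p x)) => apply: ptime_all
  | |- ptime (fun x => has (@?f x) (@?p x)) => apply: ptime_has
  | |- ptime (fun x => @?a x \in @?p x) => apply: ptime_mem
  | |- ptime (fun x => iota (@?p x) (@?q x)) => apply: ptime_iota
  | |- ptime (fun x => nseq (@?p x) (@?q x)) => apply: ptime_nseq
  | |- ptime (fun x => size (@?p x)) => apply: ptime_size
  | |- ptime (fun x => nth ?d (@?p x) (@?q x)) => apply: ptime_nth
  | |- ptime (fun x => head ?d (@?p x)) => apply: ptime_head
  | |- ptime (fun x => behead (@?p x)) => apply: ptime_behead
  | |- ptime (fun x => drop (@?p x) (@?q x)) => apply: ptime_drop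
  | |- ptime (fun x => enc (@?p x)) => apply: ptime_enc
  | _ => apply: ptime_if
  end ].

Ltac ptime := repeat ptime_step.

(** * Fixed-parameter reductions *)

Fixpoint used_expr (e : expr) : nat :=
  match e with
  | EVar x => x.+1
  | EConst _ => 0
  | EHd e1 | ETl e1 => used_expr e1
  | ECons e1 e2 | EEq e1 e2 => maxn (used_expr e1) (used_expr e2)
  end.

Fixpoint used (c : cmd) : nat :=
  match c with
  | CAssign x e => maxn x.+1 (used_expr e)
  | CSeq c1 c2 => maxn (used c1) (used c2)
  | CIf e c1 c2 => maxn (used_expr e) (maxn (used c1) (used c2))
  | CWhile e c1 => maxn (used_expr e) (used c1)
  end.

Section Agree.
Variable N : nat.

Definition agree (s1 s2 : store) := forall x, x < N -> s1 x = s2 x.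

Lemma eval_agree e s1 s2 :
  used_expr e <= N -> agree s1 s2 -> eval s2 e = eval s1 e.
Proof.
move=> u ag; elim: e u => //= [x|e1 IH1 e2 IH2|e IH|e IH|e1 IH1 e2 IH2].
- by move/ag.
- by rewrite geq_max => /andP[/IH1 -> /IH2 ->].
- by move/IH->.
- by move/IH->.
- by rewrite geq_max => /andP[/IH1 -> /IH2 ->].
Qed.

Lemma ecost_agree e s1 s2 :
  used_expr e <= N -> agree s1 s2 -> ecost s2 e = ecost s1 e.
Proof.
move=> u ag; elim: e u => [x|a|e1 IH1 e2 IH2|e IH|e IH|e1 IH1 e2 IH2] u //;
  rewrite /= -/(eval s1 _) -/(eval s2 _).
- by rewrite (ag x u).
- by move: u; rewrite geq_max => /andP[u1 u2]; rewrite IH1 // IH2 // !(@eval_agree _ s1 s2).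
- by rewrite IH // (@eval_agree _ s1 s2).
- by rewrite IH // (@eval_agree _ s1 s2).
- by move: u; rewrite geq_max => /andP[u1 u2]; rewrite IH1 // IH2 // !(@eval_agree _ s1 s2).
Qed.

Lemma exec_agree c s t s' : exec c s t s' -> forall r, used c <= N -> agree s r ->
  exists2 r', exec c r t r' & agree s' r'.
Proof.
elim=> {c s t s'} /=.
- move=> x e s r; rewrite geq_max => /andP[ux ue] ag.
  exists (update r x (eval r e)).
    by rewrite -(ecost_agree ue ag); constructor.
  by move=> y hy; rewrite !updateE (eval_agree ue ag) ag.
- move=> c1 c2 s t1 s1 t2 s2 _ IH1 _ IH2 r; rewrite geq_max => /andP[u1 u2] ag.
  have [r1 e1 ag1] := IH1 r u1 ag; have [r2 e2 ag2] := IH2 r1 u2 ag1.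
  by exists r2 => //; apply: ExecSeq e1 e2.
- move=> e c1 c2 s t s1 nz _ IH r; rewrite !geq_max => /and3P[ue u1 u2] ag.
  have [r1 e1 ag1] := IH r u1 ag; exists r1 => //; rewrite -(ecost_agree ue ag).
  by apply: ExecIfTrue e1; rewrite (eval_agree ue ag).
- move=> e c1 c2 s t s1 nz _ IH r; rewrite !geq_max => /and3P[ue u1 u2] ag.
  have [r1 e1 ag1] := IH r u2 ag; exists r1 => //; rewrite -(ecost_agree ue ag).
  by apply: ExecIfFalse e1; rewrite (eval_agree ue ag).
- move=> e c s t1 s1 t2 s2 nz _ IH1 _ IH2 r u ag.
  have /andP[ue u1] : (used_expr e <= N) && (used c <= N) by rewrite -geq_max.
  have [r1 e1 ag1] := IH1 r u1 ag; have [r2 e2 ag2] := IH2 r1 u ag1.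
  exists r2 => //; rewrite -(ecost_agree ue ag).
  by apply: ExecWhileTrue e1 e2; rewrite (eval_agree ue ag).
- move=> e c s nz r; rewrite geq_max => /andP[ue u1] ag.
  exists r => //; rewrite -(ecost_agree ue ag).
  by apply: ExecWhileFalse; rewrite (eval_agree ue ag).
Qed.
End Agree.

(** [runs] describes a program only on a store that is [Nil] outside register 0. After another
    program, the registers that [c] mentions must be reset, at unit cost each, before [c] behaves as
    described. *)
Fixpoint clear_then (n : nat) (c : cmd) : cmd :=
  if n is n'.+1 then CSeq (CAssign n (EConst Nil)) (clear_then n' c) else c.

Lemma clear_then_exec c a t s' s :
  exec c (update (fun=> Nil) 0 a) t s' -> s 0 = a ->
  exists2 r, exec (clear_then (used c) c) s (used c + t) r & r 0 = s' 0.
Proof.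
move=> e s0.
suff h n r : n <= used c -> r 0 = a -> (forall x, n < x -> x <= used c -> r x = Nil) ->
    exists2 r', exec (clear_then n c) r (n + t) r' & agree (used c).+1 s' r'.
  have [r er ag] := h (used c) s (leqnn _) s0 (fun x h1 h2 => ltac:(lia)).
  by exists r => //; rewrite ag.
elim: n r => [|n IH] r hn r0 hr.
  apply: (exec_agree e) => [//|[|x] hx]; rewrite updateE //=.
  by rewrite hr.
have [|||r' e' ag] := IH (update r n.+1 Nil); rewrite ?updateE //; first by lia.
  by move=> x h1 h2; rewrite updateE; case: eqP => // ne; apply: hr => //; lia.
exists r' => //.
exact: (ExecSeq (ExecAssign n.+1 (EConst Nil) r) e').
Qed.

Lemma effective_computable (f : nat -> nat) : effective f -> computable f.
Proof.
move=> [c [T h]]; exists c => n.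
have [//|t [s' [e _ q]]] := h n (update (fun=> Nil) 0 (num n)).
by exists t, s'.
Qed.

(** Choice turns the running times, which exist for each input separately, into a function; clearing
    registers removes the assumption of a clean store. *)
Lemma computable_effective (f : nat -> nat) : computable f -> effective f.
Proof.
move=> [c h]; have [T hT] := functional_choice _ h.
exists (clear_then (used c) c), (fun n => used c + T n) => n s s0.
have [s' e s'0] := hT n; have [r er r0] := clear_then_exec e s0.
by apply: run_exec er _ _; rewrite ?r0.
Qed.

(** A computable majorant of [f] on all arguments up to [n]. A reduction only bounds the new
    parameter, and the time bound applied to it next need not be monotone. *)
Definition sum_upto (f : nat -> nat) (n : nat) : nat :=
  foldl (fun s j => s + f j) 0 (iota 0 n.+1).

Lemma sum_upto_ge f n j : j <= n -> f j <= sum_upto f n.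
Proof.
rewrite -ltnS /sum_upto => hj.
have e : forall s a, foldl (fun s j => s + f j) a s = a + \sum_(j <- s) f j.
  elim=> [|x s IH] a /=; first by rewrite big_nil addn0.
  by rewrite IH big_cons addnA.
rewrite e add0n (bigD1_seq j) ?iota_uniq ?leq_addr //.
by rewrite mem_iota.
Qed.

Lemma effective_sum_upto (f g : nat -> nat) :
  effective f -> effective g -> effective (fun n => sum_upto f (g n)).
Proof.
move=> hf hg; apply: (@effective_foldl _ _ _ (fun _ s j => s + f j)).
- have h2 : effective (fun p : nat * (nat * nat) => (p.2.1, f p.2.2)).
    apply: effective_pair; first by apply: ptime_effective; ptime.
    by apply: effective_comp hf _; apply: ptime_effective; ptime.
  apply: (effective_comp (g := fun p : nat * nat => p.1 + p.2) _ h2).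
  by apply: ptime_effective; ptime.
- by apply: ptime_effective; ptime.
- apply: (effective_comp (g := fun n => iota 0 n.+1) _ hg).
  by apply: ptime_effective; ptime.
Qed.

(** Splits a bound in the sum of input size and parameter cost into the product required by
    [fpt_reducible]. *)
Lemma leq_add_mul x u : 0 < x -> x + u <= x * u.+1.
Proof. by case: x => // x _; nia. Qed.

Theorem fpt_reducible_trans P Q R :
  fpt_reducible P Q -> fpt_reducible Q R -> fpt_reducible P R.
Proof.
move=> [c1 [f1 [g1 [m1 [cf1 cg1 h1]]]]] [c2 [f2 [g2 [m2 [cf2 cg2 h2]]]]].
have [ef1 eg1] := (computable_effective cf1, computable_effective cg1).
have [ef2 eg2] := (computable_effective cf2, computable_effective cg2).
pose u := used c2.
exists (CSeq c1 (clear_then u c2)),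
  (fun k => f1 k + u + sum_upto f2 (g1 k) * ((k + k).+3 + f1 k) ^ m2),
  (fun k => sum_upto g2 (g1 k)), (m1 + m1.+1 * m2); split.
- apply: effective_computable.
  apply: (effective_comp (g := fun p : nat * (nat * nat) =>
    p.2.1 + u + p.2.2 * ((p.1 + p.1).+3 + p.2.1) ^ m2)
    (f := fun k => (k, (f1 k, sum_upto f2 (g1 k))))).
    by apply: ptime_effective; ptime.
  apply: effective_pair; first by apply: ptime_effective; ptime.
  by apply: effective_pair => //; apply: effective_sum_upto.
- by apply: effective_computable; apply: effective_sum_upto.
move=> x k; have [t1 [y [j [[s1 e1 q1] b1 le1 PQ]]]] := h1 x k.
have [t2 [z [i [[s2 e2 q2] b2 le2 QR]]]] := h2 y j.
have [r er r0] := clear_then_exec e2 q1.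
exists (t1 + (u + t2)), z, i; split.
- by exists r; [apply: ExecSeq e1 er|rewrite r0].
- have hx := dsize_gt0 x; rewrite addnn; set X := dsize x in b1 hx *.
  (* The size of the intermediate instance is read off the running time of the first reduction;
     [k.*2.+2] is what the pair and the unary [k] add to the input. *)
  have hy : dsize y <= X ^ m1.+1 * (k.*2.+3 + f1 k).
    have := exec_size 0 e1; rewrite q1 updateE /= !dsize_num -/X => hy.
    have hX1 : X <= X ^ m1.+1 by rewrite expnS leq_pmulr // expn_gt0 hx.
    have hX2 : X ^ m1 <= X ^ m1.+1 by rewrite expnS leq_pmull.
    have hX3 : f1 k * X ^ m1 <= f1 k * X ^ m1.+1 by rewrite leq_mul2l hX2 orbT.
    have hX4 : k.*2.+3 <= X ^ m1.+1 * k.*2.+3 by rewrite leq_pmull // expn_gt0 hx.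
    have hX5 : (X + k.*2.+2) <= X * k.*2.+3 by apply: leq_add_mul.
    have hX6 : X * k.*2.+3 <= X ^ m1.+1 * k.*2.+3 by rewrite leq_mul2r hX1 orbT.
    by rewrite mulnDr; lia.
  have hf2 : f2 j <= sum_upto f2 (g1 k) by apply: sum_upto_ge.
  set D := m1 + _; have hD : 0 < X ^ D by rewrite expn_gt0 hx.
  rewrite mulnDl mulnDl addnA; apply: leq_add.
    apply: leq_add; last by rewrite leq_pmulr.
    apply: leq_trans b1 _; rewrite leq_mul2l /D expnD leq_pmulr ?orbT //.
    by rewrite expn_gt0 hx.
  apply: leq_trans b2 _; rewrite -mulnA; apply: leq_mul => //.
  apply: leq_trans (leq_pexp2r _ hy) _; rewrite expnMn -expnM mulnC leq_mul2l.
  by rewrite leq_pexp2l ?orbT // /D leq_addl.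
- apply: leq_trans le2 _; exact: sum_upto_ge.
- by rewrite PQ.
Qed.

Lemma foldl_nseq (A B : Type) (f : A -> A) (a : A) (b : B) k :
  foldl (fun x _ => f x) a (nseq k b) = iter k f a.
Proof. by elim: k a => //= k IH a; rewrite IH -iterSr. Qed.

Lemma effective_iter (A : encType) (f : A -> A) (a : A) :
  effective f -> effective (fun k => iter k f a).
Proof.
move=> hf; have [c [T h]] : effective (fun k : nat =>
    foldl (fun x _ => f x) a (nseq k Nil)).
  apply: (@effective_foldl _ _ _ (fun _ x _ => f x)).
  - by apply: effective_comp hf _; apply: ptime_effective; ptime.
  - by apply: ptime_effective; ptime.
  - by apply: ptime_effective; ptime.
by exists c, T; apply: computes_eq h _ => k; apply: foldl_nseq.
Qed.

(** The iterates may outgrow every polynomial in [k], so the time is only claimed to be polynomial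
    in a bound on [k] and on the sizes of the iterates. *)
Lemma computes_iter (A : encType) (f : A -> A) (a : A) (S : nat -> nat) :
  ptime f -> (forall k i, i <= k -> esize (iter i f a) <= S k) ->
  exists c T P, [/\ computes c (fun k => iter k f a) T, poly_bounded P &
    forall k n, 2 * esize k + S k <= n -> T k <= P n].
Proof.
move=> hf hS.
have [c3 [m3 h3]] : ptime (fun p : nat * (A * data) => f p.2.1).
  by apply: ptime_comp hf _; ptime.
have [c h] := (computes_foldl (f := fun _ x _ => f x) h3).
have [c4 [m4 h4]] : ptime (fun k : nat => (k, (a, nseq k Nil))) by ptime.
have [e he] := ptime_esize (ex_intro _ c4 (ex_intro _ m4 h4)).
exists (CSeq c4 c), (fun k => (esize k).+2 ^ m4 + (10 * esize (k, (a, nseq k Nil)) +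
    fold_cost (fun _ x _ => f x) (fun p => (esize p).+2 ^ m3) k a (nseq k Nil))).
exists (fun n => n.+2 ^ m4 + (10 * n.+2 ^ e + n * (30 * n + (2 * n).+4 ^ m3))).
split.
- by apply: computes_eq (computes_comp h4 h) _ => k; apply: foldl_nseq.
- by pbd.
move=> k n hn; have hk : esize k <= n by lia.
have en : esize (nseq k Nil) = esize k.
  by rewrite /esize [enc _]/(dlist _) map_nseq [enc k]numE.
apply: leq_add; first by apply: leq_pexp2r; rewrite !ltnS.
apply: leq_add.
  rewrite leq_mul2l; apply: leq_trans (he k) _.
  by apply: leq_pexp2r; rewrite !ltnS.
apply: fold_cost_le => //; first by rewrite en; lia.
move=> i; have -> : take i (nseq k Nil) = nseq (minn i k) Nil.
  by rewrite /minn; case: ltnP => ik; [rewrite take_nseq // ltnW|rewrite take_oversize ?size_nseq].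
rewrite foldl_nseq; apply: leq_trans (hS k _ (geq_minr _ _)) _; lia.
Qed.

Section FptIntro.
Variables (P Q : pproblem) (H : encType) (step : H -> H) (h0 : H).
Variables (F : (data * nat) * H -> data * nat) (g : nat -> nat).

(* The data [iter k step h0] may be huge, but it depends on [k] only; once it is
   available, everything else is polynomial. *)
Theorem fpt_intro :
  ptime step -> ptime F -> effective g ->
  (forall x k, (F ((x, k), iter k step h0)).2 <= g k) ->
  (forall x k, P x k <->
     Q (F ((x, k), iter k step h0)).1 (F ((x, k), iter k step h0)).2) ->
  fpt_reducible P Q.
Proof.
move=> hstep [c2 [m2 h2]] hg gle PQ.
have [d hd] := ptime_esize hstep.
(* The extra 1 in the exponent makes [S] nondecreasing even if [d] is 0. *)
pose S k := iter k (fun n => n.+2 ^ d.+1) (esize h0).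
have S_mono : {homo S : i j / i <= j}.
  apply: homo_leq => [//|i j l|i]; first exact: leq_trans.
  by rewrite /S iterS -/(S i) expnS; apply: leq_trans (leq_pmulr _ _); rewrite ?expn_gt0 //; lia.
have hS i : esize (iter i step h0) <= S i.
  elim: i => // i IH; rewrite /S !iterS -/(S i); apply: leq_trans (hd _) _.
  by rewrite expnS; apply: leq_trans (leq_pmull _ _) => //; apply: leq_pexp2r.
have hS' k i : i <= k -> esize (iter i step h0) <= S k.
  by move=> ik; apply: leq_trans (hS i) (S_mono _ _ ik).
have [c1 [T1 [P1 [h1 hP1 T1le]]]] := computes_iter hstep hS'.
have [c5 [m5 h5]] : ptime (fun a : data * nat => a.2) by ptime.
have [c0 [m0 hid]] := ptime_id (data * nat)%type.
have [c6 h6] := computes_pair hid (computes_comp h5 h1).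
have h7 := computes_comp h6 h2.
(* All that depends on [k] is gathered here; the total time is the polynomial [PP] in
   [dsize x + V k], and this sum is then split into a product. *)
pose V k := k.*2.+2 + (2 * esize k + S k).
pose PP n := 10 * (n + n.+2 ^ m0 + (n.+2 ^ m5 + P1 n)) + (n + n).+3 ^ m2.
have [D hD] : poly_bounded PP by rewrite /PP; pbd.
exists (CSeq c6 c2), (fun k => ((k + k).+2 + (2 * (k + k).+1 + S k)).+3 ^ D), g, D.
split; last 1 first.
- move=> x k; have [//|t [s' [e b q]]] := h7 (x, k) (update (fun=> Nil) 0 (enc (x, k))).
  exists t, (F ((x, k), iter k step h0)).1, (F ((x, k), iter k step h0)).2.
  split; last exact: PQ.
  + by exists s' => //; rewrite q; case: (F _).
  + apply: leq_trans b _ => /=; pose n := dsize x + V k.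
    have en : esize (x, k) <= n.
      by rewrite esize_pair /n /V esize_nat -[esize x]/(dsize x); lia.
    have ele : esize (x, k, iter k step h0) <= (n + n).+1.
      by rewrite esize_pair ltnS leq_add // (leq_trans (hS k)) // /n /V; lia.
    have ek : (k + k).+2 + (2 * (k + k).+1 + S k) = V k.
      by rewrite /V esize_nat !addnn.
    apply: (@leq_trans (PP n)).
      apply: leq_add; last by apply: leq_pexp2r.
      rewrite leq_mul2l; apply/orP; right.
      apply: leq_add; first by apply: leq_add => //; apply: leq_pexp2r.
      apply: leq_add; first by apply: leq_pexp2r.
      by apply: T1le; rewrite /n /V; lia.
    apply: leq_trans (hD n) _; rewrite -expnMn; apply: leq_pexp2r.
    by rewrite ek mulnC -2!addnS; apply: leq_add_mul; apply: dsize_gt0.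
  + exact: gle.
- apply: effective_computable.
  apply: (effective_comp (g := fun p : nat * nat =>
    ((p.1 + p.1).+2 + (2 * (p.1 + p.1).+1 + p.2)).+3 ^ D) (f := fun k => (k, S k))).
    by apply: ptime_effective; ptime.
  apply: effective_pair; first by apply: ptime_effective; ptime.
  by apply: effective_iter; apply: ptime_effective; ptime.
- exact: effective_computable.
Qed.
End FptIntro.

(** * The value of the game *)

Section GameValue.
Variables (X : finType) (F : {set {set X}}).
Implicit Types (S M : {set X}) (p : seq X) (W : {set X} -> {set X} -> bool).

Definition hits S : bool := [forall e in F, [exists v in e, v \in S]].

Lemma hitsP S : reflect (hyper_transversal F S) (hits S).
Proof.
apply: (iffP forall_inP) => [h e /h /exists_inP[v ve vS]|h e /h[v ve vS]].
  by exists v.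
by apply/exists_inP; exists v.
Qed.

Lemma hits_sub S S' : S \subset S' -> hits S -> hits S'.
Proof.
move=> sub /hitsP h; apply/hitsP => e /h[v ve vS]; exists v => //.
exact: (subsetP sub).
Qed.

(* Maker may also pass: this does not change the value of the game, and makes
   it meaningful on a full board. *)
Definition maker_step W S M : bool :=
  W S M && [forall u, (u \notin S) ==> W S (u |: M)].

(* [S] and [M] are the vertices claimed by Breaker and Maker; Breaker is to move
   and has [k] moves left. *)
Fixpoint breaker_value k S M : bool :=
  if k is k'.+1 then
    maker_step (breaker_value k') S M ||
    [exists v, (v \notin M) && maker_step (breaker_value k') (v |: S) M]
  else hits S.

Definition game_value first k : bool :=
  if is_breaker first then breaker_value k set0 set0
  else maker_step (breaker_value k) set0 set0.

Lemma maker_step_sub W :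
  (forall S S' M M', S \subset S' -> M' \subset M -> W S M -> W S' M') ->
  forall S S' M M', S \subset S' -> M' \subset M ->
    maker_step W S M -> maker_step W S' M'.
Proof.
move=> hW S S' M M' sS sM /andP[w /forall_inP h]; apply/andP; split.
  exact: (hW _ _ _ _ sS sM).
apply/forall_inP => u uS'; apply: (hW _ _ _ _ sS _ (h u _)); first exact: setUS.
by apply: contra uS'; apply: (subsetP sS).
Qed.

(** Extra vertices never hurt their owner. This is why passes and repeated claims leave the value of
    the game unchanged. *)
Lemma breaker_value_sub k S S' M M' :
  S \subset S' -> M' \subset M -> breaker_value k S M -> breaker_value k S' M'.
Proof.
elim: k S S' M M' => [|k IH] S S' M M' sS sM; first exact: hits_sub.
have h := maker_step_sub IH.
case/orP => [w|/existsP[v /andP[vM w]]]; apply/orP.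
  by left; apply: h w.
right; apply/existsP; exists v; apply/andP; split.
  by apply: contra vM; apply: (subsetP sM).
by apply: h w => //; apply: setUS.
Qed.

Lemma hits_breaker_value k S M : hits S -> breaker_value k S M.
Proof.
elim: k M => //= k IH M hS; apply/orP; left; apply/andP; split; first exact: IH.
by apply/forall_inP => u _; apply: IH.
Qed.

Lemma hits_maker_step k S M : hits S -> maker_step (breaker_value k) S M.
Proof.
move=> hS; apply/andP; split; first exact: hits_breaker_value.
by apply/forall_inP => u _; apply: hits_breaker_value.
Qed.

(** On a full board Breaker's remaining moves can only repeat vertices he owns, so all of them
    amount to passes. *)
Lemma full_breaker_value k S M :
  (forall v, v \notin M -> v \in S) -> breaker_value k S M -> hits S.
Proof.
move=> full; elim: k => //= k IH.
case/orP => [/andP[/IH]//|/existsP[v /andP[/full vS]]].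
by rewrite (setUidPr _) ?sub1set // => /andP[/IH].
Qed.

Section Plays.
Variables (first : player) (k : nat).

Let bm p := breaker_moves first p.
(** Vertices that Breaker claims after his first [k] moves count for neither player: they lie
    outside both [S_ p] and [M_ p]. *)
Let S_ p := [set v in take k (bm p)].
Let M_ p := [set v in p] :\: [set v in bm p].

Lemma breaker_moves_rcons p v :
  bm (rcons p v) = if is_breaker (mover first (size p)) then rcons (bm p) v else bm p.
Proof.
rewrite /bm /breaker_moves size_rcons -[in iota _ _]addn1 iotaD map_cat -cats1.
rewrite mask_cat ?size_map ?size_iota //= add0n.
by case: ifP; rewrite ?cats1 ?cats0.
Qed.

Lemma mem_breaker_moves p : {subset bm p <= p}.
Proof. by move=> v; apply: mem_mask. Qed.

Definition position_value p : bool :=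
  if is_breaker (mover first (size p)) then breaker_value (k - size (bm p)) (S_ p) (M_ p)
  else maker_step (breaker_value (k - size (bm p))) (S_ p) (M_ p).

Lemma mover_rcons p v :
  is_breaker (mover first (size (rcons p v))) = ~~ is_breaker (mover first (size p)).
Proof. by rewrite size_rcons /mover /=; case: odd; case: first. Qed.

Lemma position_rcons_breaker p v :
  v \notin p -> is_breaker (mover first (size p)) ->
  position_value (rcons p v) =
  if size (bm p) < k then maker_step (breaker_value (k - size (bm p)).-1) (v |: S_ p) (M_ p)
  else hits (S_ p).
Proof.
move=> vp turn; rewrite /position_value mover_rcons turn /=.
have -> : M_ (rcons p v) = M_ p.
  apply/setP => u; rewrite !inE breaker_moves_rcons turn !mem_rcons !inE.
  by case: eqP => //= ->; rewrite (negbTE vp) andbF.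
rewrite breaker_moves_rcons turn size_rcons.
case: ltnP => hk.
  have -> : S_ (rcons p v) = v |: S_ p.
    apply/setP => u; rewrite !inE breaker_moves_rcons turn.
    by rewrite !take_oversize ?size_rcons ?mem_rcons ?inE // ltnW.
  by rewrite subnS.
have -> : S_ (rcons p v) = S_ p.
  by apply/setP => u; rewrite !inE breaker_moves_rcons turn -cats1 takel_cat.
have -> : k - (size (bm p)).+1 = 0 by apply/eqP; rewrite subn_eq0 ltnW.
apply/idP/idP; first by case/andP.
exact: (@hits_maker_step 0).
Qed.

Lemma position_rcons_maker p v :
  v \notin p -> ~~ is_breaker (mover first (size p)) ->
  position_value (rcons p v) = breaker_value (k - size (bm p)) (S_ p) (v |: M_ p).
Proof.
move=> vp turn; rewrite /position_value mover_rcons turn /=.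
have -> : M_ (rcons p v) = v |: M_ p.
  apply/setP => u; rewrite !inE breaker_moves_rcons (negbTE turn) mem_rcons !inE.
  case: eqP => //= ->; rewrite andbT; apply/negP => /mem_breaker_moves.
  exact/negP.
by rewrite /S_ breaker_moves_rcons (negbTE turn).
Qed.

Lemma follows_rcons sigma p v :
  follows first sigma (rcons p v) <->
  follows first sigma p /\ (mover first (size p) = Breaker -> sigma p = Some v).
Proof.
split=> [h|[h hv] i].
  split=> [i ip turn|turn].
    have := h i; rewrite size_rcons -cats1 takel_cat 1?ltnW // onth_cat ip.
    by apply; rewrite // ltnW.
  have := h (size p); rewrite size_rcons -cats1 take_size_cat // onth_cat ltnn subnn.
  exact.
rewrite size_rcons ltnS leq_eqVlt -cats1 => /predU1P[->|ip] turn.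
  by rewrite take_size_cat // onth_cat ltnn subnn hv.
by rewrite takel_cat 1?ltnW // onth_cat ip h.
Qed.

Lemma moverP i : reflect (mover first i = Breaker) (is_breaker (mover first i)).
Proof. by case: mover; constructor. Qed.

Lemma fresh_vertex p : uniq p -> size p < #|X| -> exists v, v \notin p.
Proof.
move=> up lt; apply/existsP; apply: contraLR lt; rewrite negb_exists => /forallP h.
rewrite -leqNgt -(card_uniqP up); apply: subset_leq_card; apply/subsetP => v _.
by have := h v; rewrite negbK.
Qed.

Lemma position_value_nil : position_value [::] = game_value first k.
Proof.
rewrite /position_value /game_value /mover /= subn0.
have -> : S_ [::] = set0 by apply/setP => v; rewrite !inE.
by have -> : M_ [::] = set0 by apply/setP => v; rewrite !inE andbF.
Qed.

(** Backward induction on the number of free vertices: a winning strategy never passes through a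
    position of value false. *)
Lemma winning_position sigma :
  legal first sigma ->
  (forall p, uniq p -> size p = #|X| -> follows first sigma p -> hits (S_ p)) ->
  forall p, uniq p -> follows first sigma p -> position_value p.
Proof.
move=> leg win p; have [n] := ubnP (#|X| - size p).
elim: n p => // n IH p hn up fol.
have sp : size p <= #|X| by rewrite -(card_uniqP up) max_card.
have [full|lt] := eqVneq (size p) #|X|.
  have hS := win p up full fol; rewrite /position_value.
  by case: ifP => _; [apply: hits_breaker_value|apply: hits_maker_step].
have {}lt : size p < #|X| by rewrite ltn_neqAle lt.
have next v : v \notin p -> (mover first (size p) = Breaker -> sigma p = Some v) ->
    position_value (rcons p v).
  move=> vp hv; apply: IH; rewrite ?rcons_uniq ?vp ?size_rcons //; first by lia.
  exact/follows_rcons.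
have [turn|turn] := boolP (is_breaker (mover first (size p))).
  have [v hv vp] := leg p up fol lt (elimT (moverP _) turn).
  have := next v vp (fun=> hv); rewrite position_rcons_breaker //.
  rewrite /position_value turn; case: ltnP => hk.
    rewrite (_ : k - size (bm p) = (k - size (bm p)).-1.+1); last by lia.
    move=> /= w; apply/orP; right; apply/existsP; exists v; rewrite w andbT !inE.
    by rewrite (negbTE vp) andbF.
  exact: hits_breaker_value.
have {}next v : v \notin p -> breaker_value (k - size (bm p)) (S_ p) (v |: M_ p).
  move=> vp; rewrite -position_rcons_maker //; apply: next => // /moverP.
  by rewrite (negbTE turn).
(* The value after a pass of Maker follows by monotonicity from the value after some real move. *)
have w0 : breaker_value (k - size (bm p)) (S_ p) (M_ p).
  have [v vp] := fresh_vertex up lt; apply: breaker_value_sub (next v vp) => //.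
  exact: subsetUr.
rewrite /position_value (negbTE turn); apply/andP; split=> //.
(* A claimed [u] outside [S_ p] is either Maker's already, and nothing changes, or one of Breaker's
   surplus vertices; then his budget is spent and the value ignores Maker's set. *)
apply/forall_inP => u uS; have [up'|] := boolP (u \in p); last exact: next.
have [ub|ub] := boolP (u \in bm p); last first.
  by rewrite (setUidPr _) // sub1set !inE ub.
suff : k - size (bm p) = 0 by move: w0 => /[swap] ->.
apply/eqP; rewrite subn_eq0 leqNgt; apply: contra uS => hk.
by rewrite inE take_oversize // ltnW.
Qed.

(** A free vertex is returned even if none is singled out by the value, because [legal] forbids
    passing while the board is not full. *)
Definition value_strategy : strategy X := fun p =>
  if [pick v | (v \notin p) &&
        maker_step (breaker_value (k - size (bm p)).-1) (v |: S_ p) (M_ p)]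
  is Some v then Some v else [pick v | v \notin p].

Lemma value_strategy_legal : legal first value_strategy.
Proof.
move=> p up fol lt _; rewrite /value_strategy.
case: pickP => [v /andP[vp _]|_]; first by exists v.
have [v vp] := fresh_vertex up lt.
by case: pickP => [u up'|/(_ v)]; [exists u|rewrite vp].
Qed.

Lemma value_strategy_position p :
  game_value first k -> uniq p -> follows first value_strategy p -> position_value p.
Proof.
move=> g; elim/last_ind: p => [|p v IH]; first by rewrite position_value_nil.
rewrite rcons_uniq => /andP[vp up] /follows_rcons[fol hv].
have := IH up fol; rewrite /position_value.
have [turn|turn] := boolP (is_breaker (mover first (size p))); last first.
  case/andP => _ /forall_inP w; rewrite -/(position_value _) position_rcons_maker //.
  apply: w; apply: contra vp; rewrite inE => /mem_take; exact: mem_breaker_moves.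
rewrite -/(position_value _) position_rcons_breaker //.
case: ltnP => hk; last first.
  by rewrite (_ : k - _ = 0); [|apply/eqP; rewrite subn_eq0].
have {}hv := hv (elimT (moverP _) turn).
rewrite (_ : k - size (bm p) = (k - size (bm p)).-1.+1) /=; last by lia.
move=> w; move: hv; rewrite /value_strategy; case: pickP => [u /andP[_ wu] [<-] //|no _].
have sub := maker_step_sub (@breaker_value_sub (k - size (bm p)).-1).
(* Were a pass good, any free vertex would be good too and would have been picked. The remaining
   good choice is a vertex Breaker already owns, which is again a pass. *)
have wS : maker_step (breaker_value (k - size (bm p)).-1) (S_ p) (M_ p) -> False.
  move=> w'; have := no v; rewrite vp => /negP; apply; apply: sub w' => //.
  exact: subsetUr.
case/orP: w => [/wS//|/existsP[u /andP[uM w]]].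
have [up'|up'] := boolP (u \in p); last by have := no u; rewrite up' w.
case: wS; rewrite -(setUidPr (_ : [set u] \subset S_ p)) // sub1set inE.
move: uM; rewrite !inE up' andbT negbK take_oversize //.
exact: ltnW.
Qed.
End Plays.

Theorem breaker_wins_withinP first k :
  breaker_wins_within F first k <-> game_value first k.
Proof.
split=> [[sigma leg win]|g].
  rewrite -position_value_nil; apply: (winning_position leg) => // p up sp fol.
  exact/hitsP/win.
exists (value_strategy first k) => [|p up sp fol]; first exact: value_strategy_legal.
have := value_strategy_position g up fol.
have full v : v \in p.
  have /eqP : [set v in p] == setT.
    rewrite eqEcard subsetT cardsT -sp cardsE; exact/eq_leq/esym/card_uniqP.
  by move/setP/(_ v); rewrite !inE.
rewrite /position_value => h; apply/hitsP.
have {h} : breaker_value (k - size (breaker_moves first p))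
    [set v in take k (breaker_moves first p)]
    ([set v in p] :\: [set v in breaker_moves first p]).
  by move: h; case: ifP => // _ /andP[].
have [hk|hk] := leqP k (size (breaker_moves first p)).
  by rewrite (_ : k - _ = 0); [|apply/eqP; rewrite subn_eq0].
apply: full_breaker_value => v; rewrite !inE full andbT negbK take_oversize //.
exact: ltnW.
Qed.
End GameValue.

(** * Strategy trees of bounded size *)

(* A shape consists of a number of nodes, of the sets of nodes occurring on the
   maximal plays, and of pairs of nodes which must not receive the same vertex. *)
Definition shape : Type := (nat * (seq (seq nat) * seq (nat * nat)))%type.
Implicit Type sh : shape.

Definition shape_paths sh := sh.2.1.
Definition shape_conflicts sh := sh.2.2.

(* Block 0 is Breaker's plan as long as Maker stays away from its vertices;
   block [c + 1] is his plan once Maker has claimed the vertex of node [c] of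
   block 0. *)
Definition maker_shape sh : shape :=
  (sh.1 * sh.1.+1,
   (flatten [seq [seq [seq a + c * sh.1 | a <- p] | p <- shape_paths sh]
            | c <- iota 0 sh.1.+1],
    flatten [seq [seq (q.1 + c * sh.1, q.2 + c * sh.1) | q <- shape_conflicts sh]
            | c <- iota 0 sh.1.+1]
    ++ [seq (c, a + c.+1 * sh.1) | c <- iota 0 sh.1, a <- iota 0 sh.1])).

Definition root_shape sh : shape :=
  (sh.1.+1, ([seq 0 :: [seq a.+1 | a <- p] | p <- shape_paths sh],
             [seq (q.1.+1, q.2.+1) | q <- shape_conflicts sh])).

(** With no move left there is one play, on which Breaker adds nothing; its empty path still demands
    a transversal. Each further move turns [N] nodes into [N * N.+1 + 1]. *)
Definition breaker_shape k : shape :=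
  iter k (fun sh => root_shape (maker_shape sh)) (0, ([:: [::]], [::])).

Definition shape_wf sh : bool :=
  all (all (fun a => a < sh.1)) (shape_paths sh) &&
  all (fun q => (q.1 < sh.1) && (q.2 < sh.1)) (shape_conflicts sh).

Lemma block_lt N c a : a < N -> c < N.+1 -> a + c * N < N * N.+1.
Proof. by move=> aN cN; nia. Qed.

Lemma maker_shape_wf sh : shape_wf sh -> shape_wf (maker_shape sh).
Proof.
case: sh => N [ps cs] /andP[/= /allP hp /allP hc]; apply/andP; split=> /=.
  apply/allP => _ /flattenP[_ /mapP[c hc' ->] /mapP[p pP ->]]; rewrite all_map.
  move: hc'; rewrite mem_iota => /= hc'.
  by apply/sub_all/(hp p pP) => a aN; apply: block_lt.
rewrite all_cat; apply/andP; split.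
  apply/allP => _ /flattenP[_ /mapP[c hc' ->] /mapP[q qP ->]].
  move: hc'; rewrite mem_iota => /= hc'; have /andP[q1 q2] := hc q qP.
  by rewrite !block_lt.
apply/allP => _ /allpairsP[[c a] /= [hc' ha ->]] /=.
move: hc' ha; rewrite !mem_iota /= => hc' ha; rewrite block_lt ?ltnS //.
by rewrite andbT; nia.
Qed.

Lemma root_shape_wf sh : shape_wf sh -> shape_wf (root_shape sh).
Proof.
case: sh => N [ps cs] /andP[/= /allP hp /allP hc]; apply/andP; split=> /=.
  apply/allP => _ /mapP[p /hp pP ->] /=; rewrite all_map.
  exact: sub_all pP.
by apply/allP => _ /mapP[q /hc qP ->].
Qed.

Lemma breaker_shape_wf k : shape_wf (breaker_shape k).
Proof. by elim: k => // k IH; apply/root_shape_wf/maker_shape_wf. Qed.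

Section Trees.
Variables (X : finType) (F : {set {set X}}).
Implicit Types (S M A : {set X}) (w : nat -> option X).

Definition path_set w (p : seq nat) : {set X} := [set v | Some v \in map w p].

(** A node with [w a = None] is a pass. [A] is Maker's set when a strategy is read off a tree, but
    all claimed vertices when a tree is built from a strategy. *)
Definition tree_ok sh w A S : Prop :=
  [/\ forall a v, a < sh.1 -> w a = Some v -> v \notin A,
      forall q v, q \in shape_conflicts sh -> w q.1 = Some v -> w q.2 <> Some v
    & forall p, p \in shape_paths sh -> hits F (S :|: path_set w p)].

Lemma path_set_map w f p : path_set w (map f p) = path_set (w \o f) p.
Proof. by rewrite /path_set -map_comp. Qed.

Lemma eq_path_set w w' (p : seq nat) :
  {in p, w =1 w'} -> path_set w p = path_set w' p.
Proof. by move=> /eq_in_map e; rewrite /path_set e. Qed.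

Lemma path_set_cons w a p :
  path_set w (a :: p) = (if w a is Some v then [set v] else set0) :|: path_set w p.
Proof. by apply/setP => u; rewrite !inE /=; case: (w a) => [v|]; rewrite !inE. Qed.

Lemma maker_shape_sound sh (W : {set X} -> {set X} -> bool) S M w :
  (forall S M w, tree_ok sh w M S -> W S M) ->
  tree_ok (maker_shape sh) w M S -> maker_step W S M.
Proof.
move=> hW [hA hC hP].
have block c M' : c <= sh.1 ->
    (forall a v, a < sh.1 -> w (a + c * sh.1) = Some v -> v \notin M') -> W S M'.
  move=> hc hM; apply: (hW _ _ (fun a => w (a + c * sh.1))); split=> //.
    move=> q v qC; apply: (hC (q.1 + c * sh.1, q.2 + c * sh.1)).
    rewrite /= mem_cat; apply/orP; left; apply/flatten_mapP; exists c.
      by rewrite mem_iota.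
    exact: (map_f (fun q : nat * nat => (q.1 + c * sh.1, q.2 + c * sh.1))).
  move=> p pP; rewrite -(path_set_map w (fun a => a + c * sh.1)); apply: hP.
  apply/flatten_mapP; exists c; first by rewrite mem_iota.
  exact: (map_f (map (fun a => a + c * sh.1))).
apply/andP; split.
  by apply: (block 0) => // a v ha; apply: hA; apply: (@block_lt _ 0).
apply/forall_inP => u uS.
have [/hasP[c]|/hasPn hn] := boolP (has (fun c => w c == Some u) (iota 0 sh.1)).
  rewrite mem_iota => /= hc /eqP wc; apply: (block c.+1) => // a v ha wa.
  rewrite in_setU1 negb_or (hA _ _ _ wa) ?andbT; last exact: block_lt.
  apply/eqP => vu; apply: (hC (c, a + c.+1 * sh.1) u) => //=; last by rewrite -vu.
  rewrite mem_cat; apply/orP; right; apply/allpairsP; exists (c, a).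
  by rewrite !mem_iota.
apply: (block 0) => // a v ha; rewrite mul0n addn0 => wa.
rewrite in_setU1 negb_or (hA _ _ _ wa) ?andbT; last first.
  by have := @block_lt _ 0 _ ha isT; rewrite addn0.
apply/eqP => vu; have := hn a; rewrite mem_iota ha wa vu eqxx.
by move/(_ isT).
Qed.

Lemma maker_shape_complete sh (W : {set X} -> {set X} -> bool) S M :
  shape_wf sh ->
  (forall S M, W S M -> exists w, tree_ok sh w (S :|: M) S) ->
  maker_step W S M -> exists w, tree_ok (maker_shape sh) w (S :|: M) S.
Proof.
move=> /andP[/allP wfp /allP wfc] hW /andP[w0S /forall_inP step].
have [w0 ok0] := hW _ _ w0S.
have reply c : exists wc, tree_ok sh wc (S :|: M) S /\
    (c < sh.1 -> forall u a, w0 c = Some u -> a < sh.1 -> wc a <> Some u).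
  have [hc|hc] := ltnP c sh.1; last by exists w0.
  case wc0: (w0 c) => [u|]; last by exists w0.
  (* Here it matters that trees also avoid Breaker's own vertices: the vertex of a node is one that
     Maker may really claim. *)
  have uSM : u \notin S :|: M by case: ok0 => hA _ _; apply: hA wc0.
  have uS : u \notin S by apply: contra uSM; rewrite inE => ->.
  have [wc [hA hC hP]] := hW _ _ (step u uS).
  exists wc; split=> [|_ _ a [<-] ha wa].
    split=> // a v ha wa; have := hA a v ha wa; apply: contra.
    by rewrite !inE => /orP[->|->]; rewrite ?orbT.
  by have := hA a u ha wa; rewrite !inE eqxx orbT.
(* The replies to the separate nodes are collected into one family; nodes without a vertex and
   indices beyond the plan get [w0] as a filler. *)
have [r hr] := functional_choice _ reply.
pose block c := if c is c'.+1 then r c' else w0.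
have okb c : tree_ok sh (block c) (S :|: M) S by case: c => //= c; case: (hr c).
pose w b := block (b %/ sh.1) (b %% sh.1).
have wE c a : a < sh.1 -> w (a + c * sh.1) = block c a.
  move=> ha; rewrite /w addnC divnMDl ?(leq_ltn_trans _ ha) // divn_small // addn0.
  by rewrite modnMDl modn_small.
exists w; split=> [b v hb|q v|p].
- have N0 : 0 < sh.1 by move: hb; rewrite /=; case: (sh.1).
  by case: (okb (b %/ sh.1)) => hA _ _; apply: hA; rewrite ltn_mod.
- rewrite /= mem_cat => /orP[/flatten_mapP[c _ /mapP[q' q'C ->]]|] /=.
    have /andP[q1 q2] := wfc _ q'C; rewrite !wE //.
    by case: (okb c) => _ hC _; apply: hC.
  case/allpairsP => -[c a] /= [hc ha ->] /=; move: hc ha; rewrite !mem_iota /= => hc ha.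
  rewrite -[c in w c]addn0 -(mul0n sh.1) !wE //= => w0c; apply: (hr c).2 w0c ha.
  exact: hc.
- case/flatten_mapP => c _ /mapP[p' p'P ->].
  rewrite path_set_map (eq_path_set (w' := block c)); first by case: (okb c) => _ _; apply.
  by move=> a /(allP (wfp _ p'P)) ha /=; rewrite wE.
Qed.

Lemma breaker_shape_sound k S M w :
  tree_ok (breaker_shape k) w M S -> breaker_value F k S M.
Proof.
elim: k S M w => [|k IH] S M w [hA hC hP].
  have e : path_set w [::] = set0 by apply/setP => v; rewrite !inE.
  by have := hP [::] (mem_head _ _); rewrite e setU0.
have sub S' : (forall p, p \in shape_paths (maker_shape (breaker_shape k)) ->
      hits F (S' :|: path_set (w \o succn) p)) ->
    maker_step (breaker_value F k) S' M.
  move=> hP'; apply: (maker_shape_sound IH (w := w \o succn)); split=> //.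
    by move=> a v ha; apply: hA.
  move=> q v qC; apply: (hC (q.1.+1, q.2.+1)).
  exact: (map_f (fun q : nat * nat => (q.1.+1, q.2.+1))).
have hP' p : p \in shape_paths (maker_shape (breaker_shape k)) ->
    hits F (S :|: path_set w (0 :: map succn p)).
  by move=> pP; apply: hP; apply: (map_f (fun p => 0 :: map succn p)).
apply/orP; case w0: (w 0) => [v|].
  right; apply/existsP; exists v; rewrite (hA 0 v) //=; apply: sub => p /hP'.
  by rewrite path_set_cons w0 path_set_map setUA [S :|: _]setUC.
left; apply: sub => p /hP'.
by rewrite path_set_cons w0 set0U path_set_map.
Qed.

Lemma breaker_shape_complete k S M :
  breaker_value F k S M -> exists w, tree_ok (breaker_shape k) w (S :|: M) S.
Proof.
elim: k S M => [|k IH] S M /=.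
  move=> hS; exists (fun=> None); split=> // p _.
  by apply: hits_sub hS; apply: subsetUl.
have step S' := maker_shape_complete (S := S') (M := M) (breaker_shape_wf k) IH.
have ext S' v w' : S \subset S' ->
    (if v is Some u then (u \notin M) && (S' \subset u |: S) else S' == S) ->
    tree_ok (maker_shape (breaker_shape k)) w' (S' :|: M) S' ->
    (if v is Some u then u \notin S else true) ->
    exists w, tree_ok (breaker_shape k.+1) w (S :|: M) S.
  move=> sS hv [hA hC hP] vS.
  exists (fun b => if b is b'.+1 then w' b' else v); split.
  - move=> [|a] u /= ha; last first.
      move=> /(hA _ _ ha); apply: contra; rewrite !inE => /orP[uS|->]; rewrite ?orbT //.
      by rewrite (subsetP sS).
    by move=> vu; move: hv vS; rewrite vu inE negb_or => /andP[-> _] ->.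
  - by move=> _ u /mapP[q qC ->]; apply: hC.
  - move=> _ /mapP[p pP ->]; apply: hits_sub (hP p pP).
    rewrite path_set_cons path_set_map setUA; apply: setSU.
    by case: v hv {vS} => [x /andP[_ /subset_trans]|/eqP->]; rewrite ?setU0 // setUC; apply.
case/orP => [/step[w ok]|/existsP[v /andP[vM /step[w ok]]]].
  by apply: (ext S None w).
(* Claiming an owned vertex is recorded as a pass, since the nodes of the tree must avoid [S]. *)
have [vS|vS] := boolP (v \in S).
  have e : v |: S = S by apply/setUidPr; rewrite sub1set.
  by apply: (ext S None w) => //; rewrite e in ok.
by apply: (ext (v |: S) (Some v) w); rewrite /= ?vM ?subxx ?subsetUr.
Qed.

Definition game_shape first k : shape :=
  if is_breaker first then breaker_shape k else maker_shape (breaker_shape k).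

Theorem game_shapeP first k :
  game_value F first k <-> exists w, tree_ok (game_shape first k) w set0 set0.
Proof.
rewrite /game_value /game_shape; case: ifP => _; split.
- by case/breaker_shape_complete => w; rewrite setU0; exists w.
- by case=> w; apply: breaker_shape_sound.
- case/(maker_shape_complete (breaker_shape_wf k) (@breaker_shape_complete k)) => w.
  by rewrite setU0; exists w.
- case=> w; apply: maker_shape_sound; exact: breaker_shape_sound.
Qed.
End Trees.

(** * Circuits *)

Section NodeValues.
Variables (A : Type) (a0 : A) (f : seq A -> gate -> A).

Definition node_values (C : circuit) : seq A :=
  foldl (fun vs g => rcons vs (f vs g)) [::] C.

Lemma node_values_rcons C g :
  node_values (rcons C g) = rcons (node_values C) (f (node_values C) g).
Proof. by rewrite /node_values -cats1 foldl_cat. Qed.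

Lemma size_node_values C : size (node_values C) = size C.
Proof. by elim/last_ind: C => // C g IH; rewrite node_values_rcons !size_rcons IH. Qed.

Lemma nth_node_values C i : i < size C ->
  nth a0 (node_values C) i = f (take i (node_values C)) (nth GInput C i).
Proof.
elim/last_ind: C => // C g IH; rewrite size_rcons ltnS leq_eqVlt node_values_rcons.
rewrite -!cats1 => /predU1P[->|iC].
  by rewrite !nth_cat size_node_values ltnn subnn /= take_size_cat ?size_node_values.
by rewrite !nth_cat size_node_values iC takel_cat ?size_node_values 1?ltnW // IH.
Qed.

Lemma fold_circuitE C : fold_circuit a0 f C = nth a0 (node_values C) (size C).-1.
Proof. by rewrite -[size C]size_node_values nth_last. Qed.
End NodeValues.

Section CircuitNodes.
Variable C : circuit.
Hypothesis wfC : circuit_wf C.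

Lemma circuit_wf_arg i j :
  i < size C -> j \in gate_args (nth GInput C i) -> j < i.
Proof.
move=> iC; case/andP: wfC => _ /allP/(_ i); rewrite mem_iota iC => /(_ isT)/allP.
exact.
Qed.

Lemma nth_depths i : i < size C ->
  let ds := node_values gate_depth C in
  nth 0 ds i = if is_input (nth GInput C i) then 0
               else (\max_(j <- gate_args (nth GInput C i)) nth 0 ds j).+1.
Proof.
move=> iC /=; rewrite nth_node_values // /gate_depth; case: ifP => // _.
congr _.+1; apply: eq_big_seq => j /(circuit_wf_arg iC) ji.
by rewrite nth_take.
Qed.

Lemma nth_wefts i : i < size C ->
  let ws := node_values gate_weft C in
  nth 0 ws i = is_large (nth GInput C i)
               + \max_(j <- gate_args (nth GInput C i)) nth 0 ws j.
Proof.
move=> iC /=; rewrite nth_node_values // /gate_weft; congr addn.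
by apply: eq_big_seq => j /(circuit_wf_arg iC) ji; rewrite nth_take.
Qed.

Lemma nth_gate_values a i : i < size C ->
  let vs := node_values (gate_value a) C in
  nth false vs i = match nth GInput C i with
                   | GInput => a i
                   | GNot j => ~~ nth false vs j
                   | GAnd s => all (nth false vs) s
                   | GOr s => has (nth false vs) s
                   end.
Proof.
move=> iC /=; rewrite nth_node_values //; have := @circuit_wf_arg i^~ iC.
case: (nth GInput C i) => [|j|s|s] /= h.
- by rewrite size_takel // size_node_values ltnW.
- by rewrite nth_take // h ?mem_head.
- by apply: eq_in_all => j /h ji; rewrite nth_take.
- by apply: eq_in_has => j /h ji; rewrite nth_take.
Qed.
End CircuitNodes.

(** Turns circuits into values of an [encType], so that reductions can produce and parse them;
    [code_ok] below describes the image. *)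
Definition gate_code (g : gate) : nat * seq nat := (gate_tag g, gate_args g).

Definition code_gate (q : nat * seq nat) : gate :=
  match q.1 with
  | 0 => GInput
  | 1 => GNot (head 0 q.2)
  | 2 => GAnd q.2
  | _ => GOr q.2
  end.

Lemma gate_codeK : cancel gate_code code_gate.
Proof. by case. Qed.

Definition code_ok (q : nat * seq nat) : bool :=
  [|| (q.1 == 0) && (q.2 == [::]), (q.1 == 1) && (size q.2 == 1), q.1 == 2 | q.1 == 3].

Lemma code_gateK q : code_ok q -> gate_code (code_gate q) = q.
Proof.
case: q => t s; rewrite /code_ok /= => /or4P[/andP[/eqP-> /eqP->]|/andP[/eqP->]|/eqP->|/eqP->] //.
by case: s => [|x []].
Qed.

Lemma gate_code_ok g : code_ok (gate_code g).
Proof. by case: g. Qed.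

Lemma encode_circuitE C : encode_circuit C = enc [seq gate_code g | g <- C].
Proof. by rewrite [RHS]/(dlist _) -map_comp. Qed.

Section CNF.

Definition literal : Type := (bool * nat)%type.

Definition literal_node NV (l : literal) : nat := if l.1 then l.2 else NV + l.2.

(** Negations have fan-in one, so a path to the output meets at most two large gates, a clause and
    the final conjunction. *)
Definition cnf_code NV (cls : seq (seq literal)) : seq (nat * seq nat) :=
  nseq NV (0, [::]) ++ [seq (1, [:: i]) | i <- iota 0 NV]
  ++ [seq (3, [seq literal_node NV l | l <- cl]) | cl <- cls]
  ++ [:: (2, iota (NV + NV) (size cls))].

Definition cnf_circuit NV cls : circuit := [seq code_gate q | q <- cnf_code NV cls].

Lemma encode_cnf_circuit NV cls :
  encode_circuit (cnf_circuit NV cls) = enc (cnf_code NV cls).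
Proof.
rewrite encode_circuitE /cnf_circuit -map_comp; congr enc.
rewrite -[RHS]map_id; apply/eq_in_map => q qC; apply: code_gateK.
move: qC; rewrite !mem_cat => /or4P[/nseqP[-> //]|/mapP[i _ ->]//|/mapP[cl _ ->]|] //.
by rewrite inE => /eqP->.
Qed.

Variables (NV : nat) (cls : seq (seq literal)).
Hypothesis cls_lt : all (all (fun l => l.2 < NV)) cls.
Let C := cnf_circuit NV cls.

Lemma size_cnf_circuit : size C = NV + NV + (size cls).+1.
Proof.
by rewrite size_map /cnf_code !size_cat size_nseq !size_map size_iota addn1 addnA.
Qed.

Lemma nth_cnf_input i : i < NV -> nth GInput C i = GInput.
Proof.
move=> iN; rewrite /C /cnf_circuit (nth_map (0, [::])) /cnf_code ?nth_cat ?size_nseq ?iN.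
  by rewrite nth_nseq iN.
by rewrite size_cat size_nseq ltn_addr.
Qed.

Lemma nth_cnf_not i : i < NV -> nth GInput C (NV + i) = GNot i.
Proof.
move=> iN; rewrite /C /cnf_circuit /cnf_code map_cat nth_cat size_map size_nseq.
rewrite ltnNge leq_addr /= addKn map_cat nth_cat !size_map size_iota iN.
by rewrite -map_comp (nth_map 0) ?size_iota // nth_iota.
Qed.

Lemma nth_cnf_or c : c < size cls ->
  nth GInput C (NV + NV + c) = GOr [seq literal_node NV l | l <- nth [::] cls c].
Proof.
move=> hc; rewrite /C /cnf_circuit /cnf_code map_cat nth_cat size_map size_nseq.
rewrite -addnA ltnNge leq_addr /= addKn map_cat nth_cat !size_map size_iota.
rewrite ltnNge leq_addr /= addKn map_cat nth_cat !size_map hc -map_comp.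
by rewrite (nth_map [::]).
Qed.

Lemma nth_cnf_and :
  nth GInput C (NV + NV + size cls) = GAnd (iota (NV + NV) (size cls)).
Proof.
rewrite /C /cnf_circuit /cnf_code map_cat nth_cat size_map size_nseq.
rewrite -addnA ltnNge leq_addr /= addKn map_cat nth_cat !size_map size_iota.
by rewrite ltnNge leq_addr /= addKn map_cat nth_cat !size_map ltnn subnn.
Qed.

Lemma cnf_nodeP i : i < size C ->
  [\/ i < NV, exists2 j, j < NV & i = NV + j,
      exists2 c, c < size cls & i = NV + NV + c | i = NV + NV + size cls].
Proof.
rewrite size_cnf_circuit addnS ltnS => hi.
have [h1|h1] := ltnP i NV; first by constructor 1.
have [h2|h2] := ltnP i (NV + NV); first by constructor 2; exists (i - NV); lia.
have [h3|h3] := ltnP i (NV + NV + size cls); last by constructor 4; lia.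
by constructor 3; exists (i - (NV + NV)); lia.
Qed.

Lemma clause_lt c j : c < size cls ->
  j \in [seq literal_node NV l | l <- nth [::] cls c] ->
  exists2 i, i < NV & j = i \/ j = NV + i.
Proof.
move=> hc /mapP[[b i] li ->]; have /allP/(_ _ li) /= iN := allP cls_lt _ (mem_nth [::] hc).
by exists i => //; case: b {li}; [left|right].
Qed.

Lemma cnf_circuit_wf : circuit_wf C.
Proof.
apply/andP; split; first by rewrite size_cnf_circuit addnS.
apply/allP => i; rewrite mem_iota => /= /cnf_nodeP[h|[j h ->]|[c h ->]|->].
- by rewrite nth_cnf_input.
- by rewrite nth_cnf_not //= andbT (leq_trans h) // leq_addr.
- rewrite nth_cnf_or //; apply/allP => j /(clause_lt h)[l lN [->|->]]; lia.
- by rewrite nth_cnf_and; apply/allP => j; rewrite mem_iota => /andP[].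
Qed.

Lemma cnf_lt_size i : i <= NV + NV + size cls -> i < size C.
Proof. by rewrite size_cnf_circuit addnS. Qed.

Lemma cnf_circuit_last : (size C).-1 = NV + NV + size cls.
Proof. by rewrite size_cnf_circuit addnS. Qed.

Lemma cnf_circuit_depth : depth C <= 3.
Proof.
rewrite /depth fold_circuitE cnf_circuit_last; set ds := node_values _ _.
have d := nth_depths cnf_circuit_wf.
have d0 i : i < NV -> nth 0 ds i = 0.
  by move=> iN; rewrite d ?nth_cnf_input //; apply: cnf_lt_size; lia.
have d1 i : i < NV -> nth 0 ds (NV + i) <= 1.
  move=> iN; rewrite d ?nth_cnf_not //=; last by apply: cnf_lt_size; lia.
  by rewrite big_seq1 d0.
have d2 c : c < size cls -> nth 0 ds (NV + NV + c) <= 2.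
  move=> hc; rewrite d ?nth_cnf_or //; last by apply: cnf_lt_size; lia.
  rewrite ltnS; apply/bigmax_leqP_seq => j /= /(clause_lt hc)[i iN [->|->]] _.
    by rewrite d0.
  exact: d1.
rewrite d ?nth_cnf_and //; last exact: cnf_lt_size.
rewrite ltnS; apply/bigmax_leqP_seq => j /=; rewrite mem_iota => /andP[h1 h2] _.
by rewrite -(subnKC h1) d2 // ltn_subLR.
Qed.

Lemma cnf_circuit_weft : weft C <= 2.
Proof.
rewrite /weft fold_circuitE cnf_circuit_last; set ws := node_values _ _.
have w := nth_wefts cnf_circuit_wf.
have w0 i : i < NV -> nth 0 ws i = 0.
  move=> iN; rewrite w ?nth_cnf_input //= ?big_nil //.
  by apply: cnf_lt_size; lia.
have w1 i : i < NV -> nth 0 ws (NV + i) = 0.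
  move=> iN; rewrite w ?nth_cnf_not //=; last by apply: cnf_lt_size; lia.
  by rewrite big_seq1 w0.
have w2 c : c < size cls -> nth 0 ws (NV + NV + c) <= 1.
  move=> hc; rewrite w ?nth_cnf_or //; last by apply: cnf_lt_size; lia.
  rewrite -[1]addn0; apply: leq_add; first exact: leq_b1.
  apply/bigmax_leqP_seq => j /= /(clause_lt hc)[i iN [->|->]] _.
    by rewrite w0.
  by rewrite w1.
rewrite w ?nth_cnf_and //; last exact: cnf_lt_size.
rewrite -[2]/(1 + 1); apply: leq_add; first exact: leq_b1.
apply/bigmax_leqP_seq => j /=; rewrite mem_iota => /andP[h1 h2] _.
by rewrite -(subnKC h1) w2 // ltn_subLR.
Qed.

Lemma satisfies_cnf_circuit a :
  satisfies a C = all (has (fun l => l.1 == a l.2)) cls.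
Proof.
rewrite /satisfies fold_circuitE cnf_circuit_last.
have := nth_gate_values cnf_circuit_wf a; set vs := node_values _ _ => v.
have v0 i : i < NV -> nth false vs i = a i.
  by move=> iN; rewrite v ?nth_cnf_input //; apply: cnf_lt_size; lia.
have v1 i : i < NV -> nth false vs (NV + i) = ~~ a i.
  move=> iN; rewrite v ?nth_cnf_not ?v0 //.
  by apply: cnf_lt_size; lia.
have v2 c : c < size cls ->
    nth false vs (NV + NV + c) = has (fun l => l.1 == a l.2) (nth [::] cls c).
  move=> hc; rewrite v ?nth_cnf_or //; last by apply: cnf_lt_size; lia.
  rewrite has_map; apply: eq_in_has => -[b i] li /=.
  have /allP/(_ _ li) /= iN := allP cls_lt _ (mem_nth [::] hc).
  by case: b {li}; rewrite /literal_node /=; [rewrite v0|rewrite v1]; case: (a i).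
rewrite v ?nth_cnf_and //; last exact: cnf_lt_size.
rewrite -[NV + NV]addn0 iotaDl all_map -{2}(mkseq_nth [::] cls) all_map.
apply: eq_in_all => c; rewrite mem_iota => /= hc.
by rewrite v2.
Qed.

Lemma weight_cnf_circuit a : weight a C = count a (iota 0 NV).
Proof.
rewrite /weight size_cnf_circuit -addnA iotaD count_cat add0n -[RHS]addn0; congr addn.
  apply: eq_in_count => i; rewrite mem_iota => /= iN.
  by rewrite nth_cnf_input.
apply/eqP; rewrite -leqn0 leqNgt -has_count; apply/hasPn => i.
rewrite mem_iota => /andP[h1 h2].
have /cnf_nodeP[|[j h ->]|[c h ->]|->] : i < size C by rewrite size_cnf_circuit; lia.
- by rewrite ltnNge h1.
- by rewrite nth_cnf_not.
- by rewrite nth_cnf_or.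
- by rewrite nth_cnf_and.
Qed.
End CNF.

(** * Membership in W[2] *)

Section TreeFormula.
Variable n : nat.

(* The variable [a * n.+1 + v] says that node [a] carries the vertex [v], or no
   vertex if [v = n]. *)
Definition node_var (a v : nat) : nat := a * n.+1 + v.

(** Only genuine vertices exclude each other. The variable for the value [n] occurs in no clause of
    the formula; it pads the weight of a node without a vertex. *)
Definition unique_clauses N : seq (seq literal) :=
  flatten [seq flatten [seq [seq [:: (false, node_var a v); (false, node_var a u)]
                            | u <- iota 0 n & u != v]
                       | v <- iota 0 n] | a <- iota 0 N].

Definition conflict_clauses (cs : seq (nat * nat)) : seq (seq literal) :=
  flatten [seq [seq [:: (false, node_var q.1 v); (false, node_var q.2 v)]
               | v <- iota 0 n] | q <- cs].

Definition path_clauses (ps es : seq (seq nat)) : seq (seq literal) :=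
  flatten [seq [seq flatten [seq [seq (true, node_var a v) | v <- e] | a <- p]
               | e <- es] | p <- ps].

Definition tree_clauses (es : seq (seq nat)) (sh : shape) : seq (seq literal) :=
  unique_clauses sh.1 ++ conflict_clauses (shape_conflicts sh)
  ++ path_clauses (shape_paths sh) es.

Lemma node_var_lt N a v : a < N -> v <= n -> node_var a v < N * n.+1.
Proof. by rewrite /node_var => aN vn; nia. Qed.

Lemma node_var_div a v : v <= n -> node_var a v %/ n.+1 = a.
Proof. by move=> vn; rewrite /node_var divnMDl // divn_small // addn0. Qed.

Lemma node_var_mod a v : v <= n -> node_var a v %% n.+1 = v.
Proof. by move=> vn; rewrite /node_var modnMDl modn_small. Qed.

Variables (es : seq (seq 'I_n)) (sh : shape).
Hypothesis wf_sh : shape_wf sh.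
Let es' := [seq [seq val v | v <- e] | e <- es].

Lemma tree_clauses_lt :
  all (all (fun l => l.2 < sh.1 * n.+1)) (tree_clauses es' sh).
Proof.
have /andP[/allP wfp /allP wfc] := wf_sh.
rewrite /tree_clauses !all_cat; apply/and3P; split.
- apply/allP => _ /flatten_mapP[a + /flatten_mapP[v + /mapP[u + ->]]].
  rewrite mem_filter !mem_iota => /= ha hv /andP[_ hu].
  by rewrite !node_var_lt // ltnW.
- apply/allP => _ /flatten_mapP[q /wfc/andP[q1 q2] /mapP[v + ->]].
  by rewrite mem_iota => /= hv; rewrite !node_var_lt // ltnW.
- apply/allP => _ /flatten_mapP[p /wfp/allP hp /mapP[_ /mapP[e _ ->] ->]].
  apply/allP => _ /flatten_mapP[a /hp ha /mapP[_ /mapP[v _ ->] ->]] /=.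
  by rewrite node_var_lt // ltnW.
Qed.

Lemma tree_clauses_sound a :
  all (has (fun l => l.1 == a l.2)) (tree_clauses es' sh) ->
  exists w, tree_ok (hyperedge_set es) sh w set0 set0.
Proof.
have /andP[/allP wfp /allP wfc] := wf_sh.
rewrite /tree_clauses !all_cat => /and3P[/allP hu /allP hc /allP hp].
have uniq_v b (v u : 'I_n) : b < sh.1 -> a (node_var b v) -> a (node_var b u) -> u = v.
  move=> hb av au; apply/eqP; apply: contraT => ne.
  have /hu /= : [:: (false, node_var b v); (false, node_var b u)] \in unique_clauses sh.1.
    apply/flatten_mapP; exists b; first by rewrite mem_iota.
    apply/flatten_mapP; exists (val v); first by rewrite mem_iota /=.
    by apply/mapP; exists (val u); rewrite // mem_filter mem_iota /= ltn_ord andbT.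
  by rewrite av au.
pose w b := [pick v : 'I_n | a (node_var b v)].
have wP b v : w b = Some v -> a (node_var b v).
  by rewrite /w; case: pickP => // u au [<-].
exists w; split=> [b v _ _|q v qC /wP a1 /wP a2|p pP].
- by rewrite inE.
- have /hc /= : [:: (false, node_var q.1 v); (false, node_var q.2 v)]
      \in conflict_clauses (shape_conflicts sh).
    apply/flatten_mapP; exists q => //.
    by apply/mapP; exists (val v); rewrite // mem_iota /=.
  by rewrite a1 a2.
- rewrite set0U; apply/hitsP => _ /[!inE] /mapP[e eE ->].
  have /hp/hasP[l /flatten_mapP[b bp /mapP[_ /mapP[v ve ->] ->]] /= /eqP av] :
      flatten [seq [seq (true, node_var b v) | v <- [seq val v | v <- e]] | b <- p]
      \in path_clauses (shape_paths sh) es'.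
    apply/flatten_mapP; exists p => //; apply/mapP.
    by exists [seq val v | v <- e] => //; apply: map_f.
  exists v; first by rewrite inE.
  rewrite inE; apply/mapP; exists b => //; rewrite /w; case: pickP => [u au|/(_ v)].
    by rewrite (uniq_v b v u) // (allP (wfp _ pP)).
  by rewrite -av.
Qed.

(** Each node owns a block of [m] variables, exactly one of which is true, so the weight is the
    number of nodes. *)
Lemma count_divn_modn (f : nat -> nat) m N : (forall a, f a < m) ->
  count (fun i => f (i %/ m) == i %% m) (iota 0 (N * m)) = N.
Proof.
move=> fm; have m0 : 0 < m := leq_ltn_trans (leq0n _) (fm 0).
elim: N => // N IH; rewrite mulSnr iotaD count_cat IH add0n -[N * m]addn0 iotaDl.
rewrite count_map -addn1; congr addn.
rewrite (@eq_in_count _ _ (pred1 (f N))) => [|i].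
  by rewrite count_uniq_mem ?iota_uniq // mem_iota /= fm.
rewrite mem_iota => /= im; rewrite divnMDl // modnMDl divn_small // modn_small //.
by rewrite addn0 eq_sym.
Qed.

Lemma tree_clauses_complete w :
  tree_ok (hyperedge_set es) sh w set0 set0 ->
  exists2 a, all (has (fun l => l.1 == a l.2)) (tree_clauses es' sh)
    & count a (iota 0 (sh.1 * n.+1)) = sh.1.
Proof.
move=> [_ hC hP]; pose code b := if w b is Some v then val v else n.
pose a i := code (i %/ n.+1) == i %% n.+1.
have aE b v : v <= n -> a (node_var b v) = (code b == v).
  by move=> vn; rewrite /a node_var_div // node_var_mod.
have codeP b v (vn : v < n) : (code b == v) = (w b == Some (Ordinal vn)).
  rewrite /code; case: (w b) => [u|]; first by rewrite -[RHS]val_eqE.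
  by rewrite gtn_eqF.
exists a; last first.
  apply: count_divn_modn => b; rewrite /code; case: (w b) => // v.
  exact: (leqW (ltn_ord v)).
rewrite /tree_clauses !all_cat; apply/and3P; split.
- apply/allP => _ /flatten_mapP[b + /flatten_mapP[v + /mapP[u + ->]]].
  rewrite mem_filter !mem_iota => /= _ hv /andP[ne hu].
  rewrite !aE 1?ltnW // orbF; case: (code b =P v) => //= ->.
  by rewrite [v == u]eq_sym (negbTE ne).
- apply/allP => _ /flatten_mapP[q qC /mapP[v + ->]].
  rewrite mem_iota => /= hv; rewrite !aE 1?ltnW // !codeP orbF.
  case: (w q.1 =P _) => //= w1.
  by case: (w q.2 =P _) => // /(hC q _ qC w1).
- apply/allP => _ /flatten_mapP[p pP /mapP[_ /mapP[e eE ->] ->]].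
  have /hitsP/(_ [set v in e]) := hP p pP; rewrite inE map_f // => /(_ isT)[v].
  rewrite !inE => ve /mapP[b bp wb]; apply/hasP; exists (true, node_var b v).
    apply/flatten_mapP; exists b => //; apply: map_f; exact: map_f.
  by rewrite /= aE 1?ltnW // /code -wb eqxx.
Qed.
End TreeFormula.

Lemma ptime_tree_clauses (X : encType) (n : X -> nat) (es : X -> seq (seq nat))
    (sh : X -> shape) :
  ptime n -> ptime es -> ptime sh -> ptime (fun x => tree_clauses (n x) (es x) (sh x)).
Proof.
move=> hn hes hsh.
suff h : ptime (fun p : nat * (seq (seq nat) * shape) => tree_clauses p.1 p.2.1 p.2.2).
  exact: ptime_comp h (ptime_pair hn (ptime_pair hes hsh)).
rewrite /tree_clauses /unique_clauses /conflict_clauses /path_clauses /node_var.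
rewrite /shape_conflicts /shape_paths; ptime.
Qed.

Lemma ptime_cnf_code (X : encType) (NV : X -> nat) (cls : X -> seq (seq literal)) :
  ptime NV -> ptime cls -> ptime (fun x => cnf_code (NV x) (cls x)).
Proof.
move=> hN hc.
suff h : ptime (fun p : nat * seq (seq literal) => cnf_code p.1 p.2).
  exact: ptime_comp h (ptime_pair hN hc).
rewrite /cnf_code /literal_node; ptime.
Qed.

Lemma ptime_maker_shape (X : encType) (sh : X -> shape) :
  ptime sh -> ptime (fun x => maker_shape (sh x)).
Proof.
move=> hsh; apply: (ptime_comp (g := maker_shape)) => //.
rewrite /maker_shape /shape_conflicts /shape_paths; ptime.
Qed.

Lemma ptime_root_shape (X : encType) (sh : X -> shape) :
  ptime sh -> ptime (fun x => root_shape (sh x)).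
Proof.
move=> hsh; apply: (ptime_comp (g := root_shape)) => //.
rewrite /root_shape /shape_conflicts /shape_paths; ptime.
Qed.

Definition game_code : Type := (nat * (seq (seq nat) * bool))%type.

Definition game_code_ok (x : data) : bool :=
  let D := dec x : game_code in
  (enc D == x) && all (all (fun v => v < D.1)) D.2.1.

Lemma encode_gameE n (es : seq (seq 'I_n)) first :
  encode_game es first =
  enc (n, ([seq [seq val v | v <- e] | e <- es], is_breaker first)).
Proof.
rewrite !enc_pairE; congr (Cons _ (Cons _ _)).
rewrite [RHS]/(dlist _) -map_comp; congr dlist; apply: eq_map => e.
by rewrite [RHS]/(dlist _) -map_comp.
Qed.

Lemma game_code_okP x :
  reflect (exists n (es : seq (seq 'I_n)) first, x = encode_game es first)
    (game_code_ok x).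
Proof.
apply: (iffP idP) => [/andP[/eqP <-]|[n [es [first ->]]]]; last first.
  rewrite /game_code_ok encode_gameE encK eqxx /=; apply/allP => _ /mapP[e _ ->].
  by apply/allP => _ /mapP[v _ ->].
rewrite encK; case: (dec x : game_code) => n [es b] /= /allP h.
have lift (e : seq nat) : all (fun v => v < n) e -> exists e' : seq 'I_n, map val e' = e.
  elim: e => [|v e IH] /=; first by exists [::].
  by case/andP => vn /IH[e' <-]; exists (Ordinal vn :: e').
have [es' es'E] : exists es' : seq (seq 'I_n), map (map val) es' = es.
  elim: es h => [|e es IH] h; first by exists [::].
  have [e' <-] := lift e (h e (mem_head _ _)).
  have [|es' <-] := IH; last by exists (e' :: es').
  by move=> e1 he1; apply: h; rewrite inE he1 orbT.
exists n, es', (if b then Breaker else Maker); rewrite encode_gameE es'E.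
by case: b.
Qed.

Lemma short_breaker_encode_game n (es : seq (seq 'I_n)) first k :
  short_breaker_MB (encode_game es first) k <->
  breaker_wins_within (hyperedge_set es) first k.
Proof.
split=> [[n' [es' [first' []]]]|h]; last by exists n, es, first.
rewrite !encode_gameE => /enc_inj[en]; case: n' / en es' => es' ees efirst.
have -> : es' = es by apply/esym/(inj_map (inj_map val_inj)).
by have -> : first' = first by case: first efirst; case: first'.
Qed.

Lemma ptime_dec_game_code (X : encType) (a : X -> data) :
  ptime a -> ptime (fun x => dec (a x) : game_code).
Proof.
apply: ptime_dec_pair; first exact: ptime_dec_nat.
move=> Y b; apply: ptime_dec_pair; last exact: ptime_dec_bool.
by move=> Z c; apply: ptime_dec_seq => W d; apply: ptime_dec_seq; apply: ptime_dec_nat.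
Qed.

Ltac ptime_hook ::=
  lazymatch goal with
  | |- ptime (fun x => maker_shape (@?p x)) => apply: ptime_maker_shape
  | |- ptime (fun x => root_shape (@?p x)) => apply: ptime_root_shape
  | |- ptime (fun x => tree_clauses (@?p x) (@?q x) (@?r x)) => apply: ptime_tree_clauses
  | |- ptime (fun x => cnf_code (@?p x) (@?q x)) => apply: ptime_cnf_code
  | |- ptime (fun x => dec (@?p x)) => apply: ptime_dec_game_code
  end.

(** Data that encode no game go to [Nil], the code of the empty circuit, which is not well-formed
    and hence a no-instance. *)
Definition tree_reduction (p : (data * nat) * shape) : data * nat :=
  let D := dec p.1.1 : game_code in
  let sh := if D.2.2 then p.2 else maker_shape p.2 in
  if game_code_ok p.1.1 then
    (enc (cnf_code (sh.1 * D.1.+1) (tree_clauses D.1 D.2.1 sh)), sh.1)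
  else (Nil, 0).

Lemma ptime_tree_reduction : ptime tree_reduction.
Proof. by rewrite /tree_reduction /game_code_ok; ptime. Qed.

Theorem short_breaker_in_W2 : in_W 2 short_breaker_MB.
Proof.
(* Depth 3: a negation, a clause and the final conjunction. *)
exists 3; split=> //.
pose step sh := root_shape (maker_shape sh).
apply: (@fpt_intro _ _ _ step (0, ([:: [::]], [::])) tree_reduction
  (fun k => (breaker_shape k).1 + (maker_shape (breaker_shape k)).1)).
- by rewrite /step; ptime.
- exact: ptime_tree_reduction.
- apply: (effective_comp (g := fun sh : shape => sh.1 + (maker_shape sh).1)).
    by apply: ptime_effective; ptime.
  apply: effective_iter; apply: ptime_effective.
  by ptime.
- move=> x k; rewrite /tree_reduction -/(breaker_shape k).
  by case: ifP => //= _; case: ifP => _; rewrite ?leq_addr ?leq_addl.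
move=> x k; rewrite -/(breaker_shape k) /tree_reduction.
rewrite -[(x, k, breaker_shape k).1.1]/x -[(x, k, breaker_shape k).2]/(breaker_shape k).
case: game_code_okP => [[n [es [first hx]]]|bad]; last first.
  split=> /= [[n [es [first [hx _]]]]|[C [hC wfC _ _ _]]].
    by case: bad; exists n, es, first.
  by case: C hC wfC.
rewrite (_ : dec x = (n, ([seq [seq val v | v <- e] | e <- es], is_breaker first)));
  last by rewrite hx encode_gameE encK.
set es' := [seq [seq val v | v <- e] | e <- es]; set D := (n, _).
rewrite hx -[D.1]/n -[D.2.1]/es' -[D.2.2]/(is_breaker first).
set sh := if _ then _ else _.
rewrite -[(_, _).1]/(enc _) -[(_, _).2]/sh.1.
have shE : sh = game_shape first k by [].
have wf_sh : shape_wf sh.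
  by rewrite /sh; case: ifP => _; rewrite ?maker_shape_wf ?breaker_shape_wf.
have lt := tree_clauses_lt es wf_sh.
rewrite short_breaker_encode_game breaker_wins_withinP game_shapeP -shE; split.
  case=> w /tree_clauses_complete[a sat wt].
  exists (cnf_circuit (sh.1 * n.+1) (tree_clauses n es' sh)).
  split; rewrite ?encode_cnf_circuit ?cnf_circuit_wf ?cnf_circuit_weft ?cnf_circuit_depth //.
  by exists a; rewrite satisfies_cnf_circuit // weight_cnf_circuit.
case=> C [hC _ _ _ [a [sat _]]].
have eC : C = cnf_circuit (sh.1 * n.+1) (tree_clauses n es' sh).
  apply: (can_inj (mapK gate_codeK)); apply: (@enc_inj (seq (nat * seq nat))).
  by rewrite -!encode_circuitE -hC encode_cnf_circuit.
by apply: (tree_clauses_sound wf_sh (a := a)); rewrite eC satisfies_cnf_circuit in sat.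
Qed.

(** * Normal form of circuits of weft two *)

Lemma has_flatten (T : Type) (p : pred T) ss : has p (flatten ss) = has (has p) ss.
Proof. by elim: ss => //= s ss IH; rewrite has_cat IH. Qed.

Lemma all_flatten (T : Type) (p : pred T) ss : all p (flatten ss) = all (all p) ss.
Proof. by elim: ss => //= s ss IH; rewrite all_cat IH. Qed.

Section Levels.
Variable A : encType.

(* A value [v : seq (seq A)] is read as an OR of ANDs if [o], and as an AND of
   ORs otherwise; every node gets a value and one for its negation. *)
Definition eval_inner (e : pred A) (o : bool) (l : seq A) : bool :=
  if o then all e l else has e l.

Definition eval_outer (e : pred A) (o : bool) (v : seq (seq A)) : bool :=
  if o then has (eval_inner e o) v else all (eval_inner e o) v.

Definition distribute (v1 v2 : seq (seq A)) : seq (seq A) :=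
  [seq c1 ++ c2 | c1 <- v1, c2 <- v2].

(** A gate of the inner kind ([conj == o]) must multiply out its at most two arguments. The default
    [[:: [::]]] is true if [o] and false otherwise, which in both cases is neutral for that gate. *)
Definition small_gate (o conj : bool) (vs : seq (seq (seq A))) : seq (seq A) :=
  if conj == o then distribute (nth [:: [::]] vs 0) (nth [:: [::]] vs 1)
  else flatten vs.

(** Arguments of a large gate have smaller weft and arrive as single inner lists, so unbounded
    fan-in causes no multiplying out. *)
Definition large_gate (o conj : bool) (ls : seq (seq A)) : seq (seq A) :=
  if conj == o then [:: flatten ls] else ls.

(** [low] is the table of the level below, [L] the current approximation at this level. The second
    components follow by De Morgan, with the kind of the gate flipped. *)
Definition node_value (o : bool) (low : seq (seq A * seq A))
    (L : seq (seq (seq A) * seq (seq A))) (q : nat * seq nat) (i : nat) :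
    seq (seq A) * seq (seq A) :=
  let l j := nth ([::], [::]) low j in
  let v j := nth ([::], [::]) L j in
  if q.1 == 0 then ([:: (l i).1], [:: (l i).2])
  else if q.1 == 1 then ((v (head 0 q.2)).2, (v (head 0 q.2)).1)
  else if 2 < size q.2 then
    (large_gate o (q.1 == 2) [seq (l j).1 | j <- q.2],
     large_gate o (q.1 != 2) [seq (l j).2 | j <- q.2])
  else
    (small_gate o (q.1 == 2) [seq (v j).1 | j <- q.2],
     small_gate o (q.1 != 2) [seq (v j).2 | j <- q.2]).

(** After [r] rounds the nodes of depth less than [r] have their values. One round at most squares
    the sizes coming from small gates, so a constant number of rounds stays polynomial. *)
Definition level (o : bool) (low : seq (seq A * seq A)) (P : seq (nat * seq nat))
    (r : nat) : seq (seq (seq A) * seq (seq A)) :=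
  iter r (fun L => [seq node_value o low L (nth (0, [::]) P i) i | i <- iota 0 (size P)])
    [::].

Lemma eval_distribute e o v1 v2 :
  eval_outer e o (distribute v1 v2) =
  if o then eval_outer e o v1 && eval_outer e o v2
  else eval_outer e o v1 || eval_outer e o v2.
Proof.
rewrite /eval_outer /eval_inner /distribute; case: o.
  elim: v1 => //= c1 v1 IH; rewrite has_cat IH has_map.
  rewrite (eq_has (a2 := predI (fun=> all e c1) (all e))) => [|c]; last first.
    by rewrite /= all_cat.
  by case: (all e c1) => //=; rewrite ?has_pred0; case: (has _ _) => //=; case: has.
elim: v1 => //= c1 v1 IH; rewrite all_cat IH all_map.
rewrite (eq_all (a2 := predU (fun=> has e c1) (has e))) => [|c]; last first.
  by rewrite /= has_cat.
by case: (has e c1) => //=; rewrite ?all_predT //; case: (all _ v2); rewrite ?orbF ?orbT ?andbT.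
Qed.

Lemma eval_small_gate e o conj vs : size vs <= 2 ->
  eval_outer e o (small_gate o conj vs) =
  if conj then all (eval_outer e o) vs else has (eval_outer e o) vs.
Proof.
move=> sz; rewrite /small_gate; case: eqP => [->|].
  rewrite eval_distribute; case: vs sz => [|v1 [|v2 []]] //= _; case: o => //=;
  by rewrite ?andbT ?orbF // /eval_outer /= ?andbT ?orbF.
case: o conj => -[] // _; rewrite /eval_outer.
- by rewrite has_flatten.
- by rewrite all_flatten.
Qed.

Lemma eval_large_gate e o conj ls :
  eval_outer e o (large_gate o conj ls) =
  if conj then all (eval_inner e o) ls else has (eval_inner e o) ls.
Proof.
rewrite /large_gate; case: eqP => [->|].
  by rewrite /eval_outer /eval_inner; case: o; rewrite /= ?orbF ?andbT ?all_flatten ?has_flatten.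
by case: o conj => -[].
Qed.
End Levels.

Definition literal_values n : seq (seq literal * seq literal) :=
  [seq ([:: (true, i)], [:: (false, i)]) | i <- iota 0 n].

Definition eval_literal (a : nat -> bool) (l : literal) : bool := l.1 == a l.2.

(* The bound on the length of [t] is automatic for circuits of depth at most [d];
   it is what makes the gadget for terms polynomial. *)
Definition eval_term d a (t : seq literal) : bool :=
  (size t <= 2 ^ d) && all (eval_literal a) t.

(** One level for each weft 0, 1 and 2, with alternating kinds: an outer list of one level is read
    as an inner list of the next, whose atoms are the former inner lists. Depth [d] takes [d.+1]
    rounds. *)
Definition formula d (P : seq (nat * seq nat)) : seq (seq (seq (seq literal))) :=
  let v0 := level true (literal_values (size P)) P d.+1 in
  let v1 := level false v0 P d.+1 in
  (nth ([::], [::]) (level true v1 P d.+1) (size P).-1).1.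

(** Needed because the reduction has to recognise inputs that violate the bounds; entry [i] tells
    whether node [i] has depth at most [d]. *)
Definition depth_table d (P : seq (nat * seq nat)) : seq bool :=
  iter d (fun L => [seq (q.1 == 0) || all (nth false L) q.2 | q <- P])
    [seq q.1 == 0 | q <- P].

Definition weft_step (low : seq bool) (P : seq (nat * seq nat)) (r : nat) : seq bool :=
  iter r (fun L => [seq if 2 < size q.2 then all (nth false low) q.2
                        else all (nth false L) q.2 | q <- P]) [::].

(** Entry [i] tells whether the weft of node [i] is less than [l], provided its depth is less than
    [r]. Weft at most 2 is thus tested with [l = 3]. *)
Definition weft_table l (P : seq (nat * seq nat)) (r : nat) : seq bool :=
  iter l (fun low => weft_step low P r) [::].

Lemma bigmax_leq_all (F : nat -> nat) s m :
  (\max_(j <- s) F j <= m) = all (fun j => F j <= m) s.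
Proof.
elim: s => [|j s IH]; first by rewrite big_nil.
by rewrite big_cons geq_max IH.
Qed.

Section NormalForm.
Variable C : circuit.
Hypothesis wfC : circuit_wf C.
Let P := [seq gate_code g | g <- C].
Let D := nth 0 (node_values gate_depth C).
Let W := nth 0 (node_values gate_weft C).

Lemma nth_gate_code i : nth (0, [::]) P i = gate_code (nth GInput C i).
Proof.
have [iC|iC] := ltnP i (size C); first by rewrite (nth_map GInput).
by rewrite !nth_default ?size_map.
Qed.

Lemma depth_arg i j :
  i < size C -> j \in gate_args (nth GInput C i) -> j < size C /\ D j < D i.
Proof.
move=> iC ji; have jC := circuit_wf_arg wfC iC ji; split; first exact: ltn_trans iC.
rewrite [D i]nth_depths //; case: ifP ji => [|_ ji]; first by case: nth.
by rewrite ltnS (@leq_bigmax_seq _ _ xpredT D j).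
Qed.

(* The nodes which can be evaluated at level [l]. *)
Definition weft_below (l i : nat) : bool :=
  if l is l'.+1 then W i <= l' else is_input (nth GInput C i).

(** A large gate uses up one level and a small gate none, which is why large gates read the lower
    table and small gates their own. *)
Lemma weft_below_arg l i j : i < size C -> weft_below l.+1 i ->
  j \in gate_args (nth GInput C i) ->
  if is_large (nth GInput C i) then weft_below l j else weft_below l.+1 j.
Proof.
move=> iC hW ji.
have Wi : W i = is_large (nth GInput C i) + \max_(k <- gate_args (nth GInput C i)) W k.
  exact: nth_wefts.
have Wj : W j <= \max_(k <- gate_args (nth GInput C i)) W k.
  exact: (@leq_bigmax_seq _ _ xpredT W j).
move: hW; rewrite /= Wi; case: is_large => /=; last exact: leq_trans.
by case: l => [|l]; rewrite add1n // ltnS; apply: leq_trans.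
Qed.

Lemma weft_below_input l i :
  i < size C -> nth GInput C i = GInput -> weft_below l i.
Proof.
by move=> iC ei; case: l => [|l] /=; rewrite ?ei // /W nth_wefts // ei /= big_nil.
Qed.

Section LevelCorrect.
Variables (A : encType) (e : pred A) (o : bool) (low : seq (seq A * seq A)) (l : nat).
Variable a : nat -> bool.
Let V := nth false (node_values (gate_value a) C).
Let lo := nth ([::], [::]) low.
Let lv r := nth ([::], [::]) (level o low P r).

Lemma nth_level r i : i < size C ->
  lv r.+1 i = node_value o low (level o low P r) (gate_code (nth GInput C i)) i.
Proof.
move=> iC; rewrite /lv /level iterS -/(level _ _ _ r) (nth_map 0) ?size_iota ?size_map //.
by rewrite nth_iota ?size_map // add0n nth_gate_code.
Qed.

(** Induction on the rounds, as arguments have smaller depth. [R] limits the depth up to which the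
    table of the level below is reliable. *)
Lemma level_correct R :
  (forall i, i < size C -> D i < R -> weft_below l i ->
     eval_inner e o (lo i).1 = V i /\ eval_inner e o (lo i).2 = ~~ V i) ->
  forall r i, r <= R -> i < size C -> D i < r -> weft_below l.+1 i ->
    eval_outer e o (lv r i).1 = V i /\ eval_outer e o (lv r i).2 = ~~ V i.
Proof.
move=> hlow; elim=> // r IH i rR iC Dr Wi; rewrite nth_level //.
have DR : D i < R := leq_trans Dr rR.
have arg j : j \in gate_args (nth GInput C i) ->
    if is_large (nth GInput C i) then
      eval_inner e o (lo j).1 = V j /\ eval_inner e o (lo j).2 = ~~ V j
    else eval_outer e o (lv r j).1 = V j /\ eval_outer e o (lv r j).2 = ~~ V j.
  move=> ji; have [jC Dj] := depth_arg iC ji; have := weft_below_arg iC Wi ji.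
  case: is_large => Wj; first by apply: hlow => //; apply: ltn_trans Dj DR.
  by apply: IH => //; [apply: ltnW|apply: leq_trans Dj _].
have Vi : V i = _ := nth_gate_values wfC a iC; rewrite {}Vi -/V.
case ei: (nth GInput C i) arg => [|j|s|s] /= arg.
- have [h1 h2] := hlow i iC DR (weft_below_input _ iC ei).
  rewrite /node_value /= -/(lo i) /eval_outer; case: o h1 h2 => /= -> ->;
  by rewrite ?andbT ?orbF /V (nth_gate_values wfC) // ei.
- have [h1 h2] := arg j (mem_head _ _).
  by rewrite /node_value /= -/(lv r j) h1 h2 negbK.
- rewrite /node_value /= /is_large /= in arg *; case: ltnP arg => sz arg /=.
    rewrite !eval_large_gate !all_map !has_map -has_predC; split.
      by apply: eq_in_all => j /arg[].
    by apply: eq_in_has => j /arg[].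
  rewrite !eval_small_gate ?size_map // !all_map !has_map -has_predC; split.
    by apply: eq_in_all => j /arg[].
  by apply: eq_in_has => j /arg[].
- rewrite /node_value /= /is_large /= in arg *; case: ltnP arg => sz arg /=.
    rewrite !eval_large_gate !all_map !has_map -all_predC; split.
      by apply: eq_in_has => j /arg[].
    by apply: eq_in_all => j /arg[].
  rewrite !eval_small_gate ?size_map // !all_map !has_map -all_predC; split.
    by apply: eq_in_has => j /arg[].
  by apply: eq_in_all => j /arg[].
Qed.
End LevelCorrect.

Lemma nth_literal_values i : i < size C ->
  nth ([::], [::]) (literal_values (size P)) i = ([:: (true, i)], [:: (false, i)]).
Proof.
by move=> iC; rewrite (nth_map 0) ?size_iota ?nth_iota ?size_map.
Qed.

Definition short_terms d (v : seq (seq literal)) : bool :=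
  all (fun t => size t <= 2 ^ d) v.

Lemma short_terms_leq d d' v : d <= d' -> short_terms d v -> short_terms d' v.
Proof. by move=> le; apply: sub_all => t /leq_trans; apply; rewrite leq_pexp2l. Qed.

(** Terms grow only when two of them are concatenated, so one gate at most doubles their length;
    this is the origin of [2 ^ d]. *)
Lemma short_terms_small_gate o conj d vs :
  all (short_terms d) vs -> short_terms d.+1 (small_gate o conj vs).
Proof.
move=> h; rewrite /small_gate; case: eqP => _.
  have h' k : short_terms d (nth [:: [::]] vs k).
    have [hk|hk] := ltnP k (size vs); first exact: (allP h) (mem_nth _ hk).
    by rewrite nth_default.
  apply/allP => _ /allpairsP[[c1 c2] /= [/(allP (h' 0)) h1 /(allP (h' 1)) h2 ->]].
  by rewrite size_cat expnS mul2n -addnn leq_add.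
rewrite /short_terms all_flatten; apply: sub_all h => v; exact: short_terms_leq.
Qed.

Lemma level_short_terms r i : i < size C -> D i < r -> weft_below 1 i ->
  short_terms (D i) (nth ([::], [::]) (level true (literal_values (size P)) P r) i).1 /\
  short_terms (D i) (nth ([::], [::]) (level true (literal_values (size P)) P r) i).2.
Proof.
elim: r i => // r IH i iC Dr Wi; rewrite nth_level //.
have arg j : j \in gate_args (nth GInput C i) -> is_large (nth GInput C i) = false /\
    short_terms (D i).-1 (nth ([::], [::]) (level true (literal_values (size P)) P r) j).1 /\
    short_terms (D i).-1 (nth ([::], [::]) (level true (literal_values (size P)) P r) j).2.
  move=> ji; have [jC Dj] := depth_arg iC ji; have Wj := weft_below_arg iC Wi ji.
  have Wi' : W i = is_large (nth GInput C i) + \max_(k <- gate_args (nth GInput C i)) W k.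
    exact: nth_wefts.
  case: is_large Wj Wi' => Wj Wi'; first by move: Wi; rewrite /= Wi'.
  split=> //.
  have le : D j <= (D i).-1 by lia.
  by have [|h1 h2] := IH j jC _ Wj; [lia|split; apply: short_terms_leq le _].
have Dn0 j : j \in gate_args (nth GInput C i) -> (D i).-1.+1 = D i.
  by case/(depth_arg iC) => _; case: (D i).
have Dg : ~~ is_input (nth GInput C i) -> (D i).-1.+1 = D i.
  by move=> ni; rewrite [D i]nth_depths // (negbTE ni).
have both o1 o2 s (f g : nat -> seq (seq literal)) :
    0 < D i -> (forall j, j \in s -> short_terms (D i).-1 (f j) /\ short_terms (D i).-1 (g j)) ->
    short_terms (D i) (small_gate true o1 [seq f j | j <- s]) /\
    short_terms (D i) (small_gate true o2 [seq g j | j <- s]).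
  move=> D0 h; rewrite -(prednK D0).
  by split; apply: short_terms_small_gate; apply/allP => _ /mapP[j /h[] ? ? ->].
case: (nth GInput C i) arg Dg => [|j|s|s] /= arg Dg; rewrite /node_value /=.
- by rewrite nth_literal_values // /short_terms /= !andbT expn_gt0.
- have [_ [h1 h2]] := arg j (mem_head _ _).
  by split; apply: short_terms_leq (leq_pred _) _.
- have -> : (2 < size s) = false by case: s arg => //= j s /(_ j (mem_head _ _))[].
  by apply: both => [|j /arg[]//]; rewrite -Dg.
- have -> : (2 < size s) = false by case: s arg => //= j s /(_ j (mem_head _ _))[].
  by apply: both => [|j /arg[]//]; rewrite -Dg.
Qed.

Lemma size_pred_lt : (size C).-1 < size C.
Proof. by case/andP: wfC => h _; rewrite prednK. Qed.

Lemma formula_correct d a : depth C <= d -> weft C <= 2 ->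
  satisfies a C = has (all (has (eval_term d a))) (formula d P).
Proof.
rewrite /depth /weft /satisfies !fold_circuitE -/D -/W => hD hW.
pose V := nth false (node_values (gate_value a) C).
pose v0 := level true (literal_values (size P)) P d.+1.
pose v1 := level false v0 P d.+1.
have h0 i : i < size C -> D i < d.+1 -> weft_below 1 i ->
    eval_inner (eval_term d a) false (nth ([::], [::]) v0 i).1 = V i /\
    eval_inner (eval_term d a) false (nth ([::], [::]) v0 i).2 = ~~ V i.
  move=> iC Di Wi.
  (* An OR of ANDs of literals is now read as one inner list of terms, and the length test in
     [eval_term] succeeds on these terms. *)
  have short v : short_terms (D i) v ->
      eval_inner (eval_term d a) false v = eval_outer (eval_literal a) true v.
    move=> /allP sv; apply: eq_in_has => t /sv st; rewrite /eval_term.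
    by rewrite (leq_trans st) // leq_pexp2l.
  have [s1 s2] := level_short_terms iC Di Wi.
  rewrite !short //; apply: (@level_correct _ _ true _ 0 a d.+1) => // j jC _ /=.
  case ej: (nth GInput C j) => // _; rewrite nth_literal_values //=.
  have -> : nth false (node_values (gate_value a) C) j = a j.
    by rewrite nth_gate_values // ej.
  by rewrite /eval_literal /= !andbT; case: (a j).
have h1 i : i < size C -> D i < d.+1 -> weft_below 2 i ->
    eval_inner (has (eval_term d a)) true (nth ([::], [::]) v1 i).1 = V i /\
    eval_inner (has (eval_term d a)) true (nth ([::], [::]) v1 i).2 = ~~ V i.
  by move=> iC Di Wi; apply: (@level_correct _ (eval_term d a) false v0 1 a d.+1).
have [] := @level_correct _ (has (eval_term d a)) true v1 2 a d.+1 h1 d.+1 (size C).-1.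
- by [].
- exact: size_pred_lt.
- by rewrite ltnS.
- exact: hW.
move=> e _; rewrite /formula -/v0 -/v1; move: e; rewrite /eval_outer size_map => ->.
by [].
Qed.

Lemma depth_table_correct d i : i < size C -> nth false (depth_table d P) i = (D i <= d).
Proof.
have szL k : size (depth_table k P) = size C by case: k => [|k]; rewrite !size_map.
move=> iC; elim: d i iC => [|d IH] i iC.
  rewrite (nth_map (0, [::])) ?size_map // nth_gate_code /D nth_depths //.
  by case: (nth GInput C i).
rewrite /depth_table iterS -/(depth_table d P) (nth_map (0, [::])) ?size_map //.
rewrite nth_gate_code [D i]nth_depths //.
have -> : all (nth false (depth_table d P)) (gate_code (nth GInput C i)).2 =
    all (fun j => D j <= d) (gate_args (nth GInput C i)).
  by apply: eq_in_all => j /(circuit_wf_arg wfC iC) ji; apply/IH/(ltn_trans ji).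
by case: (nth GInput C i) => [|j|s|s] //=; rewrite ltnS bigmax_leq_all.
Qed.

Lemma weft_table_correct l r i : i < size C -> D i < r ->
  nth false (weft_table l P r) i = if l is l'.+1 then W i <= l' else false.
Proof.
elim: l i => [|l IH] i iC Di; first by rewrite nth_nil.
rewrite /weft_table iterS -/(weft_table l P r) /weft_step.
suff h r' : r' <= r -> D i < r' ->
    nth false (weft_step (weft_table l P r) P r') i = (W i <= l) by apply: (h r).
elim: r' i iC {Di} => // r' IHr i iC r'r Di.
rewrite /weft_step iterS -/(weft_step _ P r') (nth_map (0, [::])) ?size_map //.
rewrite nth_gate_code [W i]nth_wefts //= -/W.
have arg j : j \in gate_args (nth GInput C i) -> j < size C /\ D j < r'.
  by case/(depth_arg iC) => jC Dj; split=> //; apply: leq_trans Dj _.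
rewrite /is_large; case: ltnP => sz; last first.
  rewrite add0n bigmax_leq_all; apply: eq_in_all => j /arg[jC Dj].
  by apply: IHr => //; apply: ltnW.
rewrite add1n (eq_in_all (a2 := fun j => if l is l'.+1 then W j <= l' else false)).
  case: l {IH IHr} => [|l]; last by rewrite ltnS bigmax_leq_all.
  by case: (gate_args _) sz.
by move=> j /arg[jC Dj]; apply: IH => //; apply: leq_trans Dj (ltnW r'r).
Qed.
End NormalForm.

(** * From formulas to hitting sets *)

Section Tuples.
Variable T : eqType.
Implicit Types (s t : seq T).

Definition tuples q s : seq (seq T) :=
  iter q (fun L => [seq x :: t | x <- s, t <- L]) [:: [::]].

Lemma mem_tuples q s t : (t \in tuples q s) = (size t == q) && all (fun x => x \in s) t.
Proof.
elim: q t => [|q IH] t; first by case: t.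
case: t => [|x t] /=; first by apply/negP => /allpairsP[[y u] []].
rewrite eqSS andbCA -IH; apply/allpairsP/andP => [[[y u] /= [ys uL [-> ->]]] //|[xs tL]].
by exists (x, t).
Qed.

Lemma tuples_uniq q s : uniq s -> uniq (tuples q s).
Proof.
move=> us; elim: q => //= q IH; apply: allpairs_uniq => // -[x t] [y u] _ _ /=.
by case=> -> ->.
Qed.
End Tuples.

(* A vertex of the hitting set instance is a value for a group.  The group
   [::] guesses the disjunct of the formula.  The group [J], a list of [q] slots
   between 0 and [k], guesses for each slot [j] in [J] the [j]-th and the
   [j + 1]-st true input, where the inputs are numbered from 1 and where 0 and
   [n.+1] serve as sentinels; so a negative literal says that its input lies
   strictly between the two. *)
Definition label : Type := (seq nat * seq (nat * nat))%type.

(** Only what can be checked within one slot. That the second component is again a true input comes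
    from its link to the next slot, or from the sentinel for [j = k]. *)
Definition slot_ok (P : seq (nat * seq nat)) k (j : nat) (ab : nat * nat) : bool :=
  [&& ab.1 < ab.2,
      if j == 0 then ab.1 == 0 else (0 < ab.1) && ((nth (0, [::]) P ab.1.-1).1 == 0)
    & (j == k) ==> (ab.2 == (size P).+1)].

Definition slot_pairs n : seq (nat * nat) :=
  [seq (a, b) | a <- iota 0 n.+2, b <- iota 0 n.+2].

Definition group_list k q : seq (seq nat) := [::] :: tuples q (iota 0 k.+1).

Definition label_list (P : seq (nat * seq nat)) k q m : seq label :=
  [seq ([::], [:: (c, 0)]) | c <- iota 0 m] ++
  [seq l <- [seq (J, w) | J <- tuples q (iota 0 k.+1), w <- tuples q (slot_pairs (size P))]
     | all (fun r => slot_ok P k (nth 0 l.1 r) (nth (0, 0) l.2 r)) (iota 0 q)].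

(** Guessed inputs are numbered from 1, hence [l.2.+1]. A negative literal on a position outside the
    circuit holds outright, no input there being true. *)
Definition holds n (l : literal) (ab : nat * nat) : bool :=
  if l.1 then ab.1 == l.2.+1
  else (n <= l.2) || (ab.1 <= l.2) && (l.2.+1 < ab.2).

Definition certifies n q (w : seq (nat * nat)) (t : seq literal) : bool :=
  (size t <= q) &&
  all (fun r => holds n (nth (true, 0) t r) (nth (0, 0) w r)) (iota 0 (size t)).

Definition group_test (J : seq nat) (l : label) : bool := l.1 == J.

(** The edge form of an implication: if group [J] guesses [d] for its slot [r], so does the
    reference group of that slot. The premise is negated by listing the other guesses of [J]. The
    next two tests follow the same pattern. *)
Definition slot_test q (c : seq nat * (nat * (nat * nat))) (l : label) : bool :=
  (l.1 == c.1) && (nth (0, 0) l.2 c.2.1 != c.2.2)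
  || (l.1 == nseq q (nth 0 c.1 c.2.1)) && (nth (0, 0) l.2 0 == c.2.2).

Definition link_test q (c : nat * nat) (l : label) : bool :=
  (l.1 == nseq q c.1) && ((nth (0, 0) l.2 0).2 != c.2)
  || (l.1 == nseq q c.1.+1) && ((nth (0, 0) l.2 0).1 == c.2).

Definition clause_test n q (c : nat * seq (seq literal)) (l : label) : bool :=
  (l.1 == [::]) && (l.2 != [:: (c.1, 0)])
  || (l.1 != [::]) && has (certifies n q l.2) c.2.

Definition slot_tests n k q : seq (seq nat * (nat * (nat * nat))) :=
  [seq (J, rd) | J <- tuples q (iota 0 k.+1),
                 rd <- [seq (r, d) | r <- iota 0 q, d <- slot_pairs n]].

Definition link_tests n k : seq (nat * nat) :=
  [seq (j, a) | j <- iota 0 k, a <- iota 0 n.+2].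

Definition clause_tests (fm : seq (seq (seq (seq literal)))) :
    seq (nat * seq (seq literal)) :=
  flatten [seq [seq (c, cl) | cl <- nth [::] fm c] | c <- iota 0 (size fm)].

Definition all_tests n k q fm : seq (pred label) :=
  [seq group_test J | J <- group_list k q] ++
  [seq slot_test q c | c <- slot_tests n k q] ++
  [seq link_test q c | c <- link_tests n k] ++
  [seq clause_test n q c | c <- clause_tests fm].

Lemma mem_slot_pairs n ab : (ab \in slot_pairs n) = (ab.1 < n.+2) && (ab.2 < n.+2).
Proof.
case: ab => a b; apply/allpairsP/andP => [[[c e] [h1 h2 [-> ->]]]|[h1 h2]].
  by move: h1 h2; rewrite !mem_iota.
by exists (a, b); rewrite !mem_iota.
Qed.

Lemma uniq_fst_inj (A B : eqType) (s : seq (A * B)) x y :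
  uniq (map fst s) -> x \in s -> y \in s -> x.1 = y.1 -> x = y.
Proof.
elim: s => //= z s IH /andP[zs us]; rewrite !inE.
move=> /predU1P[->|xs] /predU1P[->|ys] // e.
- by rewrite e map_f in zs.
- by rewrite -e map_f in zs.
- exact: IH.
Qed.

Section HittingSets.
Variables (P : seq (nat * seq nat)) (k d : nat) (fm : seq (seq (seq (seq literal)))).
Let n := size P.
Let q := 2 ^ d.
Let input i := (nth (0, [::]) P i).1 == 0.
Let tests := all_tests n k q fm.
Let labels := label_list P k q (size fm).

Let q_gt0 : 0 < q. Proof. by rewrite expn_gt0. Qed.

Lemma group_list_uniq : uniq (group_list k q).
Proof.
by rewrite /group_list cons_uniq tuples_uniq ?iota_uniq // andbT mem_tuples eq_sym gtn_eqF.
Qed.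

Lemma base_group j : j <= k -> nseq q j \in tuples q (iota 0 k.+1).
Proof.
by move=> jk; rewrite mem_tuples size_nseq eqxx; apply/allP => i /nseqP[-> _]; rewrite mem_iota.
Qed.

Section Soundness.
Variable s : seq label.
Hypotheses (s_labels : {subset s <= labels}) (s_size : size s <= size (group_list k q)).
Hypothesis s_hits : all (fun t => has t s) tests.

Let hit_groups : all (fun J => has (group_test J) s) (group_list k q).
Proof. by move: s_hits; rewrite /tests !all_cat !all_map => /and4P[]. Qed.

Let hit_slots : all (fun c => has (slot_test q c) s) (slot_tests n k q).
Proof. by move: s_hits; rewrite /tests !all_cat !all_map => /and4P[]. Qed.

Let hit_links : all (fun c => has (link_test q c) s) (link_tests n k).
Proof. by move: s_hits; rewrite /tests !all_cat !all_map => /and4P[]. Qed.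

Let hit_clauses : all (fun c => has (clause_test n q c) s) (clause_tests fm).
Proof. by move: s_hits; rewrite /tests !all_cat !all_map => /and4P[]. Qed.

(** Pigeonhole: every group is hit and [s] has no more elements than there are groups. *)
Let s_inj l l' : l \in s -> l' \in s -> l.1 = l'.1 -> l = l'.
Proof.
apply: uniq_fst_inj; apply: leq_size_uniq group_list_uniq _ _.
  move=> J /(allP hit_groups)/hasP[x xs /eqP<-]; exact: map_f.
by rewrite size_map.
Qed.

Let chosen J : J \in group_list k q -> exists w, (J, w) \in s.
Proof. by move=> /(allP hit_groups)/hasP[[J' w] ws /eqP /= <-]; exists w. Qed.

Let legal J w : J != [::] -> (J, w) \in s ->
  [/\ J \in tuples q (iota 0 k.+1), w \in tuples q (slot_pairs n)
    & forall r, r < q -> slot_ok P k (nth 0 J r) (nth (0, 0) w r)].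
Proof.
move=> J0 /s_labels; rewrite mem_cat => /orP[/mapP[c _ [eJ]]|]; first by rewrite eJ in J0.
rewrite mem_filter => /andP[/allP ok /allpairsP[[J' w'] [hJ hw [eJ ew]]]].
by rewrite eJ ew in ok *; split=> // r rq; apply: ok; rewrite mem_iota.
Qed.

(** The guess of the reference group of slot [j]; the default does not occur for [j <= k]. *)
Let pair_of j : nat * nat :=
  if [seq l <- s | l.1 == nseq q j] is l :: _ then nth (0, 0) l.2 0 else (0, 0).

Let base_nz (j : nat) : nseq q j != [::]. Proof. by case: q q_gt0. Qed.

Let pair_ofE j w : (nseq q j, w) \in s -> nth (0, 0) w 0 = pair_of j.
Proof.
move=> ws; rewrite /pair_of; case e: filter => [|l t].
  have : (nseq q j, w) \in [seq l <- s | l.1 == nseq q j] by rewrite mem_filter eqxx.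
  by rewrite e.
have : l \in [seq l <- s | l.1 == nseq q j] by rewrite e mem_head.
by rewrite mem_filter => /andP[/eqP l1 ls]; rewrite (s_inj ls ws).
Qed.

Let pair_ok j : j <= k -> slot_ok P k j (pair_of j) /\ (pair_of j).2 < n.+2.
Proof.
move=> jk; have [|w ws] := @chosen (nseq q j); first by rewrite inE base_group ?orbT.
have [_ hw ok] := legal (base_nz j) ws; rewrite -(pair_ofE ws); split.
  by have := ok 0 q_gt0; rewrite nth_nseq q_gt0.
move: hw; rewrite mem_tuples => /andP[/eqP sw /allP/(_ (nth (0, 0) w 0))].
by rewrite mem_nth ?sw // => /(_ isT); rewrite mem_slot_pairs => /andP[].
Qed.

Let slot_pair J w r : J != [::] -> (J, w) \in s -> r < q ->
  nth (0, 0) w r = pair_of (nth 0 J r).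
Proof.
move=> J0 ws rq; have [hJ hw _] := legal J0 ws.
have : (J, (r, nth (0, 0) w r)) \in slot_tests n k q.
  apply/allpairsP; exists (J, (r, nth (0, 0) w r)); split=> //.
  apply/allpairsP; exists (r, nth (0, 0) w r); split; rewrite ?mem_iota //=.
  by move: hw; rewrite mem_tuples => /andP[/eqP sw /allP]; apply; rewrite mem_nth ?sw.
move=> /(allP hit_slots)/hasP[[J' w'] ws' /orP[]/andP[/eqP /= e]].
  by rewrite e in ws'; have [->] := s_inj ws ws' erefl; rewrite eqxx.
by move=> /eqP <-; apply: pair_ofE; rewrite -e.
Qed.

Let pair_link j : j < k -> (pair_of j.+1).1 = (pair_of j).2.
Proof.
move=> jk; have [_ lt] := pair_ok (ltnW jk).
have : (j, (pair_of j).2) \in link_tests n k.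
  by apply/allpairsP; exists (j, (pair_of j).2); rewrite !mem_iota.
move=> /(allP hit_links)/hasP[[J w] ws /orP[]/andP[/eqP /= e]]; rewrite e in ws.
  by rewrite (pair_ofE ws) eqxx.
by rewrite (pair_ofE ws) => /eqP.
Qed.

Let pair_lt i j : i < j -> j <= k -> (pair_of i).2 <= (pair_of j).1.
Proof.
elim: j => // j IH; rewrite ltnS leq_eqVlt => /predU1P[<-|ij] jk.
  by rewrite pair_link.
apply: leq_trans (IH ij (ltnW jk)) _; rewrite pair_link //.
by have [/and3P[/ltnW]] := pair_ok (ltnW jk).
Qed.

Let slots_lt j : j <= k -> (pair_of j).1 < (pair_of j).2.
Proof. by case/pair_ok => /and3P[]. Qed.

Let pair_le_n j : j <= k -> (pair_of j).1 <= n.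
Proof. by move=> jk; have [_] := pair_ok jk; have := slots_lt jk; lia. Qed.

Let pair0 : (pair_of 0).1 = 0.
Proof. by have [/and3P[_ /eqP]] := pair_ok (leq0n k). Qed.

Let asg i : bool := has (fun j => (pair_of j).1 == i.+1) (iota 1 k).

(** The linked pairs form a strictly increasing chain, so slots 1 to [k] name [k] different
    inputs. *)
Let asg_count : count (fun i => input i && asg i) (iota 0 n) = k.
Proof.
pose xs := [seq (pair_of j).1.-1 | j <- iota 1 k].
have pos j : j \in iota 1 k ->
    [/\ 0 < (pair_of j).1, input (pair_of j).1.-1, 0 < j & j <= k].
  rewrite mem_iota add1n ltnS => /andP[j0 jk].
  have [/and3P[_ + _] _] := pair_ok jk; rewrite gtn_eqF // => /andP[].
  by [].
have uxs : uniq xs.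
  rewrite map_inj_in_uniq ?iota_uniq // => i j /pos[i1 _ i0 ik] /pos[j1 _ j0 jk] e.
  have {}e : (pair_of i).1 = (pair_of j).1 by lia.
  case: (ltngtP i j) => // ij.
    by have := pair_lt ij jk; have := slots_lt ik; lia.
  by have := pair_lt ij ik; have := slots_lt jk; lia.
rewrite -size_filter -[RHS](size_iota 1) -[RHS](size_map (fun j => (pair_of j).1.-1)) -/xs.
apply/perm_size/uniq_perm; [exact: filter_uniq (iota_uniq _ _)|by []|].
move=> i; rewrite mem_filter mem_iota add0n /=; apply/idP/mapP.
  case/andP=> /andP[_ /hasP[j hj /eqP e]] _; exists j => //.
  by rewrite e.
case=> j hj ->; have [j1 ij j0 jk] := pos j hj; rewrite ij /=.
apply/andP; split; last by have := pair_le_n jk; lia.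
by apply/hasP; exists j; rewrite ?prednK.
Qed.

(** For a negative literal: the chain is increasing, so no slot names an input strictly between two
    consecutive ones. *)
Let holds_sound l j : j <= k -> holds n l (pair_of j) -> eval_literal asg l.
Proof.
case: l => -[] i jk; rewrite /holds /eval_literal /=.
  move=> /eqP e; apply/eqP/esym/hasP; exists j; rewrite ?e // mem_iota add1n ltnS jk andbT.
  by rewrite lt0n; apply/eqP => j0; rewrite j0 pair0 in e.
move=> h; apply/eqP/esym/negbTE/hasPn => j'; rewrite mem_iota add1n ltnS => /andP[_ jk'].
apply/eqP => e; case/orP: h => [ni|/andP[h1 h2]]; first by have := pair_le_n jk'; lia.
case: (ltngtP j j') => [jj|jj|jj].
- by have := pair_lt jj jk'; lia.
- by have := pair_lt jj jk; have := slots_lt jk'; lia.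
- by rewrite jj in h1; lia.
Qed.

Lemma hitting_set_sound : exists a,
  has (all (has (eval_term d a))) fm /\ count (fun i => input i && a i) (iota 0 n) = k.
Proof.
exists asg; split=> //; have [|w ws] := @chosen [::]; first exact: mem_head.
have [c hc ew] : exists2 c, c < size fm & w = [:: (c, 0)].
  have := s_labels ws; rewrite mem_cat mem_filter => /orP[/mapP[c + [->]]|/andP[_]].
    by rewrite mem_iota => hc; exists c.
  by case/allpairsP => -[J w'] /= [+ _ [eJ _]]; rewrite -eJ mem_tuples eq_sym (gtn_eqF q_gt0).
apply/hasP; exists (nth [::] fm c); first exact: mem_nth.
apply/allP => cl clc.
have : (c, cl) \in clause_tests fm.
  by apply/flatten_mapP; exists c; rewrite ?mem_iota //; apply: map_f.
move=> /(allP hit_clauses)/hasP[[J w'] ws' /orP[]/andP[/= J0]].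
  by move/eqP: J0 ws' => -> ws'; have [<-] := s_inj ws ws' erefl; rewrite ew eqxx.
case/hasP => t tcl /andP[st /allP h]; apply/hasP; exists t => //.
apply/andP; split=> //; apply/(all_nthP (true, 0)) => r rt.
have rq : r < q by apply: leq_trans st.
have [hJ _ _] := legal J0 ws'.
have := h r; rewrite mem_iota (slot_pair J0 ws' rq) => /(_ rt); apply: holds_sound.
move: hJ; rewrite mem_tuples => /andP[/eqP sJ /allP/(_ (nth 0 J r))].
by rewrite mem_nth ?sJ // => /(_ isT); rewrite mem_iota.
Qed.
End Soundness.

Section Completeness.
Variable a : nat -> bool.
Hypothesis a_input : forall i, a i -> (i < n) && input i.
Hypothesis a_weight : count (fun i => input i && a i) (iota 0 n) = k.
Hypothesis a_formula : has (all (has (eval_term d a))) fm.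

Let xs := [seq i <- iota 0 n | a i].
Let ends := rcons [seq i.+1 | i <- xs] n.+1.
Let y j := (nth 0 (0 :: ends) j, nth 0 ends j).

Let size_xs : size xs = k.
Proof.
rewrite -a_weight size_filter; apply: eq_count => i; case ai: (a i); last by rewrite andbF.
by have /andP[_ ->] := a_input ai.
Qed.

Let size_ends : size ends = k.+1.
Proof. by rewrite size_rcons size_map size_xs. Qed.

Let xs_mem i : (i \in xs) = a i.
Proof.
rewrite mem_filter mem_iota add0n; case ai: (a i) => //.
by have /andP[->] := a_input ai.
Qed.

Let path_ends : path ltn 0 ends.
Proof.
have sx : sorted ltn xs by apply: sorted_filter (iota_ltn_sorted _ _); apply: ltn_trans.
rewrite /ends rcons_path; apply/andP; split.
  rewrite path_min_sorted ?all_map; last by apply/allP.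
  by rewrite sorted_map.
case: xs xs_mem => //= x t h; rewrite last_map ltnS.
have : last x t \in x :: t by apply: mem_last.
by rewrite h => /a_input/andP[].
Qed.

Let y_lt j : j <= k -> (y j).1 < (y j).2.
Proof. by move=> jk; apply: (pathP 0 path_ends); rewrite size_ends. Qed.

Let ends_nth j : j < k -> nth 0 ends j = (nth 0 xs j).+1.
Proof.
by move=> jk; rewrite nth_rcons size_map size_xs jk (nth_map 0) ?size_xs.
Qed.

Let ends_last : nth 0 ends k = n.+1.
Proof. by rewrite nth_rcons size_map size_xs ltnn eqxx. Qed.

Let ends_le j : j <= k -> nth 0 ends j <= n.+1.
Proof.
rewrite leq_eqVlt => /predU1P[->|jk]; first by rewrite ends_last.
have : nth 0 xs j \in xs by rewrite mem_nth ?size_xs.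
by rewrite ends_nth // xs_mem ltnS => /a_input/andP[/ltnW].
Qed.

Let y_pairs j : j <= k -> y j \in slot_pairs n.
Proof.
move=> jk; have lt := y_lt jk; have le := ends_le jk; rewrite mem_slot_pairs.
by apply/andP; split; [apply: leq_trans lt _; apply: leqW|].
Qed.

Let y_ok j : j <= k -> slot_ok P k j (y j).
Proof.
move=> jk; apply/and3P; split; first exact: y_lt.
  case: j jk => //= j jk; rewrite ends_nth //=.
  have : nth 0 xs j \in xs by rewrite mem_nth ?size_xs.
  by rewrite xs_mem => /a_input/andP[].
by apply/implyP => /eqP ->; rewrite /= ends_last.
Qed.

Let slot_exists l : eval_literal a l -> exists2 j, j <= k & holds n l (y j).
Proof.
case: l => -[] i; rewrite /eval_literal /holds /= => /eqP/esym.
  rewrite -xs_mem => ix; exists (index i xs).+1; first by rewrite -size_xs index_mem.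
  by rewrite /= ends_nth ?nth_index // -size_xs index_mem.
(* The slot that ends at the first true input after [i]; if there is none, [find] returns [k], whose
   pair ends at the sentinel [n.+1]. *)
move=> ai; pose j := find (fun x => i < x) xs.
have jk : j <= k by rewrite -size_xs find_size.
have ne x : x \in xs -> x != i by apply: contraTneq => ->; rewrite xs_mem ai.
exists j => //; case: (leqP n i) => //= ni; apply/andP; split.
  case e: j jk => [|j'] //= jk; rewrite ends_nth // ltn_neqAle ne ?mem_nth ?size_xs //=.
  by rewrite leqNgt; apply/negbT/before_find; rewrite -/j e.
move: jk; rewrite leq_eqVlt => /predU1P[->|jk]; first by rewrite ends_last ltnS.
by rewrite ends_nth // ltnS; apply: (nth_find 0 (a := fun x => i < x)); rewrite has_find size_xs.
Qed.

Lemma hitting_set_complete : exists s : seq label,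
  [/\ {subset s <= labels}, size s = size (group_list k q) & all (fun t => has t s) tests].
Proof.
have [c cfm ok] : exists2 c, c < size fm & all (has (eval_term d a)) (nth [::] fm c).
  exists (find (all (has (eval_term d a))) fm); first by rewrite -has_find.
  exact: nth_find.
pose s := ([::], [:: (c, 0)]) :: [seq (J, map y J) | J <- tuples q (iota 0 k.+1)].
have slots J : J \in tuples q (iota 0 k.+1) -> size J = q /\ forall j, j \in J -> j <= k.
  rewrite mem_tuples => /andP[/eqP sJ /allP h]; split=> // j /h.
  by rewrite mem_iota.
have in_s J : J \in tuples q (iota 0 k.+1) -> (J, map y J) \in s.
  by move=> hJ; rewrite inE; apply/orP; right; apply: map_f.
have base j : j <= k -> (nseq q j, nseq q (y j)) \in s.
  by move=> jk; rewrite -map_nseq; apply/in_s/base_group.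
have hit (t : pred label) l : l \in s -> t l -> has t s.
  by move=> ls tl; apply/hasP; exists l.
exists s; split; last 1 first.
- rewrite /tests /all_tests !all_cat !all_map; apply/and4P; split; apply/allP.
  + move=> J; rewrite inE => /orP[/eqP->|hJ]; first exact: (hit (group_test [::]) _ (mem_head _ _)).
    exact: (hit (group_test J) _ (in_s J hJ) (eqxx J)).
  + move=> _ /allpairsP[[J rd] [hJ /allpairsP[[r e] [hr _ erd]] ->]].
    rewrite /= in hJ erd; rewrite {rd}erd [(J, _).1]/= [(J, _).2]/=.
    have [sJ Jk] := slots J hJ; move: hr; rewrite mem_iota => /= rq.
    have [eq_e|ne_e] := eqVneq (nth (0, 0) (map y J) r) e; last first.
      apply: (hit (slot_test q (J, (r, e))) _ (in_s J hJ)).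
      by rewrite /slot_test /= eqxx ne_e.
    have Jr : nth 0 J r <= k by rewrite Jk // mem_nth ?sJ.
    apply: (hit (slot_test q (J, (r, e))) _ (base _ Jr)).
    apply/orP; right; rewrite eqxx nth_nseq q_gt0 -eq_e (nth_map 0) ?sJ //.
    exact: eqxx.
  + move=> _ /allpairsP[[j b] [hj _ ->]]; move: hj; rewrite mem_iota => /= jk.
    have [eb|nb] := eqVneq (y j).2 b; last first.
      apply: (hit (link_test q (j, b)) _ (base _ (ltnW jk))).
      by apply/orP; left; rewrite eqxx nth_nseq q_gt0 nb.
    apply: (hit (link_test q (j, b)) _ (base _ jk)).
    by apply/orP; right; rewrite eqxx nth_nseq q_gt0 -eb eqxx.
  + move=> _ /flatten_mapP[c' _ /mapP[cl hcl ->]].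
    have [ec|nc] := eqVneq c c'; last first.
      apply: (hit (clause_test n q (c', cl)) _ (mem_head _ _)).
      by rewrite /clause_test /= eqseq_cons xpair_eqE (negbTE nc).
    move: hcl; rewrite -ec => /(allP ok)/hasP[t tcl /andP[st /allP ht]].
    pose slot l := find (fun j => holds n l (y j)) (iota 0 k.+1).
    have slotP l : l \in t -> slot l <= k /\ holds n l (y (slot l)).
      move=> /ht/slot_exists[j jk hj].
      have hs : has (fun j => holds n l (y j)) (iota 0 k.+1).
        by apply/hasP; exists j; rewrite ?mem_iota.
      have lt : slot l < k.+1 by rewrite -[X in _ < X](size_iota 0) -has_find.
      by split=> //; have := nth_find 0 hs; rewrite nth_iota.
    (* One certifying slot for each literal, padded with slot 0 up to the fixed length [q] of a
       group. *)
    pose J := map slot t ++ nseq (q - size t) 0.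
    have sJ : size J = q by rewrite size_cat size_map size_nseq subnKC.
    have hJ : J \in tuples q (iota 0 k.+1).
      rewrite mem_tuples sJ eqxx; apply/allP => j; rewrite mem_cat mem_iota ltnS.
      by case/orP => [/mapP[l /slotP[h _] ->]|/nseqP[->]].
    apply: (hit (clause_test n q (c, cl)) _ (in_s J hJ)).
    have J0 : J != [::] by rewrite -size_eq0 sJ -lt0n.
    rewrite /clause_test /= J0 (negbTE J0) /=; apply/hasP; exists t => //.
    apply/andP; split=> //; apply/allP => r; rewrite mem_iota => /= rt.
    rewrite (nth_map 0) ?sJ ?(leq_trans rt) // nth_cat size_map rt (nth_map (true, 0)) //.
    by have [_] := slotP _ (mem_nth (true, 0) rt).
- move=> l; rewrite inE => /predU1P[->|/mapP[J hJ ->]].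
    by rewrite mem_cat; apply/orP; left; apply: map_f; rewrite mem_iota.
  have [sJ Jk] := slots J hJ; rewrite mem_cat mem_filter; apply/orP; right.
  apply/andP; split.
    apply/allP => r; rewrite mem_iota => /= rq.
    by rewrite (nth_map 0) ?sJ //; apply/y_ok/Jk; rewrite mem_nth ?sJ.
  apply/allpairsP; exists (J, map y J); split=> //; rewrite mem_tuples size_map sJ eqxx.
  by rewrite all_map; apply/allP => j /Jk /y_pairs.
- by rewrite /= size_map.
Qed.
End Completeness.
End HittingSets.

(** * From hitting sets to the game *)

Section HittingGame.
Variables (X : finType) (F : {set {set X}}).
Implicit Types (S M T : {set X}).

(** If Maker always passes, Breaker's at most [k] further vertices must complete a transversal. *)
Lemma breaker_value_hits k S M : breaker_value F k S M ->
  exists T, [/\ S \subset T, #|T| <= #|S| + k & hits F T].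
Proof.
elim: k S => [|k IH] S /=; first by exists S; rewrite addn0 leqnn.
case/orP => [/andP[/IH[T [sT cT hT]] _]|/existsP[v /andP[_ /andP[/IH[T [sT cT hT]] _]]]].
  by exists T; split; rewrite ?addnS 1?ltnW.
exists T; split=> //; first exact: subset_trans (subsetUr _ _) sT.
by apply: leq_trans cT _; rewrite cardsU1 addnS -addSn leq_add2r; case: (v \notin S).
Qed.

(* With [K] copies of every vertex of a transversal, Maker has no time to claim
   them all. *)
Lemma copies_breaker_value (L : eqType) (lab : X -> L) K (s : seq L) S M :
  {in s, forall l, K <= #|[set v | lab v == l]|} -> #|M| + size s <= K ->
  (forall T, S \subset T -> {in s, forall l, exists2 v, v \in T & lab v = l} -> hits F T) ->
  breaker_value F (size s) S M.
Proof.
elim: s S M => [|l s IH] S M hK hM hS; first exact: hS.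
(* Maker owns fewer than [K] vertices as long as some label is still to be claimed, so a copy of it
   is free. *)
have [v hv vM] : exists2 v, lab v = l & v \notin M.
  have /subsetPn[v] : ~~ ([set v | lab v == l] \subset M).
    apply/negP => /subset_leq_card; have := hK l (mem_head _ _); move: hM => /=; lia.
  by rewrite inE => /eqP hv vM; exists v.
have hK' : {in s, forall l, K <= #|[set v | lab v == l]|}.
  by move=> l' ls; apply: hK; rewrite inE ls orbT.
have hS' T : v |: S \subset T ->
    {in s, forall l, exists2 v, v \in T & lab v = l} -> hits F T.
  rewrite subUset sub1set => /andP[vT sT] hT; apply: hS => // l'.
  by rewrite inE => /predU1P[->|/hT //]; exists v.
apply/orP; right; apply/existsP; exists v; rewrite vM /=; apply/andP; split.
  by apply: IH => //; move: hM => /=; lia.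
apply/forall_inP => u _; apply: IH => //; move: hM; rewrite cardsU1 /=.
by case: (u \notin M) => /=; lia.
Qed.
End HittingGame.

Lemma hits_hyperedge_set n (es : seq (seq 'I_n)) T :
  hits (hyperedge_set es) T = all (has (fun v => v \in T)) es.
Proof.
apply/forall_inP/allP => [h e ee|h E].
  have /exists_inP[v] := h [set v in e] (ltac:(by rewrite inE map_f)).
  by rewrite inE => ve vT; apply/hasP; exists v.
rewrite inE => /mapP[e /h/hasP[v ve vT] ->]; apply/exists_inP; exists v => //.
by rewrite inE.
Qed.

Section LabelledGame.
Variables (L : eqType) (l0 : L) (V : seq L) (p : nat) (tests : seq (pred L)).
Let V' := flatten (nseq p V).
Let lab (v : 'I_(size V')) := nth l0 V' v.

Definition label_edges : seq (seq 'I_(size V')) :=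
  [seq [seq v <- enum 'I_(size V') | t (lab v)] | t <- tests].

Lemma hits_label_edges T :
  hits (hyperedge_set label_edges) T = all (fun t => has (fun v => t (lab v)) (enum T)) tests.
Proof.
rewrite hits_hyperedge_set all_map; apply: eq_all => t /=.
apply/hasP/hasP => [[v + vT]|[v + tv]].
  by rewrite mem_filter => /andP[tv _]; exists v; rewrite ?mem_enum.
by rewrite mem_enum => vT; exists v; rewrite // mem_filter tv mem_enum.
Qed.

Lemma lab_mem v : lab v \in V.
Proof.
have : lab v \in V' by apply: mem_nth.
by case/flattenP => W /nseqP[->].
Qed.

Lemma card_lab l : l \in V -> p <= #|[set v | lab v == l]|.
Proof.
move=> lV; rewrite cardsE -sum1_card -(big_mkord (fun i => nth l0 V' i == l) (fun=> 1)).
rewrite -(big_nth l0 (pred1 l) (fun=> 1)) sum1_count count_flatten map_nseq sumn_nseq.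
by rewrite leq_pmull // -has_count has_pred1.
Qed.

Lemma label_game_sound :
  game_value (hyperedge_set label_edges) Breaker p ->
  exists s : seq L, [/\ {subset s <= V}, size s <= p & all (fun t => has t s) tests].
Proof.
move=> /breaker_value_hits[T [_ cT hT]]; exists [seq lab v | v <- enum T]; split.
- by move=> _ /mapP[v _ ->]; apply: lab_mem.
- by move: cT; rewrite size_map -cardE cards0.
- by move: hT; rewrite hits_label_edges; apply: sub_all => t; rewrite has_map.
Qed.

Lemma label_game_complete (s : seq L) :
  {subset s <= V} -> size s = p -> all (fun t => has t s) tests ->
  game_value (hyperedge_set label_edges) Breaker p.
Proof.
move=> sV ss hs; rewrite /game_value /=.
suff : breaker_value (hyperedge_set label_edges) (size s) set0 set0 by rewrite ss.
apply: (@copies_breaker_value _ _ L lab p) => [l /sV/card_lab //||T _ hT].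
  by rewrite cards0 ss.
rewrite hits_label_edges; apply: sub_all hs => t /hasP[l /hT[v vT <-] tl].
by apply/hasP; exists v; rewrite ?mem_enum.
Qed.

Lemma label_edgesE :
  [seq [seq val v | v <- e] | e <- label_edges] =
  [seq [seq i <- iota 0 (size V') | t (nth l0 V' i)] | t <- tests].
Proof.
rewrite /label_edges -map_comp; apply: eq_map => t /=.
by rewrite -val_enum_ord filter_map.
Qed.
End LabelledGame.

(** * Hardness *)

Lemma satisfies_ext C a a' :
  (forall i, i < size C -> is_input (nth GInput C i) -> a i = a' i) ->
  satisfies a C = satisfies a' C.
Proof.
move=> h; rewrite /satisfies /fold_circuit -!/(node_values _ _); congr last.
elim/last_ind: C h => // C g IH h; rewrite !node_values_rcons.
have -> : node_values (gate_value a) C = node_values (gate_value a') C.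
  by apply: IH => i iC inp; apply: h; rewrite ?size_rcons ?nth_rcons ?iC // ltnW.
congr rcons; case: g h => //= h; rewrite size_node_values.
by apply: h; rewrite ?size_rcons // nth_rcons ltnn eqxx.
Qed.

Definition circuit_code : Type := seq (nat * seq nat).

Definition circuit_code_ok d (x : data) : bool :=
  let P := dec x : circuit_code in
  [&& enc P == x, all code_ok P, 0 < size P,
      all (fun i => all (fun j => j < i) (nth (0, [::]) P i).2) (iota 0 (size P)),
      nth false (depth_table d P) (size P).-1
    & nth false (weft_table 3 P d.+1) (size P).-1].

Lemma circuit_code_okP d x :
  reflect (exists C, [/\ x = encode_circuit C, circuit_wf C, weft C <= 2 & depth C <= d])
    (circuit_code_ok d x).
Proof.
rewrite /circuit_code_ok; apply: (iffP idP) => [|[C [-> wfC wC dC]]]; last first.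
  have lt := size_pred_lt wfC; case/andP: (wfC) => C0 argC.
  rewrite encode_circuitE encK eqxx size_map C0 depth_table_correct // -fold_circuitE.
  rewrite weft_table_correct -?fold_circuitE // dC wC /= andbT; apply/andP; split.
    by rewrite all_map (eq_all gate_code_ok) all_predT.
  by apply: sub_all argC => i; rewrite nth_gate_code.
case/and5P => /eqP ex okP sP wfP /andP[dP wP].
set P := (dec x : circuit_code) in ex okP sP wfP dP wP.
have eP : P = [seq gate_code g | g <- [seq code_gate q | q <- P]].
  rewrite -map_comp -[LHS]map_id; apply/eq_in_map => q /(allP okP) h.
  by rewrite /= code_gateK.
exists [seq code_gate q | q <- P]; set C := [seq code_gate q | q <- P] in eP *.
have szC : size C = size P by rewrite /C size_map.
have wfC : circuit_wf C.
  rewrite /circuit_wf szC sP; apply: sub_all wfP => i.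
  by rewrite eP nth_gate_code.
have lt := size_pred_lt wfC.
have dC : depth C <= d.
  by move: dP; rewrite -szC eP depth_table_correct // -fold_circuitE.
split=> //; first by rewrite encode_circuitE -eP ex.
by move: wP; rewrite -szC eP weft_table_correct // -fold_circuitE.
Qed.

Section PtimeHardness.
Variable X : encType.

Lemma ptime_tuples (A : encType) q (s : X -> seq A) :
  ptime s -> ptime (fun x => tuples q (s x)).
Proof.
move=> hs; rewrite /tuples.
by apply: (@ptime_iter _ _ q (fun x L => [seq y :: t | y <- s x, t <- L])); ptime;
  apply: ptime_comp hs _; ptime.
Qed.

Lemma ptime_level (A : encType) o r (low : X -> seq (seq A * seq A))
    (P : X -> seq (nat * seq nat)) :
  ptime low -> ptime P -> ptime (fun x => level o (low x) (P x) r).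
Proof.
move=> hl hP.
suff h : ptime (fun p : seq (seq A * seq A) * seq (nat * seq nat) => level o p.1 p.2 r).
  exact: ptime_comp h (ptime_pair hl hP).
rewrite /level; apply: ptime_iter; last by ptime.
by rewrite /node_value /large_gate /small_gate /distribute; ptime.
Qed.

Lemma ptime_literal_values (n : X -> nat) :
  ptime n -> ptime (fun x => literal_values (n x)).
Proof. by move=> hn; rewrite /literal_values; ptime. Qed.

Lemma ptime_depth_table d (P : X -> seq (nat * seq nat)) :
  ptime P -> ptime (fun x => depth_table d (P x)).
Proof.
move=> hP; suff h : ptime (fun P => depth_table d P) by exact: ptime_comp h hP.
by rewrite /depth_table; apply: ptime_iter; ptime.
Qed.

Lemma ptime_weft_table l r (P : X -> seq (nat * seq nat)) :
  ptime P -> ptime (fun x => weft_table l (P x) r).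
Proof.
move=> hP; suff h : ptime (fun P => weft_table l P r) by exact: ptime_comp h hP.
rewrite /weft_table; apply: ptime_iter; last by ptime.
by rewrite /weft_step; apply: ptime_iter; ptime.
Qed.

Lemma ptime_dec_circuit_code (a : X -> data) :
  ptime a -> ptime (fun x => dec (a x) : circuit_code).
Proof.
apply: ptime_dec_seq => Y b; apply: ptime_dec_pair; first exact: ptime_dec_nat.
by move=> Z c; apply: ptime_dec_seq => W e; apply: ptime_dec_nat.
Qed.
End PtimeHardness.

Ltac ptime_hook ::=
  lazymatch goal with
  | |- ptime (fun x => tuples ?q (@?s x)) => apply: ptime_tuples
  | |- ptime (fun x => level ?o (@?l x) (@?P x) ?r) => apply: ptime_level
  | |- ptime (fun x => literal_values (@?n x)) => apply: ptime_literal_values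
  | |- ptime (fun x => depth_table ?d (@?P x)) => apply: ptime_depth_table
  | |- ptime (fun x => weft_table ?l (@?P x) ?r) => apply: ptime_weft_table
  | |- ptime (fun x => dec (@?p x)) => apply: ptime_dec_circuit_code
  end.

Lemma ptime_formula (X : encType) d (P : X -> seq (nat * seq nat)) :
  ptime P -> ptime (fun x => formula d (P x)).
Proof. by move=> hP; rewrite /formula; ptime. Qed.

Lemma ptime_label_list (X : encType) q (P : X -> seq (nat * seq nat)) (k m : X -> nat) :
  ptime P -> ptime k -> ptime m -> ptime (fun x => label_list (P x) (k x) q (m x)).
Proof.
move=> hP hk hm.
suff h : ptime (fun p : seq (nat * seq nat) * (nat * nat) => label_list p.1 p.2.1 q p.2.2).
  exact: ptime_comp h (ptime_pair hP (ptime_pair hk hm)).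
by rewrite /label_list /slot_ok /slot_pairs; ptime.
Qed.

(** [all_tests] is a list of predicates, which are not data. Here every test is applied on the spot,
    so that the list of edges is visibly computable in polynomial time. *)
Definition test_edges (V : seq label) n k q fm : seq (seq nat) :=
  let v i := nth ([::], [::]) V i in
  [seq [seq i <- iota 0 (size V) | group_test J (v i)] | J <- group_list k q] ++
  [seq [seq i <- iota 0 (size V) | slot_test q c (v i)] | c <- slot_tests n k q] ++
  [seq [seq i <- iota 0 (size V) | link_test q c (v i)] | c <- link_tests n k] ++
  [seq [seq i <- iota 0 (size V) | clause_test n q c (v i)] | c <- clause_tests fm].

Lemma test_edgesE V n k q fm : test_edges V n k q fm =
  [seq [seq i <- iota 0 (size V) | t (nth ([::], [::]) V i)] | t <- all_tests n k q fm].
Proof. by rewrite /all_tests !map_cat -!map_comp. Qed.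

Lemma ptime_test_edges (X : encType) q (V : X -> seq label) (n k : X -> nat)
    (fm : X -> seq (seq (seq (seq literal)))) :
  ptime V -> ptime n -> ptime k -> ptime fm ->
  ptime (fun x => test_edges (V x) (n x) (k x) q (fm x)).
Proof.
move=> hV hn hk hf.
suff h : ptime (fun p : seq label * ((nat * nat) * seq (seq (seq (seq literal)))) =>
    test_edges p.1 p.2.1.1 p.2.1.2 q p.2.2).
  exact: ptime_comp h (ptime_pair hV (ptime_pair (ptime_pair hn hk) hf)).
rewrite /test_edges /group_test /slot_test /link_test /clause_test /certifies /holds.
by rewrite /group_list /slot_tests /link_tests /clause_tests /slot_pairs; ptime.
Qed.

(** Invalid inputs go to a game with one empty edge, which Breaker cannot hit. Otherwise the number
    [b] of groups is both the number of copies of each vertex and the budget. *)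
Definition game_reduction d (p : (data * nat) * nat) : data * nat :=
  let P := dec p.1.1 : circuit_code in
  let k := p.1.2 in
  let q := 2 ^ d in
  let fm := formula d P in
  let b := size (group_list k q) in
  let V := flatten (nseq b (label_list P k q (size fm))) in
  if circuit_code_ok d p.1.1 then
    (enc (size V, (test_edges V (size P) k q fm, true)), b)
  else (enc (0, ([:: [::] : seq nat], true)), 0).

Lemma ptime_circuit_code_ok (X : encType) d (a : X -> data) :
  ptime a -> ptime (fun x => circuit_code_ok d (a x)).
Proof.
move=> ha; apply: (ptime_comp (g := circuit_code_ok d)) => //.
by rewrite /circuit_code_ok /code_ok; ptime.
Qed.

Ltac ptime_hook ::=
  lazymatch goal with
  | |- ptime (fun x => tuples ?q (@?s x)) => apply: ptime_tuples
  | |- ptime (fun x => dec (@?p x)) => apply: ptime_dec_circuit_code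
  | |- ptime (fun x => formula ?d (@?P x)) => apply: ptime_formula
  | |- ptime (fun x => label_list (@?P x) (@?k x) ?q (@?m x)) => apply: ptime_label_list
  | |- ptime (fun x => circuit_code_ok ?d (@?a x)) => apply: ptime_circuit_code_ok
  | |- ptime (fun x => test_edges (@?V x) (@?n x) (@?k x) ?q (@?f x)) =>
      apply: ptime_test_edges
  end.

Lemma ptime_game_reduction d : ptime (game_reduction d).
Proof. by rewrite /game_reduction /group_list; ptime. Qed.

Theorem WCS2_reducible d : fpt_reducible (WCS 2 d) short_breaker_MB.
Proof.
(* With [2 ^ d] constant, the number of groups is polynomial in [k], so the iterated data are
   trivial. *)
apply: (@fpt_intro _ _ _ id 0 (game_reduction d) (fun k => size (group_list k (2 ^ d)))).
- exact: ptime_id.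
- exact: ptime_game_reduction.
- by apply: ptime_effective; rewrite /group_list; ptime.
- by move=> x k; rewrite /game_reduction; case: ifP.
move=> x k; set h := iter _ _ _; rewrite /game_reduction.
rewrite -[(x, k, h).1.1]/x -[(x, k, h).1.2]/k.
case: circuit_code_okP => [[C [hx wfC wC dC]]|bad]; last first.
  split=> [[C [hx wfC wC dC _]]|]; first by case: bad; exists C.
  have := short_breaker_encode_game [:: [::] : seq 'I_0] Breaker 0.
  rewrite [encode_game _ _]encode_gameE => -> /breaker_wins_withinP.
  by rewrite /game_value /= hits_hyperedge_set.
have eP : dec x = [seq gate_code g | g <- C] by rewrite hx encode_circuitE encK.
rewrite eP; set P := map _ C; set q := 2 ^ d; set fm := formula d P.
set b := size (group_list k q); set V := label_list P k q (size fm).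
rewrite -[(_, _).1]/(enc _) -[(_, _).2]/b test_edgesE.
rewrite -(label_edgesE ([::], [::]) V b) -[true]/(is_breaker Breaker).
rewrite -encode_gameE short_breaker_encode_game breaker_wins_withinP.
have input_code i : is_input (nth GInput C i) = ((nth (0, [::]) P i).1 == 0).
  by rewrite nth_gate_code; case: (nth GInput C i).
have szP : size P = size C by rewrite size_map.
have satE a : satisfies a C = has (all (has (eval_term d a))) fm.
  exact: formula_correct.
have wtE a : weight a C =
    count (fun i => ((nth (0, [::]) P i).1 == 0) && a i) (iota 0 (size P)).
  by rewrite szP; apply: eq_count => i; rewrite input_code.
split.
  case=> C' [hC' _ _ _ [a [sat wt]]].
  have eC : C' = C.
    apply: (can_inj (mapK gate_codeK)); apply: (@enc_inj (seq (nat * seq nat))).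
    by rewrite -!encode_circuitE -hC' hx.
  rewrite {C' hC'}eC in sat wt.
  (* [weight] and [satisfies] ignore [a] outside the input nodes; clearing it there gives an
     assignment whose true positions are exactly the counted ones. *)
  pose a' i := [&& i < size P, (nth (0, [::]) P i).1 == 0 & a i].
  have [||| s [sV ss hs]] := @hitting_set_complete P k d fm a'.
  - by move=> i /and3P[-> ->].
  - rewrite -wt wtE; apply: eq_in_count => i; rewrite mem_iota => /= iP.
    by rewrite /a' iP /=; case: (_ == 0).
  - rewrite -satE (satisfies_ext (a' := a)) // => i iC inp.
    by rewrite /a' szP iC -input_code inp.
  exact: label_game_complete sV ss hs.
case/label_game_sound => s [sV ss hs].
have [a [fa wa]] := hitting_set_sound sV ss hs.
exists C; split=> //; exists a.
by rewrite satE wtE.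
Qed.

Theorem corollary3p12 : W_complete 2 short_breaker_MB.
Proof.
split; first exact: short_breaker_in_W2.
by move=> Q [d [_ hQ]]; apply: fpt_reducible_trans hQ (WCS2_reducible d).
Qed.
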